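(* If $n>2$ is an integer, then $\rho^s_{2,n}=\rho^u_{n,2}=1$.
   Context: A convex body is a compact convex set with nonempty interior. Let $\mathcal O_3$ be the family of convex bodies in $\mathbb R^3$ with $C^\infty$ boundary and $\mathcal P_3$ the family of convex polytopes in $\mathbb R^3$ with nonempty interior. Let $K\in\mathcal O_3\cup\mathcal P_3$ and let $G\in\operatorname{int}K$ be its center of gravity (uniform density). A point $q\in\operatorname{bd}K$ is an equilibrium point of $K$ (with respect to $G$) if the plane through $q$ perpendicular to $q-G$ supports $K$. For $K\in\mathcal O_3$ these are the critical points of $z\mapsto|z-G|$, $z\in\operatorname{bd}K$; such a point is nondegenerate if the Hessian is nonsingular, and is called stable, saddle or unstable if the Hessian has $0$, $1$ or $2$ negative eigenvalues, respectively. For $K\in\mathcal P_3$ an equilibrium point $q$ is nondegenerate if the plane through $q$ perpendicular to $q-G$ meets $K$ exactly in the (unique) face, edge or vertex of $K$ whose relative interior contains $q$; it is then called stable, saddle or unstable if it lies in the relative interior of a face, in the relative interior of an edge, or is a vertex, respectively. Standing assumption: all bodies considered have only nondegenerate equilibrium points with respect to their centers of gravity. $\{S,U\}$ denotes the class of such bodies $K\in\mathcal O_3\cup\mathcal P_3$ with exactly $S$ stable and $U$ unstable points with respect to the center of gravity of $K$. The $S$-robustness $\rho^s(K)$ of $K\in\{S,U\}$ is the infimum of $\operatorname{vol}(K\setminus K')/\operatorname{vol}(K)$ over all such bodies $K'\subseteq K$ that have strictly fewer than $S$ stable points with respect to the center of gravity of $K'$. The $U$-robustness $\rho^u(K)$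 is the infimum of $\operatorname{vol}(K\setminus K')/\operatorname{vol}(K)$ over all such bodies $K'\subseteq K$ that have strictly fewer than $U$ unstable points with respect to the center of gravity of $K'$. (If there is no such $K'$, the value is taken to be $1$.) For a class, $\rho^s_{i,j}=\sup\{\rho^s(K):K\in\{i,j\}\}$ and $\rho^u_{i,j}=\sup\{\rho^u(K):K\in\{i,j\}\}$. *)

(* Defs.v *)
From HB Require Import structures.
From mathcomp Require Import all_boot all_order all_algebra.
From mathcomp Require Import all_classical all_reals all_analysis.

Set Implicit Arguments.
Unset Strict Implicit.
Unset Printing Implicit Defensive.
Import Order.TTheory GRing.Theory Num.Theory.
Import numFieldNormedType.Exports.
Local Open Scope classical_set_scope.
Local Open Scope card_scope.
Local Open Scope ring_scope.

(* The library norm on ['rV[R]_n] is the sup norm; it is used only through the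
   topology and the notion of derivative, which do not depend on the norm. *)
Definition dotv (R : realType) (n : nat) (x y : 'rV[R]_n) : R :=
  \sum_(i < n) x 0 i * y 0 i.

Definition enorm (R : realType) (n : nat) (x : 'rV[R]_n) : R :=
  Num.sqrt (dotv x x).

Definition point3 (R : realType) (t : R * R * R) : 'rV[R]_3 :=
  \row_(i < 3) nth 0 [:: t.1.1; t.1.2; t.2] i.

Definition lebesgue3 (R : realType) :=
  ((@lebesgue_measure R \x @lebesgue_measure R) \x @lebesgue_measure R)%E.

Definition vol (R : realType) (K : set 'rV[R]_3) : \bar R :=
  @lebesgue3 R (@point3 R @^-1` K).

Definition centroid (R : realType) (K : set 'rV[R]_3) : 'rV[R]_3 :=
  \row_(i < 3) ((\int[@lebesgue3 R]_(t in @point3 R @^-1` K) point3 t 0 i)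
                  / fine (vol K)).

Definition bd (T : topologicalType) (K : set T) : set T :=
  closure K `\` interior K.

Definition convex_body (R : realType) (K : set 'rV[R]_3) : Prop :=
  [/\ compact K, convex_set K & interior K !=set0].

(* Recursively: [f] is of class C^(k+1) on the open set [U] when it is
   differentiable on [U] and its directional derivatives are of class C^k. *)
Fixpoint class_C (R : realType) (m : nat) (W : normedModType R) (k : nat)
    (U : set 'rV[R]_m.+1) (f : 'rV[R]_m.+1 -> W) : Prop :=
  match k with
  | 0 => forall x, U x -> {for x, continuous f}
  | k'.+1 => (forall x, U x -> differentiable f x) /\
             (forall v, class_C k' U (fun x => 'D_v f x))
  end.

Definition smooth_on (R : realType) (m : nat) (W : normedModType R)
    (U : set 'rV[R]_m.+1) (f : 'rV[R]_m.+1 -> W) : Prop :=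
  forall k, class_C k U f.

(* [phi] restricted to [U] is a C^oo local parametrization of the surface [M]:
   an immersion which is a homeomorphism onto a relatively open part of [M]. *)
Definition local_param (R : realType) (M : set 'rV[R]_3)
    (U : set 'rV[R]_2) (phi : 'rV[R]_2 -> 'rV[R]_3) : Prop :=
  [/\ open U,
      smooth_on U phi,
      forall u, U u -> row_free ('J phi u),
      {in U &, injective phi} &
      forall V, open V -> V `<=` U ->
        exists2 W : set 'rV[R]_3, open W & phi @` V = M `&` W].

Definition smooth_surface (R : realType) (M : set 'rV[R]_3) : Prop :=
  forall q, M q -> exists U phi u, [/\ local_param M U phi, U u & phi u = q].

Definition conv_hull (R : realType) (n : nat) (v : 'I_n -> 'rV[R]_3) :
    set 'rV[R]_3 :=
  [set x | exists w : 'I_n -> R,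
     [/\ forall i, 0 <= w i, \sum_i w i = 1 & x = \sum_i w i *: v i]].

Definition smooth_body (R : realType) (K : set 'rV[R]_3) : Prop :=
  convex_body K /\ smooth_surface (bd K).

Definition polytope (R : realType) (K : set 'rV[R]_3) : Prop :=
  convex_body K /\ exists (n : nat) (v : 'I_n -> 'rV[R]_3), K = conv_hull v.

Definition plane (R : realType) (p n : 'rV[R]_3) : set 'rV[R]_3 :=
  [set x | dotv n (x - p) = 0].

Definition supports (R : realType) (p n : 'rV[R]_3) (K : set 'rV[R]_3) : Prop :=
  [/\ n != 0, K `&` plane p n !=set0 &
      (forall x, K x -> 0 <= dotv n (x - p)) \/
      (forall x, K x -> dotv n (x - p) <= 0)].

Definition equilibrium (R : realType) (K : set 'rV[R]_3) (c q : 'rV[R]_3) :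
    Prop :=
  bd K q /\ supports q (q - c) K.

Definition hessian (R : realType) (h : 'rV[R]_2 -> R) (u : 'rV[R]_2) :
    'M[R]_2 :=
  \matrix_(i, j) 'D_(delta_mx 0 i) (fun x => 'D_(delta_mx 0 j) h x) u.

(* [H] is the matrix at [q], in some local coordinates of [bd K], of the Hessian
   of the distance from [c].  At a critical point, another choice of coordinates
   replaces [H] by a congruent matrix. *)
Definition dist_hessian (R : realType) (K : set 'rV[R]_3) (c q : 'rV[R]_3)
    (H : 'M[R]_2) : Prop :=
  exists U phi u,
    [/\ local_param (bd K) U phi, U u, phi u = q &
        H = hessian (fun x => enorm (phi x - c)) u].

(* The eigenvalues, counted with multiplicity, are the roots of [char_poly]. *)
Definition neg_eigenvalues (R : realType) (H : 'M[R]_2) (k : nat) : Prop :=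
  exists s : seq R, char_poly H = \prod_(a <- s) ('X - a%:P) /\
                    count (fun a => a < 0) s = k.

Definition smooth_nondegenerate (R : realType) (K : set 'rV[R]_3)
    (c q : 'rV[R]_3) : Prop :=
  exists2 H, dist_hessian K c q H & H \in unitmx.

Definition smooth_index (R : realType) (K : set 'rV[R]_3) (c q : 'rV[R]_3)
    (k : nat) : Prop :=
  exists2 H, dist_hessian K c q H & neg_eigenvalues H k.

Definition aff_hull (R : realType) (A : set 'rV[R]_3) : set 'rV[R]_3 :=
  [set x | exists (n : nat) (v : 'I_n -> 'rV[R]_3) (w : 'I_n -> R),
     [/\ forall i, A (v i), \sum_i w i = 1 & x = \sum_i w i *: v i]].

Definition relint (R : realType) (A : set 'rV[R]_3) : set 'rV[R]_3 :=
  [set x | A x /\ exists2 W : set 'rV[R]_3,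
                    open W /\ W x & W `&` aff_hull A `<=` A].

Definition has_dim (R : realType) (A : set 'rV[R]_3) (d : nat) : Prop :=
  exists (p : 'rV[R]_3) (B : 'M[R]_(d, 3)),
    row_free B /\ aff_hull A = [set p + a *m B | a in [set: 'rV[R]_d]].

(* Vertices, edges and facets alike: the (automatically nonempty and proper)
   faces of dimension 0, 1 and 2. *)
Definition face (R : realType) (K F : set 'rV[R]_3) : Prop :=
  exists p n, supports p n K /\ F = K `&` plane p n.

Definition poly_nondegenerate (R : realType) (K : set 'rV[R]_3)
    (c q : 'rV[R]_3) : Prop :=
  exists F, [/\ face K F, relint F q & K `&` plane q (q - c) = F].

Definition poly_index (R : realType) (K : set 'rV[R]_3) (q : 'rV[R]_3)
    (k : nat) : Prop :=
  exists F, [/\ face K F, relint F q & has_dim F (2 - k)].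

Definition admissible (R : realType) (K : set 'rV[R]_3) : Prop :=
  (smooth_body K /\ forall q, equilibrium K (centroid K) q ->
                              smooth_nondegenerate K (centroid K) q) \/
  (polytope K /\ forall q, equilibrium K (centroid K) q ->
                           poly_nondegenerate K (centroid K) q).

(* The equilibria of index 0, 1, 2 are the stable, saddle and unstable points. *)
Definition equilibria (R : realType) (k : nat) (K : set 'rV[R]_3) :
    set 'rV[R]_3 :=
  [set q | equilibrium K (centroid K) q /\
     ((smooth_body K /\ smooth_nondegenerate K (centroid K) q /\
       smooth_index K (centroid K) q k) \/
      (polytope K /\ poly_nondegenerate K (centroid K) q /\
       poly_index K q k))].

Definition stable_points (R : realType) (K : set 'rV[R]_3) := equilibria 0 K.
Definition unstable_points (R : realType) (K : set 'rV[R]_3) := equilibria 2 K.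

Definition body_class (R : realType) (S U : nat) : set (set 'rV[R]_3) :=
  [set K | [/\ admissible K, stable_points K #= `I_S &
               unstable_points K #= `I_U]].

Definition removed_fraction (R : realType) (K K' : set 'rV[R]_3) : R :=
  fine (vol (K `\` K')) / fine (vol K).

(* [~~ (A #<= B)] says that [B] has strictly smaller cardinality than [A]. *)
Definition truncations (R : realType) (pts : set 'rV[R]_3 -> set 'rV[R]_3)
    (K : set 'rV[R]_3) : set (set 'rV[R]_3) :=
  [set K' | [/\ admissible K', K' `<=` K & ~~ (pts K #<= pts K')]].

(* [inf set0] is 0, whence the case distinction. *)
Definition robustness (R : realType) (pts : set 'rV[R]_3 -> set 'rV[R]_3)
    (K : set 'rV[R]_3) : R :=
  if truncations pts K == set0 then 1
  else inf [set removed_fraction K K' | K' in truncations pts K].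

Definition S_robustness (R : realType) (K : set 'rV[R]_3) : R :=
  robustness (@stable_points R) K.
Definition U_robustness (R : realType) (K : set 'rV[R]_3) : R :=
  robustness (@unstable_points R) K.

Definition rho_s (R : realType) (i j : nat) : R :=
  sup [set S_robustness K | K in @body_class R i j].
Definition rho_u (R : realType) (i j : nat) : R :=
  sup [set U_robustness K | K in @body_class R i j].

(* Main.v *)
(* The supremum 1 is approached by bodies so thin that every admissible subbody of
   non-negligible relative volume still has two equilibria of the critical type.

   Stable points: the frustum of height [h] over a regular n-gon has its two base
   centres as stable points and the [n] vertices of the larger base as unstable
   points.  If [K'] inside it has volume more than [48 h^2], it contains the
   horizontal disc of radius [2 h] around its centroid (otherwise a separating
   functional and a Markov inequality confine half of [K'] to a thin slab), while
   it reaches at most [h] above and below.  Hence the distance from the centroid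
   attains a minimum strictly inside the upper half of [bd K'], and another one
   inside the lower half.  As the frustum has volume at least [h / 16], at least a
   fraction [1 - 768 h] must be removed to lose one of them.

   Unstable points: a long double pyramid over the n-gon whose lower apex is much
   closer has exactly the [n] upper facets stable and its two apexes unstable.  A
   subbody of volume more than 600 extends far beyond its centroid on both sides,
   so the distance has a maximum over each half.

   A local extremum of the distance is of the expected type: on a smooth boundary
   its Hessian is semidefinite, hence definite by nondegeneracy, and on a polytope
   its face must be a vertex, respectively a facet.  The centroids of the frustum
   and of the bipyramid lie on the axis because rotation by [2 pi / n] preserves
   volume. *)

Require Import Defs.
From HB Require Import structures.
From mathcomp Require Import all_boot all_order all_algebra.
From mathcomp Require Import all_classical all_reals all_analysis.
From mathcomp Require Import measurable_realfun ring lra zify.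

Set Implicit Arguments.
Unset Strict Implicit.
Unset Printing Implicit Defensive.
Import Order.TTheory GRing.Theory Num.Theory.
Import numFieldNormedType.Exports.
Local Open Scope classical_set_scope.
Local Open Scope ring_scope.
Local Open Scope card_scope.

(** A truncation [K'] is known only through its volume and the body containing it: it may be smooth
    or a polytope, and its centroid is its own. So every estimate is made relative to the centroid
    of [K'], from a bounding box and the fact that a linear functional has mean zero about the
    centroid. The removable fractions are controlled by a mismatch of scales: a slab of width of
    order [h] has volume of order [h ^+ 2] in a plate of volume of order [h], and a slab of bounded
    height has bounded volume in a spindle of volume of order [M]. The shapes are dictated by the
    exact counts that the classes demand. A thin regular prism would have [2 * n] unstable vertices;
    shrinking the top base disqualifies the upper ones. A symmetric long bipyramid would have
    [2 * n] stable facets; once the centroid is high above the rim, the perpendicular from it to the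
    plane of a lower facet misses that facet. Polytopes are convenient because support, face and
    index are all decided by finitely many vertex inequalities. *)

Lemma continuous_sum (R : realType) (V : normedModType R) (T : topologicalType)
  (I : Type) (s : seq I) (F : I -> T -> V) :
  (forall i, continuous (F i)) -> continuous (fun x => \sum_(i <- s) F i x).
Proof.
move=> cF; elim: s => [|i s IH].
  rewrite (_ : (fun x => _) = cst 0); first exact: cst_continuous.
  by apply/funext => x; rewrite big_nil.
rewrite (_ : (fun x => _) = (fun x => F i x + \sum_(j <- s) F j x)).
  by move=> x; apply: (@cvgD _ _ _ (nbhs x) _ (F i)); [exact: cF|exact: IH].
by apply/funext => x; rewrite big_cons.
Qed.

(** * The Euclidean structure *)

Section Dot.
Variables (R : realType) (n : nat).
Implicit Types x y z : 'rV[R]_n.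

Lemma dotvC x y : dotv x y = dotv y x.
Proof. by apply: eq_bigr => i _; rewrite mulrC. Qed.

Lemma dotvDl x y z : dotv (x + y) z = dotv x z + dotv y z.
Proof. by rewrite /dotv -big_split; apply: eq_bigr => i _; rewrite mxE mulrDl. Qed.

Lemma dotvDr x y z : dotv x (y + z) = dotv x y + dotv x z.
Proof. by rewrite ![dotv x _]dotvC dotvDl. Qed.

Lemma dotvZl a x y : dotv (a *: x) y = a * dotv x y.
Proof. by rewrite /dotv mulr_sumr; apply: eq_bigr => i _; rewrite mxE mulrA. Qed.

Lemma dotvZr a x y : dotv x (a *: y) = a * dotv x y.
Proof. by rewrite dotvC dotvZl dotvC. Qed.

Lemma dotvNl x y : dotv (- x) y = - dotv x y.
Proof. by rewrite -scaleN1r dotvZl mulN1r. Qed.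

Lemma dotvNr x y : dotv x (- y) = - dotv x y.
Proof. by rewrite dotvC dotvNl dotvC. Qed.

Lemma dotvBl x y z : dotv (x - y) z = dotv x z - dotv y z.
Proof. by rewrite dotvDl dotvNl. Qed.

Lemma dotvBr x y z : dotv x (y - z) = dotv x y - dotv x z.
Proof. by rewrite dotvDr dotvNr. Qed.

Lemma dot0v x : dotv 0 x = 0.
Proof. by rewrite -(scale0r x) dotvZl mul0r. Qed.

Lemma dotv0 x : dotv x 0 = 0.
Proof. by rewrite dotvC dot0v. Qed.

Lemma dotv_sumr (I : finType) x (a : I -> R) (v : I -> 'rV[R]_n) :
  dotv x (\sum_i a i *: v i) = \sum_i a i * dotv x (v i).
Proof.
elim/big_ind2: _ => [|y s z t <- <-|i _]; first exact: dotv0.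
- exact: dotvDr.
- exact: dotvZr.
Qed.

Lemma dotv_average (I : finType) x y (a : I -> R) (v : I -> 'rV[R]_n) : \sum_i a i = 1 ->
  dotv x (\sum_i a i *: v i - y) = \sum_i a i * dotv x (v i - y).
Proof.
move=> a1; rewrite dotvBr dotv_sumr -[dotv x y]mul1r -a1 mulr_suml -sumrB.
by apply: eq_bigr => j _; rewrite dotvBr mulrBr.
Qed.

Lemma dotvv_ge0 x : 0 <= dotv x x.
Proof. by apply: sumr_ge0 => i _; rewrite -expr2 sqr_ge0. Qed.

Lemma dotvv_eq0 x : (dotv x x == 0) = (x == 0).
Proof.
apply/idP/eqP => [|->]; last by rewrite dot0v.
rewrite psumr_eq0 => [/allP h|i _]; last by rewrite -expr2 sqr_ge0.
apply/rowP => i; rewrite mxE; apply/eqP.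
by have := h i (mem_index_enum _); rewrite mulf_eq0 orbb.
Qed.

Lemma dotvv_gt0 x : (0 < dotv x x) = (x != 0).
Proof. by rewrite lt_neqAle dotvv_ge0 eq_sym dotvv_eq0 andbT. Qed.

Lemma dotv_cauchy x y : dotv x y ^+ 2 <= dotv x x * dotv y y.
Proof.
have [->|y0] := eqVneq y 0; first by rewrite !dotv0 mulr0 expr2 mulr0.
have yy : 0 < dotv y y by rewrite dotvv_gt0.
have := dotvv_ge0 (dotv y y *: x - dotv x y *: y).
rewrite dotvBl !dotvBr !dotvZl !dotvZr [dotv y x]dotvC.
have -> : dotv y y * (dotv y y * dotv x x) - dotv y y * (dotv x y * dotv x y) -
  (dotv x y * (dotv y y * dotv x y) - dotv x y * (dotv x y * dotv y y)) =
  dotv y y * (dotv x x * dotv y y - dotv x y ^+ 2) by ring.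
by rewrite pmulr_rge0// subr_ge0.
Qed.

Lemma enorm_sqr x : enorm x ^+ 2 = dotv x x.
Proof. by rewrite sqr_sqrtr// dotvv_ge0. Qed.

Lemma enorm_ge0 x : 0 <= enorm x.
Proof. exact: sqrtr_ge0. Qed.

Lemma dotv_le_enorm x y : dotv x y <= enorm x * enorm y.
Proof.
have [h|h] := leP (dotv x y) 0; first by rewrite (le_trans h)// mulr_ge0 ?enorm_ge0.
rewrite -(ler_pXn2r (ltn0Sn 1)) ?nnegrE ?(ltW h) ?mulr_ge0 ?enorm_ge0//.
by rewrite exprMn !enorm_sqr dotv_cauchy.
Qed.

Lemma coord_le_enorm x i : `|x 0 i| <= enorm x.
Proof.
rewrite -(ler_pXn2r (ltn0Sn 1)) ?nnegrE ?enorm_ge0// enorm_sqr real_normK ?num_real//.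
rewrite /dotv (bigD1 i)//= expr2 lerDl; apply: sumr_ge0 => j _.
by rewrite -expr2 sqr_ge0.
Qed.

Lemma continuous_dotv (f g : 'rV[R]_n -> 'rV[R]_n) :
  continuous f -> continuous g -> continuous (fun x => dotv (f x) (g x)).
Proof.
move=> cf cg; apply: continuous_sum => i x.
have hf : {for x, continuous ((fun y : 'rV[R]_n => y 0 i) \o f)}.
  by apply: continuous_comp; [exact: cf|exact: coord_continuous].
have hg : {for x, continuous ((fun y : 'rV[R]_n => y 0 i) \o g)}.
  by apply: continuous_comp; [exact: cg|exact: coord_continuous].
exact: (continuousM hf hg).
Qed.

Lemma continuous_subr (c : 'rV[R]_n) : continuous (fun x : 'rV[R]_n => x - c).
Proof. by move=> x; apply: continuousB; [exact: cvg_id|exact: cst_continuous]. Qed.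

Lemma continuous_dotvr (w c : 'rV[R]_n) : continuous (fun x => dotv w (x - c)).
Proof.
by apply: continuous_dotv; [exact: cst_continuous|exact: continuous_subr].
Qed.

Lemma open_dot_lt (w c : 'rV[R]_n) b : open [set x | dotv w (x - c) < b].
Proof.
have := @open_comp _ _ (fun x => dotv w (x - c)) [set y | y < b].
by apply; [move=> x _; exact: continuous_dotvr|exact: open_lt].
Qed.

Lemma open_dot_gt (w c : 'rV[R]_n) b : open [set x | b < dotv w (x - c)].
Proof.
have := @open_comp _ _ (fun x => dotv w (x - c)) [set y | b < y].
by apply; [move=> x _; exact: continuous_dotvr|exact: open_gt].
Qed.

Lemma closed_dot_ge (w c : 'rV[R]_n) b : closed [set x | b <= dotv w (x - c)].
Proof.
have := @closed_comp _ _ (fun x => dotv w (x - c)) [set y | b <= y].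
by apply; [move=> x _; exact: continuous_dotvr|exact: closed_ge].
Qed.

End Dot.

Lemma continuous_line (R : realType) (V : normedModType R) (p w : V) :
  continuous (fun s : R => p + s *: w).
Proof.
move=> s; apply: (@cvgD _ _ _ (nbhs s) _ (fun=> p) (fun s => s *: w)); first exact: cvg_cst.
exact: scalel_continuous.
Qed.

Lemma nbhs_line (R : realType) (V : normedModType R) (p w : V) (A : set V) : nbhs p A ->
  exists2 e : R, 0 < e & forall s, `|s| < e -> A (p + s *: w).
Proof.
move=> pA; have : \forall s \near (0 : R), A (p + s *: w).
  by apply: (@continuous_line R V p w 0); rewrite /= scale0r addr0.
move=> /nbhs_ballP[e /= e0 he]; exists e => // s se; apply: he.
by rewrite /ball/= sub0r normrN.
Qed.

Section Dot3.
Variable R : realType.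
Implicit Types x y : 'rV[R]_3.

Definition i1 : 'I_3 := @Ordinal 3 1 isT.
Definition i2 : 'I_3 := @Ordinal 3 2 isT.

Lemma dotv3 x y : dotv x y = x 0 0 * y 0 0 + x 0 i1 * y 0 i1 + x 0 i2 * y 0 i2.
Proof.
rewrite /dotv !big_ord_recl big_ord0 addr0 addrA.
by congr (_ * _ + _ * _ + _ * _); congr (_ _ _); exact: val_inj.
Qed.

Lemma ord3_ind (P : 'I_3 -> Prop) : P 0 -> P i1 -> P i2 -> forall i, P i.
Proof.
move=> h0 hh1 h2 [[|[|[|//]]] h].
- by rewrite (_ : Ordinal h = 0)//; exact: val_inj.
- by rewrite (_ : Ordinal h = i1)//; exact: val_inj.
- by rewrite (_ : Ordinal h = i2)//; exact: val_inj.
Qed.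

Lemma row3P x y : x 0 0 = y 0 0 -> x 0 i1 = y 0 i1 -> x 0 i2 = y 0 i2 -> x = y.
Proof. by move=> h0 h1 h2; apply/rowP; exact: ord3_ind. Qed.

Definition vec3 (a b c : R) : 'rV[R]_3 := point3 (a, b, c).

Lemma vec3E a b c : (vec3 a b c 0 0 = a) * (vec3 a b c 0 i1 = b) * (vec3 a b c 0 i2 = c).
Proof. by rewrite !mxE. Qed.

Lemma vec3K x : vec3 (x 0 0) (x 0 i1) (x 0 i2) = x.
Proof. by apply: row3P; rewrite vec3E. Qed.

Lemma point3E (t : R * R * R) :
  (point3 t 0 0 = t.1.1) * (point3 t 0 i1 = t.1.2) * (point3 t 0 i2 = t.2).
Proof. by rewrite !mxE. Qed.

(** Identity minus rotation has determinant [(1 - c) ^+ 2 + s ^+ 2 = 2 - 2 * c], nonzero since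
    [c != 1]. This serves both the centroid and the sums over the polygon. *)
Lemma rotation_fixed (c s a b : R) : c != 1 -> c ^+ 2 + s ^+ 2 = 1 ->
  a = c * a - s * b -> b = s * a + c * b -> a = 0 /\ b = 0.
Proof.
move=> c1 cs ha hb; have key (x : R) : (1 - c) * ((1 - c) * x) + s * (s * x) = (2 - 2 * c) * x.
  have -> : (2 - 2 * c) * x = (1 + (c ^+ 2 + s ^+ 2) - 2 * c) * x by rewrite cs; ring.
  by ring.
have q : (2 - 2 * c) != 0 by apply: contra c1 => /eqP h; apply/eqP; lra.
have h0 : (1 - c) * a = - (s * b) by lra.
have h1 : (1 - c) * b = s * a by lra.
have h2 : s * b = - ((1 - c) * a) by lra.
split; apply: (mulfI q); rewrite mulr0 -key; first by rewrite h0 -h1; ring.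
by rewrite h1 h2; ring.
Qed.

End Dot3.

Lemma lebesgue_translation (R : realType) (b : R) (A : set (measurableTypeR R)) :
  measurable A -> lebesgue_measure ((fun x => x + b) @^-1` A) = lebesgue_measure A.
Proof.
move=> mA; pose f (x : measurableTypeR R) : measurableTypeR R := x + b.
have mf : measurable_fun setT f by exact: measurable_funD.
suff : lebesgue_measure A = pushforward lebesgue_measure f A by [].
unshelve apply: lebesgue_measure_unique => // X [[x y]] _ <-.
suff : @lebesgue_measure R `]x, y] = lebesgue_measure (f @^-1` `]x, y])%E by [].
have -> : f @^-1` `]x, y] = `]x - b, y - b]%classic.
  by apply/seteqP; split=> z /=; rewrite !in_itv/= ltrBlDr lerBrDr.
by rewrite !lebesgue_measure_itv/= !lte_fin ltrD2r -!EFinD opprD opprK addrACA addNr addr0.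
Qed.

(** * Lebesgue measure and the centroid *)

Section Lebesgue3.
Variable R : realType.
Local Notation mu := (@lebesgue_measure R).
Local Notation mu3 := (@lebesgue3 R).

Definition box (a b : R * R * R) : set (R * R * R) :=
  (`]a.1.1, b.1.1[ `*` `]a.1.2, b.1.2[) `*` `]a.2, b.2[.

Lemma measurable_box a b :
  measurable (box a b : set (measurableTypeR R * measurableTypeR R * measurableTypeR R)).
Proof. by apply: measurableX => //; apply: measurableX. Qed.

Lemma lebesgue2X (A B : set (measurableTypeR R)) : measurable A -> measurable B ->
  ((mu \x mu) (A `*` B) = mu A * mu B)%E.
Proof. exact: product_measure1E. Qed.

Lemma lebesgue3X (A : set (measurableTypeR R * measurableTypeR R))
  (B : set (measurableTypeR R)) : measurable A -> measurable B ->
  (mu3 (A `*` B) = (mu \x mu) A * mu B)%E.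
Proof. exact: product_measure1E. Qed.

Lemma lebesgue3_box (a b : R * R * R) :
  a.1.1 < b.1.1 -> a.1.2 < b.1.2 -> a.2 < b.2 ->
  mu3 (box a b) = ((b.1.1 - a.1.1) * (b.1.2 - a.1.2) * (b.2 - a.2))%:E.
Proof.
move=> h1 h2 h3; rewrite lebesgue3X//; last exact: measurableX.
rewrite lebesgue2X// !lebesgue_measure_itv/= !lte_fin h1 h2 h3.
by rewrite -!EFinB -!EFinM.
Qed.

Lemma open_box (W : set 'rV[R]_3) t : open W -> W (point3 t) ->
  exists2 e : R, 0 < e &
    box (t.1.1 - e, t.1.2 - e, t.2 - e) (t.1.1 + e, t.1.2 + e, t.2 + e)
      `<=` @point3 R @^-1` W.
Proof.
move=> oW Wt; have /nbhs_ballP[e/= e0 eW] : nbhs (point3 t) W by exact: open_nbhs_nbhs.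
exists e => // -[[x y] z] /=; rewrite /box/= !in_itv/= => -[[/andP[h1 h2] /andP[h3 h4]] /andP[h5 h6]].
apply: eW; split=> // i j; rewrite !mxE /ball/=.
by case: j => -[|[|[|//]]]/= _; rewrite ltr_distlC; apply/andP.
Qed.

(** Measurability of triples refers to the product sigma-algebra, openness to the topology of row
    vectors; countably many boxes with rational corners link the two. *)
Lemma open_point3_measurable (W : set 'rV[R]_3) : open W ->
  measurable (@point3 R @^-1` W : set (measurableTypeR R * measurableTypeR R * measurableTypeR R)).
Proof.
move=> oW.
pose D (q : (rat * rat * rat) * (rat * rat * rat)) : set (R * R * R) := box (ratr q.1.1.1, ratr q.1.1.2, ratr q.1.2)
   (ratr q.2.1.1, ratr q.2.1.2, ratr q.2.2).
(* Boxes that leave [W] are replaced by the empty set, so that the union can run over all rational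
   corners. *)
pose F q := if pselect (D q `<=` @point3 R @^-1` W) then D q else set0.
have -> : @point3 R @^-1` W = \bigcup_q F q.
  apply/seteqP; split; last first.
    by move=> t [q _]; rewrite /F; case: pselect => // h /h.
  move=> t /= Wt; have [e e0 eW] := open_box oW Wt.
  have lo (x : R) : exists q : rat, x - e < ratr q < x.
    have [|q] := @rat_in_itvoo R (x - e) x; first by lra.
    by rewrite in_itv/=; exists q.
  have up (x : R) : exists q : rat, x < ratr q < x + e.
    have [|q] := @rat_in_itvoo R x (x + e); first by lra.
    by rewrite in_itv/=; exists q.
  have [a1 /andP[u1 u2]] := lo t.1.1; have [a2 /andP[u3 u4]] := lo t.1.2.
  have [a3 /andP[u5 u6]] := lo t.2; have [b1 /andP[v1 v2]] := up t.1.1.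
  have [b2 /andP[v3 v4]] := up t.1.2; have [b3 /andP[v5 v6]] := up t.2.
  exists ((a1, a2, a3), (b1, b2, b3)) => //; rewrite /F; case: pselect => [?|].
    by rewrite /D /box/= !in_itv/= u2 u4 u6 v1 v3 v5.
  case=> s; rewrite /D /box/= !in_itv/= => -[[/andP[s1 s2] /andP[s3 s4]] /andP[s5 s6]].
  by apply: eW; rewrite /box/= !in_itv/=; split; [split|]; lra.
apply: countable_bigcupT_measurable => // q.
by rewrite /F; case: pselect => ?; [exact: measurable_box|exact: measurable0].
Qed.

Lemma closed_point3_measurable (W : set 'rV[R]_3) : closed W ->
  measurable (@point3 R @^-1` W : set (measurableTypeR R * measurableTypeR R * measurableTypeR R)).
Proof.
move=> cW; rewrite -[W]setCK preimage_setC; apply: measurableC.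
by apply: (@open_point3_measurable (~` W)); rewrite openC.
Qed.

Lemma point3_surj (x : 'rV[R]_3) : exists t, point3 t = x.
Proof.
by exists (x 0 0, x 0 i1, x 0 i2); exact: vec3K.
Qed.

Lemma vol_open_gt0 (W : set 'rV[R]_3) : open W -> W !=set0 -> (0 < vol W)%E.
Proof.
move=> oW [x]; have [t <-] := point3_surj x => Wt; have [e e0 eW] := open_box oW Wt.
apply: (@lt_le_trans _ _ (mu3 (box (t.1.1 - e, t.1.2 - e, t.2 - e) (t.1.1 + e, t.1.2 + e, t.2 + e)))).
  rewrite lebesgue3_box/= ?lte_fin; [by rewrite !mulr_gt0//; lra|lra..].
apply: le_measure => //; rewrite inE; first exact: measurable_box.
exact: open_point3_measurable.
Qed.

End Lebesgue3.

(** Under its own name the planar measure can carry a sigma-finite instance, needed to apply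
    uniqueness of product measures with it as a factor. *)
Definition lebesgue2 (R : realType) := (@lebesgue_measure R \x @lebesgue_measure R)%E.

HB.instance Definition _ (R : realType) := Measure.on (@lebesgue2 R).

Lemma lebesgue2_sigma_finite (R : realType) : sigma_finite setT (@lebesgue2 R).
Proof.
have /sigma_finiteP[F [TF ndF Foo]] := sigma_finiteT (@lebesgue_measure R).
exists (fun n => F n `*` F n).
  rewrite -setXTT TF predeqE => -[x y]; split; last by move=> [n _ []/= ? ?]; split; exists n.
  move=> [/= [n _ Fnx] [k _ Fky]]; exists (maxn n k) => //; split.
  - by move: x Fnx; exact/subsetPset/ndF/leq_maxl.
  - by move: y Fky; exact/subsetPset/ndF/leq_maxr.
move=> k; have [mF Fk] := Foo k; split; first exact: measurableX.
have -> : lebesgue2 (F k `*` F k) = (lebesgue_measure (F k) * lebesgue_measure (F k))%E.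
  exact: lebesgue2X.
by rewrite lte_mul_pinfty// ge0_fin_numE.
Qed.

HB.instance Definition _ (R : realType) := Measure_isSigmaFinite.Build _ _ _ (@lebesgue2 R)
  (@lebesgue2_sigma_finite R).

(** * Invariance of volume under rotations about the vertical axis *)

Section Lebesgue_maps.
Variable R : realType.
Local Notation mu := (@lebesgue_measure R).
Local Notation mu2 := (@lebesgue2 R).
Local Notation mu3 := (@lebesgue3 R).
Local Notation R1 := (measurableTypeR R).

Lemma lebesgue2E (A : set (R1 * R1)) : mu2 A = (\int[mu]_x mu (xsection A x))%E.
Proof. by []. Qed.

Lemma lebesgue2E' (A : set (R1 * R1)) : measurable A ->
  mu2 A = (\int[mu]_y mu (ysection A y))%E.
Proof.
move=> mA; transitivity ((mu \x^ mu) A)%E; last by [].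
apply: product_measure_unique => // B C mB mC; exact: product_measure2E.
Qed.

Lemma lebesgue3E' (A : set (R1 * R1 * R1)) : measurable A ->
  mu3 A = (\int[mu]_y mu2 (ysection A y))%E.
Proof.
move=> mA; transitivity ((mu2 \x^ mu) A)%E; last by [].
have H := @product_measure_unique _ _ _ _ R mu2 mu (mu2 \x^ mu)%E.
apply: H => // B C mB mC; exact: product_measure2E.
Qed.

Definition shear1 (c : R) (p : R1 * R1) : R1 * R1 := (p.1, p.2 + c * p.1).
Definition shear2 (c : R) (p : R1 * R1) : R1 * R1 := (p.1 + c * p.2, p.2).

Lemma measurable_shear1 c : measurable_fun setT (shear1 c).
Proof.
apply: measurable_fun_pair => //; apply: measurable_funD => //.
by apply: measurable_funM.
Qed.

Lemma measurable_shear2 c : measurable_fun setT (shear2 c).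
Proof.
apply: measurable_fun_pair => //; apply: measurable_funD => //.
by apply: measurable_funM.
Qed.

(** On each vertical line the shear is a translation, so Fubini reduces the claim to translation
    invariance in dimension one. *)
Lemma lebesgue2_shear1 c A : measurable A -> mu2 (shear1 c @^-1` A) = mu2 A.
Proof.
move=> mA; rewrite !lebesgue2E; apply: eq_integral => x _.
rewrite -[in RHS](lebesgue_translation (c * x)); last exact: measurable_xsection.
by congr (mu _); apply/seteqP; split=> y; rewrite /xsection/= !inE.
Qed.

Lemma measurable_preimageT d1 d2 (T1 : measurableType d1) (T2 : measurableType d2)
  (f : T1 -> T2) A : measurable_fun setT f -> measurable A -> measurable (f @^-1` A).
Proof. by move=> mf mA; rewrite -[X in measurable X]setTI; apply: mf. Qed.

Lemma lebesgue2_shear2 c A : measurable A -> mu2 (shear2 c @^-1` A) = mu2 A.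
Proof.
move=> mA; rewrite !lebesgue2E'//; last exact: measurable_preimageT (measurable_shear2 c) mA.
apply: eq_integral => x _.
rewrite -[in RHS](lebesgue_translation (c * x)); last exact: measurable_ysection.
by congr (mu _); apply/seteqP; split=> y; rewrite /ysection/= !inE.
Qed.

Definition rot2 (c s : R) (p : R1 * R1) : R1 * R1 :=
  (c * p.1 - s * p.2, s * p.1 + c * p.2).

Lemma measurable_rot2 c s : measurable_fun setT (rot2 c s).
Proof.
apply: measurable_fun_pair => //.
  apply: measurable_funB => //; exact: measurable_funM.
apply: measurable_funD => //; exact: measurable_funM.
Qed.

(* Three shears compose to a rotation, and each preserves area by Fubini. *)
Lemma lebesgue2_rot c s A : s != 0 -> c ^+ 2 + s ^+ 2 = 1 -> measurable A ->
  mu2 (rot2 c s @^-1` A) = mu2 A.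
Proof.
(* For [c = cos t] and [s = sin t] this [k] is [- tan (t / 2)], the outer shear factor of the
   factorisation; [s0] makes it defined. *)
move=> s0 cs mA; pose k := (c - 1) / s.
have -> : rot2 c s = shear2 k \o shear1 s \o shear2 k.
  have ks : k * s = c - 1 by rewrite /k; field.
  have kc : k * (1 + c) = - s.
    apply: (mulIf s0); rewrite mulrAC ks; have -> : - s * s = - s ^+ 2 by ring.
    by rewrite -[s ^+ 2](addKr (c ^+ 2)) cs; ring.
  apply/funext => -[x y]; rewrite /rot2 /shear1 /shear2/=; congr (_, _).
    have -> : x + k * y + k * (y + s * (x + k * y)) =
      x + k * y + k * s * x + k * (1 + k * s) * y by ring.
    rewrite ks; have -> : x + k * y + (c - 1) * x + k * (1 + (c - 1)) * y =
      c * x + k * (1 + c) * y by ring.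
    by rewrite kc; ring.
  have -> : y + s * (x + k * y) = s * x + (1 + k * s) * y by ring.
  by congr (_ + _ * _); rewrite ks; ring.
rewrite !comp_preimage lebesgue2_shear2 ?lebesgue2_shear1 ?lebesgue2_shear2//.
  exact: measurable_preimageT (measurable_shear2 k) mA.
apply: measurable_preimageT (measurable_shear1 s) _.
exact: measurable_preimageT (measurable_shear2 k) mA.
Qed.

Definition prod12 (T : R1 * R1 -> R1 * R1) (p : R1 * R1 * R1) : R1 * R1 * R1 :=
  (T p.1, p.2).

Lemma lebesgue3_prod12 T A : measurable_fun setT T ->
  (forall B, measurable B -> mu2 (T @^-1` B) = mu2 B) -> measurable A ->
  mu3 (prod12 T @^-1` A) = mu3 A.
Proof.
move=> mT T2 mA.
have mT3 : measurable_fun setT (prod12 T).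
  by apply: measurable_fun_pair => //; exact: measurableT_comp.
have mTA := measurable_preimageT mT3 mA.
rewrite (lebesgue3E' mTA) (lebesgue3E' mA).
apply: eq_integral => z _.
rewrite -[in RHS]T2; last exact: measurable_ysection.
by congr (mu2 _); apply/seteqP; split=> y; rewrite /ysection/= !inE.
Qed.

(** Change of variables without a Jacobian: the pushforward of the volume under [T] agrees with the
    volume on measurable sets. *)
Lemma Rintegral_invariant (T : R1 * R1 * R1 -> R1 * R1 * R1) f D :
  measurable_fun setT T -> (forall A, measurable A -> mu3 (T @^-1` A) = mu3 A) ->
  measurable D -> T @^-1` D = D -> measurable_fun setT f ->
  mu3.-integrable D (EFin \o f \o T) ->
  \int[mu3]_(x in D) f (T x) = \int[mu3]_(x in D) f x.
Proof.
move=> mT T3 mD TD mf intfT.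
have mfE : measurable_fun setT (EFin \o f) by exact/measurable_EFinP.
rewrite -{1}TD in intfT; have H := integral_pushforward mT mfE intfT mD.
have E : (\int[pushforward mu3 T]_(x in D) (EFin \o f) x = \int[mu3]_(x in D) (EFin \o f) x)%E.
  by apply: (@eq_measure_integral _ _ _ _ mu3) => A mA _; exact: T3.
by move: H; rewrite E TD /Rintegral => ->.
Qed.

End Lebesgue_maps.

(** * Volume and centroid of convex bodies *)

Section Centroid.
Variable R : realType.
Local Notation mu := (@lebesgue_measure R).
Local Notation mu3 := (@lebesgue3 R).
Local Notation R1 := (measurableTypeR R).
Local Notation pre K := (@point3 R @^-1` K : set (R1 * R1 * R1)).
Implicit Types (K : set 'rV[R]_3) (w c : 'rV[R]_3).

Lemma compact_closed_rV K : compact K -> closed K.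
Proof. by apply: compact_closed; exact: norm_hausdorff. Qed.

Lemma compact_measurable_pre K : compact K -> measurable (pre K).
Proof. by move=> /compact_closed_rV; exact: closed_point3_measurable. Qed.

Lemma compact_coord_bound K : compact K ->
  exists2 M : R, 0 < M & forall x, K x -> forall i, `|x 0 i| <= M.
Proof.
move=> /compact_bounded[M [Mreal hM]]; exists (`|M| + 1); first by rewrite ltr_wpDl.
move=> x Kx i; have /(_ x Kx) : forall x, K x -> `|x| <= `|M| + 1.
  by apply: hM; rewrite (le_lt_trans (ler_norm M))// ltrDl.
by apply: le_trans; rewrite {2}/Num.norm/= mx_normrE; apply: (le_bigmax _ _ (0, i)).
Qed.

Lemma vol_lty K : compact K -> (vol K < +oo)%E.
Proof.
move=> cK; have [M M0 hM] := compact_coord_bound cK.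
pose N := M + 1; have N0 : 0 < N by rewrite addr_gt0.
apply: (@le_lt_trans _ _ (mu3 (box (- N, - N, - N) (N, N, N)))); last first.
  by rewrite lebesgue3_box/= ?ltry//; lra.
apply: le_measure; rewrite ?inE; [exact: compact_measurable_pre|exact: measurable_box|].
move=> -[[x y] z] /= Kt; have := hM _ Kt; rewrite /box/= !in_itv/= => h.
have := h 0; have := h i1; have := h i2; rewrite !mxE/= /N !ler_norml.
by move=> /andP[? ?] /andP[? ?] /andP[? ?]; split; [split|]; lra.
Qed.

Lemma vol_fin K : compact K -> vol K \is a fin_num.
Proof. by move=> cK; rewrite ge0_fin_numE ?vol_lty// measure_ge0. Qed.

Lemma vol_ge0 K : 0 <= fine (vol K).
Proof. by apply: fine_ge0; rewrite /vol measure_ge0. Qed.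

Lemma vol_gt0 K : convex_body K -> 0 < fine (vol K).
Proof.
move=> [cK _ [x Kx]]; rewrite fine_gt0// vol_lty// andbT.
apply: (@lt_le_trans _ _ (vol (interior K))).
  by apply: vol_open_gt0; [exact: open_interior|exists x].
apply: le_measure; rewrite ?inE; [|exact: compact_measurable_pre|].
  by apply: (@open_point3_measurable R (interior K)); exact: open_interior.
by move=> t /=; exact: interior_subset.
Qed.

Lemma measurable_coord (i : 'I_3) :
  measurable_fun setT (fun t : R1 * R1 * R1 => point3 t 0 i : R1).
Proof.
case: i => -[|[|[|//]]] h.
- rewrite (_ : (fun t => _) = fst \o fst); last by apply/funext => t; rewrite mxE.
  exact: (measurableT_comp (@measurable_fst _ _ _ _) (@measurable_fst _ _ _ _)).
- rewrite (_ : (fun t => _) = snd \o fst); last by apply/funext => t; rewrite mxE.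
  exact: (measurableT_comp (@measurable_snd _ _ _ _) (@measurable_fst _ _ _ _)).
- rewrite (_ : (fun t => _) = snd); last by apply/funext => t; rewrite mxE.
  exact: measurable_snd.
Qed.

Lemma measurable_dot w c :
  measurable_fun setT (fun t : R1 * R1 * R1 => dotv w (point3 t - c) : R1).
Proof.
rewrite (_ : (fun t => _) = (fun t => w 0 0 * (point3 t - c) 0 0 +
  w 0 i1 * (point3 t - c) 0 i1 + w 0 i2 * (point3 t - c) 0 i2)); last first.
  by apply/funext => t; rewrite dotv3.
have m i : measurable_fun setT (fun t : R1 * R1 * R1 => w 0 i * (point3 t - c) 0 i : R1).
  apply: measurable_funM => //.
  rewrite (_ : (fun t => _) = (fun t => point3 t 0 i + (- c) 0 i)); last first.
    by apply/funext => t; rewrite mxE.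
  by apply: measurable_funD; [exact: measurable_coord|].
exact: (measurable_funD (measurable_funD (m 0) (m i1)) (m i2)).
Qed.

Lemma integrable_dot K w c : compact K ->
  mu3.-integrable (pre K) (EFin \o (fun t => dotv w (point3 t - c))).
Proof.
move=> cK; have [M M0 hM] := compact_coord_bound cK.
apply: measurable_bounded_integrable; [exact: compact_measurable_pre|exact: vol_lty| |].
  by apply: measurable_funTS; exact: measurable_dot.
exists (\sum_i `|w 0 i| * (M + `|c 0 i|)); split; first exact: num_real.
move=> y /ltW hy t Kt; apply: le_trans hy; apply: le_trans (ler_norm_sum _ _ _) _.
apply: ler_sum => i _; rewrite normrM ler_wpM2l// !mxE.
rewrite (le_trans (ler_normB _ _))// lerD2r.
by have := hM _ Kt i; rewrite mxE.
Qed.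

Lemma integrable_coord K i : compact K ->
  mu3.-integrable (pre K) (EFin \o (fun t => point3 t 0 i)).
Proof.
move=> cK; have := integrable_dot (delta_mx 0 i) 0 cK.
congr integrable; apply/funext => t /=; congr (_%:E).
rewrite subr0 /dotv (bigD1 i)//= mxE !eqxx/= mul1r big1 ?addr0// => j ji.
by rewrite mxE eqxx (negbTE ji) mul0r.
Qed.

Lemma Rintegral_dot0 K w : compact K -> 0 < fine (vol K) ->
  \int[mu3]_(t in pre K) dotv w (point3 t) = dotv w (centroid K) * fine (vol K).
Proof.
move=> cK vK; have mK := compact_measurable_pre cK.
have ic i : mu3.-integrable (pre K) (EFin \o (fun t => w 0 i * point3 t 0 i)).
  exact: (integrableZl mK (w 0 i) (integrable_coord i cK)).
under eq_Rintegral do rewrite dotv3.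
rewrite RintegralD//; last exact: (integrableD mK (ic 0) (ic i1)).
rewrite RintegralD// !RintegralZl//; try exact: integrable_coord.
by rewrite dotv3 !mxE; field; rewrite gt_eqF.
Qed.

Lemma integrable_cst K (r : R) : compact K ->
  mu3.-integrable (pre K) (EFin \o (fun=> r)).
Proof.
move=> cK; apply: measurable_bounded_integrable; [exact: compact_measurable_pre|exact: vol_lty|exact: measurable_cst|].
by exists `|r|; split; [exact: num_real|move=> y /ltW hy t _].
Qed.

Lemma Rintegral_dot K w c : compact K -> 0 < fine (vol K) ->
  \int[mu3]_(t in pre K) dotv w (point3 t - c) =
  dotv w (centroid K - c) * fine (vol K).
Proof.
move=> cK vK; have mK := compact_measurable_pre cK.
under eq_Rintegral do rewrite dotvBr.
rewrite RintegralB//; last 2 first.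
- by have := integrable_dot w 0 cK; congr integrable; apply/funext => t /=; rewrite subr0.
- exact: integrable_cst.
by rewrite Rintegral_dot0// Rintegral_cst// dotvBr; ring.
Qed.

Lemma Rintegral_centroid K w : convex_body K ->
  \int[mu3]_(t in pre K) dotv w (point3 t - centroid K) = 0.
Proof.
by move=> bK; rewrite Rintegral_dot ?vol_gt0//; [rewrite subrr dotv0 mul0r|case: bK].
Qed.

Lemma integrable_indic K A (r : R) : compact K -> measurable A ->
  mu3.-integrable (pre K) (EFin \o (fun t => r * \1_A t)).
Proof.
move=> cK mA; apply: measurable_bounded_integrable; [exact: compact_measurable_pre|exact: vol_lty| |].
  by apply: measurable_funTS; apply: measurable_funM => //; exact: measurable_indic.
exists `|r|; split; [exact: num_real|move=> y /ltW hy t _]; apply: le_trans hy.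
by rewrite normrM ler_piMr// indicE; case: (_ \in _); rewrite ?normr1 ?normr0.
Qed.

Lemma Rintegral_indic K A (r : R) : compact K -> measurable A ->
  \int[mu3]_(t in pre K) (r * \1_A t) = r * fine (mu3 (A `&` pre K)).
Proof.
move=> cK mA; have mK := compact_measurable_pre cK.
rewrite RintegralZl//; first by rewrite /Rintegral integral_indic.
have := integrable_indic 1 cK mA; congr integrable.
by apply/funext => t /=; rewrite mul1r.
Qed.

(** An interior point lies strictly below the bound, so on an open set [V] of positive volume the
    functional is even below [b - d]. Integrating the majorant [b - d * \1_V] makes the inequality
    strict. *)
Lemma centroid_lt K w (b : R) : convex_body K -> w != 0 ->
  (forall x, K x -> dotv w x <= b) -> dotv w (centroid K) < b.
Proof.
move=> bK w0 hb; have [cK _ [p Kp]] := bK; have vK := vol_gt0 bK.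
have mK := compact_measurable_pre cK.
have ob : dotv w p < b.
  have [e e0 he] := nbhs_line w Kp.
  have /he/hb : `|e / 2| < e by rewrite gtr0_norm; lra.
  rewrite dotvDr dotvZr; apply: lt_le_trans; rewrite ltrDl mulr_gt0 ?dotvv_gt0//; lra.
pose d := (b - dotv w p) / 2; have d0 : 0 < d by rewrite /d; lra.
pose V := interior K `&` [set x | dotv w (x - 0) < b - d].
have oV : open V.
  apply: openI; first exact: open_interior.
  exact: open_dot_lt.
have V0 : V !=set0 by exists p; split => //=; rewrite subr0 /d; lra.
have vV := vol_open_gt0 oV V0.
have mV := open_point3_measurable oV.
have VK : pre V `<=` pre K by move=> t [/interior_subset].
have fV : 0 < fine (vol V).
  by rewrite fine_gt0// vV (le_lt_trans _ (vol_lty cK))// le_measure// inE.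
have : \int[mu3]_(t in pre K) dotv w (point3 t - 0) <= \int[mu3]_(t in pre K) (b - d * \1_(pre V) t).
  apply: le_Rintegral => //; first exact: integrable_dot.
    have := integrableB mK (integrable_cst b cK) (integrable_indic d cK mV).
    by congr integrable.
  move=> t Kt; rewrite indicE; case: (boolP (t \in _)) => [|_]; last by rewrite subr0 mulr0 subr0; exact: hb.
  by rewrite inE => -[_ /ltW]; rewrite mulr1.
rewrite Rintegral_dot// subr0 RintegralB//; [|exact: integrable_cst|exact: integrable_indic].
rewrite Rintegral_cst// Rintegral_indic// setIidl// => h.
rewrite -(ltr_pM2r vK); apply: le_lt_trans h _.
by rewrite ltrBlDr ltrDl mulr_gt0.
Qed.

Lemma centroid_le K w (b : R) : convex_body K ->
  (forall x, K x -> dotv w x <= b) -> dotv w (centroid K) <= b.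
Proof.
move=> bK hb; have [w0|w0] := eqVneq w 0; last exact/ltW/centroid_lt.
have [_ _ [p /interior_subset/hb]] := bK.
by rewrite w0 !dot0v.
Qed.

(** The functional has mean zero, is at most [d] on [K], and is below [- (2 * d)] off the slab, so
    [- 2 * d + 3 * d * \1_S] dominates it. Integration shows that the slab holds at least two thirds
    of the volume; half is enough later. *)
Lemma centroid_markov K w (d : R) : convex_body K -> 0 < d ->
  (forall x, K x -> dotv w (x - centroid K) <= d) ->
  fine (vol K) <= 2 * fine (vol (K `&` [set x | - (2 * d) <= dotv w (x - centroid K)])).
Proof.
move=> bK d0 hd; have [cK _ _] := bK; have vK := vol_gt0 bK.
have mK := compact_measurable_pre cK.
set S := [set x | _ <= _].
have mS : measurable (pre S).
  by apply: (@closed_point3_measurable R S); exact: closed_dot_ge.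
have : \int[mu3]_(t in pre K) dotv w (point3 t - centroid K) <=
       \int[mu3]_(t in pre K) (- (2 * d) + 3 * d * \1_(pre S) t).
  apply: le_Rintegral => //; first exact: integrable_dot.
    have := integrableD mK (integrable_cst (- (2 * d)) cK) (integrable_indic (3 * d) cK mS).
    by congr integrable.
  move=> t Kt; rewrite indicE; case: (boolP (t \in _)) => [_|].
    by rewrite mulr1; have := hd _ Kt; lra.
  by rewrite notin_setE /= mulr0 addr0 => /negP; rewrite -ltNge => /ltW.
rewrite Rintegral_centroid// RintegralD//; [|exact: integrable_cst|exact: integrable_indic].
rewrite Rintegral_cst// Rintegral_indic// setIC -preimage_setI -/(vol _).
set u := fine (vol K); set v := fine (vol _) => h.
have : 0 <= d * (3 * v - 2 * u) by lra.
by rewrite pmulr_rge0//; have : 0 <= v := vol_ge0 _; lra.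
Qed.

Lemma vol_setD K K' : compact K -> compact K' -> K' `<=` K ->
  fine (vol (K `\` K')) = fine (vol K) - fine (vol K').
Proof.
move=> cK cK' sK; have mK := compact_measurable_pre cK.
have mK' := compact_measurable_pre cK'.
have E : (mu3 (pre K `\` pre K') = mu3 (pre K) - mu3 (pre K `&` pre K'))%E.
  by apply: measureD => //; exact: vol_lty.
have E2 : pre K `&` pre K' = pre K' by apply/setIidPr => t; exact: sK.
rewrite -[vol _]/(mu3 (pre K `\` pre K')) E E2.
by rewrite fineB//; exact: vol_fin.
Qed.

Lemma vol_le K K' : compact K' -> measurable (pre K) -> K `<=` K' ->
  fine (vol K) <= fine (vol K').
Proof.
move=> cK' mK sK; have le : (vol K <= vol K')%E.
  by apply: le_measure; rewrite ?inE; [exact: mK|exact: compact_measurable_pre|move=> t; exact: sK].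
apply: fine_le => //; last exact: vol_fin.
by rewrite ge0_fin_numE ?measure_ge0// (le_lt_trans le)// vol_lty.
Qed.

End Centroid.

(** * Rotational symmetry of the centroid *)

Section Centroid_linear.
Variable R : realType.
Local Notation mu3 := (@lebesgue3 R).
Local Notation R1 := (measurableTypeR R).
Local Notation pre K := (@point3 R @^-1` K : set (R1 * R1 * R1)).
Implicit Types (K : set 'rV[R]_3).

Definition rotz (c s : R) (x : 'rV[R]_3) : 'rV[R]_3 :=
  vec3 (c * x 0 0 - s * x 0 i1) (s * x 0 0 + c * x 0 i1) (x 0 i2).

(** A measure-preserving rotation that leaves [K] invariant fixes the horizontal part of the
    centroid, and a nontrivial rotation fixes only the origin. *)
Lemma centroid_rotz (c s : R) K : s != 0 -> c ^+ 2 + s ^+ 2 = 1 ->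
  convex_body K -> rotz c s @^-1` K = K ->
  centroid K 0 0 = 0 /\ centroid K 0 i1 = 0.
Proof.
move=> s0 cs bK inv; have [cK _ _] := bK; have vK := vol_gt0 bK.
have mK := compact_measurable_pre cK; pose T := prod12 (rot2 c s).
have mT : measurable_fun setT T.
  by apply: measurable_fun_pair => //; apply: measurableT_comp => //; exact: measurable_rot2.
have T3 A : measurable A -> mu3 (T @^-1` A) = mu3 A.
  apply: lebesgue3_prod12; first exact: measurable_rot2.
  by move=> B mB; exact: lebesgue2_rot.
have TE t : point3 (T t) = rotz c s (point3 t).
  by apply: row3P; rewrite /rotz !(point3E, vec3E).
have TK : T @^-1` pre K = pre K.
  by rewrite -[in RHS]inv; apply/seteqP; split=> t; rewrite /= TE.
have E i w : (forall x, rotz c s x 0 i = dotv w x) -> centroid K 0 i = dotv w (centroid K).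
  move=> wE; have TW t : dotv w (point3 t) = point3 (T t) 0 i by rewrite TE wE.
  apply: (mulIf (lt0r_neq0 vK)); rewrite -Rintegral_dot0//.
  under eq_Rintegral do rewrite TW.
  rewrite (@Rintegral_invariant R T (fun t => point3 t 0 i))//.
  - by rewrite mxE divfK// gt_eqF.
  - exact: measurable_coord.
  - have := integrable_dot w 0 cK; congr integrable.
    by apply/funext => t /=; rewrite subr0 TW.
have c1 : c != 1.
  apply/eqP => c1; move: cs; rewrite c1 expr1n => /(canRL (addKr _)); rewrite addNr.
  by move/eqP; rewrite sqrf_eq0 (negbTE s0).
apply: (rotation_fixed c1 cs).
  rewrite {1}(E 0 (vec3 c (- s) 0)) => [|x]; rewrite dotv3 !vec3E; ring.
rewrite {1}(E i1 (vec3 s c 0)) => [|x]; rewrite dotv3 !vec3E; ring.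
Qed.

End Centroid_linear.

(** * Second-order conditions on a smooth boundary *)

Section Calculus.
Variables (R : realType) (V : normedModType R).
Implicit Types (f g : V -> R) (p u a b : V).

Lemma is_derive_line f p a (s : R) : derivable f (p + s *: a) a ->
  is_derive s 1 (fun s => f (p + s *: a)) ('D_a f (p + s *: a)).
Proof.
move=> df.
have E : (fun h : R => h^-1 *: (((fun s => f (p + s *: a)) \o shift s) (h *: 1) - f (p + s *: a))) =
  (fun h : R => h^-1 *: ((f \o shift (p + s *: a)) (h *: a) - f (p + s *: a))).
  apply/funext => h /=; congr (_ *: (f _ - _)).
  by rewrite [h *: 1]mulr1 scalerDl addrCA.
by split; rewrite /derivable /derive /= E.
Qed.

Lemma mvt_line f p a (t : R) : 0 < t ->
  (forall s, 0 <= s <= t -> derivable f (p + s *: a) a) ->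
  exists2 s, 0 < s < t & f (p + t *: a) - f p = t * 'D_a f (p + s *: a).
Proof.
move=> t0 df.
have dl s : 0 <= s <= t -> is_derive s 1 (fun s => f (p + s *: a)) ('D_a f (p + s *: a)).
  by move=> /df; exact: is_derive_line.
have [s|s|s] := @MVT R (fun s => f (p + s *: a)) (fun s => 'D_a f (p + s *: a)) 0 t t0.
- by rewrite in_itv/= => /andP[h1 h2]; apply: dl; rewrite (ltW h1) (ltW h2).
- apply: continuous_in_subspaceT => x /[!inE]/= /[!in_itv]/= /dl dx.
  by apply: differentiable_continuous; apply/derivable1_diffP; case: dx.
by rewrite in_itv/= scale0r addr0 subr0 mulrC => st E; exists s.
Qed.

Lemma diff_expand g u (e : R) : differentiable g u -> 0 < e ->
  exists2 d : R, 0 < d & forall w : V, `|w| < d ->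
    `|g (u + w) - g u - 'd g u w| <= e * `|w|.
Proof.
move=> dg e0; have /eqaddoP/(_ e e0) := diff_locally dg.
move=> /nbhs_ballP[d /= d0 hd]; exists d => // w wd.
have /hd : ball (0 : V) d w by rewrite -ball_normE/= sub0r normrN.
rewrite /= !fctE/= [w + u]addrC => h.
by rewrite -addrA -opprD.
Qed.

(** The core of Young's theorem, which asks for differentiability of the first derivative at [u]
    only. The mean value theorem in direction [a] turns the second difference into [t] times an
    increment of [g] in direction [b]; expanding [g] to first order at [u] at both ends costs at
    most [e * t / 2] each. *)
Lemma second_difference f u a b (e : R) :
  (\forall x \near u, differentiable f x) -> differentiable (fun x => 'D_a f x) u ->
  0 < e -> exists2 d : R, 0 < d & forall t : R, 0 < t < d ->
    `|f (u + t *: b + t *: a) - f (u + t *: a) - f (u + t *: b) + f u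
      - t ^+ 2 * 'D_b (fun x => 'D_a f x) u| <= e * t ^+ 2.
Proof.
move=> /nbhs_ballP[r /= r0 hr] dg e0; set g := fun x => 'D_a f x in dg *.
pose N := `|a| + `|b| + 1.
have N0 : 0 < N by rewrite /N ltr_wpDl// addr_ge0.
have e'0 : 0 < e / (2 * N) by rewrite divr_gt0// mulr_gt0.
have [d' d'0 hd'] := diff_expand dg e'0.
exists (Num.min r d' / N); first by rewrite divr_gt0// lt_min r0.
move=> t /andP[t0]; rewrite ltr_pdivlMr// lt_min => /andP[tr td'].
have wN s s' : 0 <= s <= t -> 0 <= s' <= t -> `|s' *: b + s *: a| <= t * N.
  move=> /andP[s0 st] /andP[s'0 s't]; rewrite (le_trans (ler_normD _ _))// !normrZ.
  rewrite !ger0_norm// /N.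
  have : s' * `|b| <= t * `|b| by rewrite ler_wpM2r.
  have : s * `|a| <= t * `|a| by rewrite ler_wpM2r.
  by lra.
have df s s' : 0 <= s <= t -> 0 <= s' <= t -> derivable f (u + s' *: b + s *: a) a.
  move=> hs hs'; apply: diff_derivable; apply: hr.
  rewrite -ball_normE/= -addrA opprD addrA subrr sub0r normrN.
  by rewrite (le_lt_trans (wN _ _ hs hs')).
have dphi s : 0 <= s <= t -> is_derive s 1
    (fun s => f (u + t *: b + s *: a) - f (u + s *: a))
    (g (u + t *: b + s *: a) - g (u + s *: a)).
  move=> hs; apply: is_deriveB; apply: is_derive_line.
    by apply: df => //; rewrite (ltW t0) lexx.
  by have := df s 0 hs; rewrite scale0r addr0; apply; rewrite lexx ltW.
have [s|s|s] := @MVT R (fun s => f (u + t *: b + s *: a) - f (u + s *: a))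
  (fun s => g (u + t *: b + s *: a) - g (u + s *: a)) 0 t t0.
- by rewrite in_itv/= => /andP[h1 h2]; apply: dphi; rewrite (ltW h1) (ltW h2).
- apply: continuous_in_subspaceT => x /[!inE]/= /[!in_itv]/= /dphi dx.
  by apply: differentiable_continuous; apply/derivable1_diffP; case: dx.
rewrite in_itv/= scale0r !addr0 subr0 => /andP[s0 st] E.
have hs : 0 <= s <= t by rewrite !ltW.
have ht : 0 <= t <= t by rewrite lexx ltW.
have h0 : (0 : R) <= 0 <= t by rewrite lexx ltW.
have w1 := wN s t hs ht; have w2 := wN s 0 hs h0.
have b1 := hd' _ (le_lt_trans w1 td').
have b2 := hd' _ (le_lt_trans w2 td').
have D1 : 'd g u (t *: b + s *: a) = t * 'D_b g u + 'd g u (s *: a).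
  by rewrite linearD; congr (_ + _); rewrite linearZ deriveE.
move: b1 b2 w2; rewrite scale0r add0r D1 addrA => b1 b2 w2.
have -> : f (u + t *: b + t *: a) - f (u + t *: a) - f (u + t *: b) + f u =
  f (u + t *: b + t *: a) - f (u + t *: a) - (f (u + t *: b) - f u) by ring.
rewrite E.
set e1 := _ - _ - _ in b1; set e2 := _ - _ - _ in b2.
have -> : (g (u + t *: b + s *: a) - g (u + s *: a)) * t - t ^+ 2 * 'D_b g u = t * (e1 - e2).
  by rewrite /e1 /e2; ring.
rewrite normrM (gtr0_norm t0) expr2 mulrCA ler_pM2l//.
have be (x y : R) : x <= e / (2 * N) * y -> y <= t * N -> x <= e * t / 2.
  move=> xy yt; apply: le_trans xy _.
  have -> : e * t / 2 = e / (2 * N) * (t * N) by field; rewrite gt_eqF.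
  by rewrite ler_pM2l.
have c1 := be _ _ b1 w1; have c2 := be _ _ b2 w2.
by rewrite (le_trans (ler_normB _ _))//; lra.
Qed.

(** The second difference is symmetric in [a] and [b], so both mixed derivatives are limits of the
    same quotient. *)
Lemma derive_swap f u a b :
  (\forall x \near u, differentiable f x) ->
  differentiable (fun x => 'D_a f x) u -> differentiable (fun x => 'D_b f x) u ->
  'D_a (fun x => 'D_b f x) u = 'D_b (fun x => 'D_a f x) u.
Proof.
move=> df da db; set A := LHS; set B := RHS.
apply/eqP; rewrite -subr_eq0 -normr_le0; apply/ler_addgt0Pl => e e0; rewrite addr0.
have e2 : 0 < e / 2 by rewrite divr_gt0.
have [d d0 hd] := second_difference b df da e2.
have [d' d'0 hd'] := second_difference a df db e2.
pose t := Num.min d d' / 2.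
have m0 : 0 < Num.min d d' by rewrite lt_min d0.
have t0 : 0 < t by rewrite /t; lra.
have tm : t < Num.min d d' by rewrite /t; lra.
move: tm; rewrite lt_min => /andP[td td'].
have := hd t; rewrite t0 td => /(_ isT); have := hd' t; rewrite t0 td' => /(_ isT).
rewrite [u + t *: a + _]addrAC -/A -/B.
set S := f _ - f (u + t *: b) - _ + _.
have -> : f (u + t *: b + t *: a) - f (u + t *: a) - f (u + t *: b) + f u = S by rewrite /S; ring.
move=> h1 h2; have t2 : 0 < t ^+ 2 by rewrite exprn_gt0.
rewrite -(ler_pM2l t2) -{1}(gtr0_norm t2) -normrM.
have -> : t ^+ 2 * (A - B) = (S - t ^+ 2 * B) - (S - t ^+ 2 * A) by ring.
apply: le_trans (ler_normB _ _) _; apply: le_trans (lerD h2 h1) _.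
by rewrite -mulrDl -splitr mulrC.
Qed.

Lemma derive_max0 f u a :
  (\forall x \near u, differentiable f x) ->
  (\forall x \near u, f x <= f u) -> 'D_a f u = 0.
Proof.
move=> df fmax; pose F t := f (u + t *: a).
have /(nbhs_line a)[r r0 hr] : \forall x \near u, differentiable f x /\ f x <= f u.
  by apply: filterS2 df fmax.
have r2 : 0 < r / 2 by rewrite divr_gt0.
have dF : is_derive (0 : R) 1 F ('D_a f u).
  have := @is_derive_line f u a 0; rewrite scale0r addr0; apply.
  by apply: diff_derivable; have [] := hr 0; rewrite ?normr0// scale0r addr0.
have := @derive1_at_max R F (- (r / 2)) (r / 2) 0.
move=> /(_ _ _ _ _) H; have {H}[_ <-] : is_derive (0 : R) 1 F 0; last first.
  by case: dF => _ <-.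
apply: H; rewrite ?in_itv/=.
- by lra.
- move=> t; rewrite in_itv/= => /andP[t1 t2].
  have [|dt _] := hr t; first by rewrite ltr_norml; lra.
  have /(@is_derive_line f u a t)[] // : derivable f (u + t *: a) a by exact: diff_derivable.
- by lra.
- move=> t; rewrite in_itv/= => /andP[t1 t2].
  have [|_] := hr t; first by rewrite ltr_norml; lra.
  by rewrite /F scale0r addr0.
Qed.

Lemma second_derive_le0 f u a :
  (\forall x \near u, differentiable f x) -> differentiable (fun x => 'D_a f x) u ->
  (\forall x \near u, f x <= f u) -> 'D_a (fun x => 'D_a f x) u <= 0.
Proof.
move=> df da fmax; rewrite leNgt; apply/negP; set D := 'D_a _ u => D0.
pose F t := f (u + t *: a).
have /(nbhs_line a)[r r0 hr] : \forall x \near u, differentiable f x /\ f x <= f u.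
  by apply: filterS2 df fmax.
have r2 : 0 < r / 2 by rewrite divr_gt0.
have g0 : 'D_a f u = 0 by exact: derive_max0.
have [d d0 hd] := diff_expand da (divr_gt0 D0 (ltr_wpDl (normr_ge0 a) (ltr0Sn R 1) : 0 < `|a| + 2)).
pose t := Num.min (r / 2) (d / (`|a| + 1)) / 2.
have a1 : 0 < `|a| + 1 by rewrite ltr_wpDl.
have m0 : 0 < Num.min (r / 2) (d / (`|a| + 1)) by rewrite lt_min r2 divr_gt0.
have t0 : 0 < t by rewrite /t; lra.
have : t < Num.min (r / 2) (d / (`|a| + 1)) by rewrite /t; lra.
rewrite lt_min => /andP[tr]; rewrite ltr_pdivlMr// => td.
have [s hs|s /andP[s0 st] E] := @mvt_line f u a t t0.
  apply: diff_derivable; have [] := hr s => //.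
  by move/andP: hs => [? ?]; rewrite ger0_norm//; lra.
have [] := hr t; first by rewrite gtr0_norm//; lra.
move=> _; rewrite -subr_le0 E pmulr_rle0// => gs.
have sa : `|s *: a| < d.
  rewrite normrZ gtr0_norm// (le_lt_trans _ td)//.
  have : s * `|a| <= t * `|a| by rewrite ler_wpM2r// ltW.
  by lra.
have := hd _ sa; rewrite g0 subr0.
have -> : 'd (fun x => 'D_a f x) u (s *: a) = s * D by rewrite linearZ/= -deriveE.
rewrite normrZ (gtr0_norm s0) ler_norml => /andP[+ _].
have : D / (`|a| + 2) * (s * `|a|) < s * D.
  have -> : D / (`|a| + 2) * (s * `|a|) = s * D * (`|a| / (`|a| + 2)).
    by field; rewrite gt_eqF// ltr_wpDl.
  by rewrite gtr_pMr ?mulr_gt0// ltr_pdivrMr ?ltr_wpDl// mul1r ltrDl.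
by lra.
Qed.

End Calculus.

Section Near_differentiable.
Variables (R : realType) (V : normedModType R).
Implicit Types (f g : V -> R) (u v : V).

Lemma near_eq_differentiable f g u : (\forall x \near u, f x = g x) ->
  differentiable f u -> differentiable g u.
Proof.
move=> fg df; have fgu : f u = g u by exact: nbhs_singleton fg.
have E : g \o shift u = cst (g u) + 'd f u +o_ 0 id.
  apply/eqaddoP => e e0; have /eqaddoP/(_ e e0) := diff_locally df.
  have fg0 : \forall x \near (0 : V), f (x + u) = g (x + u).
    by move: fg; rewrite (near_shift 0 u) /= ; apply: filterS => x /=; rewrite subr0.
  apply: filterS2 fg0 => x E.
  by rewrite /= !fctE/= -E -fgu.
have cf : continuous ('d f u) by exact: diff_continuous.
by apply/diff_locallyP; rewrite (diff_unique cf E).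
Qed.

End Near_differentiable.

(** * Second-order differentiability of the distance *)

Section Distance.
Variable R : realType.

Lemma class_C2_coord m (W : set 'rV[R]_m.+1) n (phi : 'rV[R]_m.+1 -> 'rV[R]_n.+1) i :
  class_C 2 W phi -> forall x, W x ->
  differentiable (fun x => phi x 0 i) x /\
  forall v, 'D_v (fun x => phi x 0 i) x = ('D_v phi x) 0 i /\
            differentiable (fun x => ('D_v phi x) 0 i) x.
Proof.
move=> [d1 d2] x Wx; split.
  exact: (differentiable_comp (d1 _ Wx) (differentiable_coord _ _ _)).
move=> v; split; last first.
  exact: (differentiable_comp ((d2 v).1 _ Wx) (differentiable_coord _ _ _)).
by rewrite (derive_mx (diff_derivable (d1 _ Wx))) mxE.
Qed.

Lemma differentiable_sqrt (x : R) : 0 < x -> differentiable (Num.sqrt : R -> R) x.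
Proof. by move=> x0; apply/derivable1_diffP; case: (is_derive1_sqrt x0). Qed.

(** Away from [c] the distance [h] is the root of the positive function [N]. Differentiating
    [N = h * h] gives ['D_v h] as a quotient of differentiable functions, valid only near [u], which
    suffices because differentiability is a local property. *)
Lemma enorm_C2 m (W : set 'rV[R]_m.+1) n (phi : 'rV[R]_m.+1 -> 'rV[R]_n.+1) c u :
  open W -> class_C 2 W phi -> W u -> phi u != c ->
  (\forall x \near u, differentiable (fun x => enorm (phi x - c)) x) /\
  forall v, differentiable (fun x => 'D_v (fun x => enorm (phi x - c)) x) u.
Proof.
move=> oW C2 Wu uc; set h := fun x => enorm (phi x - c).
pose p i x : R := phi x 0 i - c 0 i.
pose N x := dotv (phi x - c) (phi x - c).
have NE : N = \sum_i (fun x => p i x * p i x).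
  apply/funext => x; rewrite /N /dotv fct_sumE; apply: eq_bigr => i _.
  by rewrite !mxE.
have dp i x : W x -> differentiable (p i) x.
  by move=> Wx; apply: differentiableB => //; have [] := class_C2_coord i C2 Wx.
have dN x : W x -> differentiable N x.
  by move=> Wx; rewrite NE; apply: differentiable_sum => i; apply: differentiableM; exact: dp.
have WN : \forall x \near u, W x /\ 0 < N x.
  have Wn : \forall x \near u, W x by exact: open_nbhs_nbhs.
  have cN := differentiable_continuous (dN u Wu).
  have : \forall x \near u, 0 < N x.
    by apply: (cN [set y | 0 < y]); apply: open_nbhs_nbhs; split;
      [exact: open_gt|rewrite /= dotvv_gt0 subr_eq0].
  by apply: filterS2 Wn.
have dh x : W x -> 0 < N x -> differentiable h x.
  by move=> Wx Nx; apply: (differentiable_comp (dN _ Wx)); exact: differentiable_sqrt.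
split; first by apply: filterS WN => x [Wx Nx]; exact: dh.
move=> v; have [_ Nu] : W u /\ 0 < N u by exact: nbhs_singleton WN.
have DN x : W x -> 'D_v N x = \sum_i 2 * (p i x * ('D_v phi x) 0 i).
  move=> Wx; rewrite NE derive_sum => [|i]; last first.
    by apply: diff_derivable; apply: differentiableM; exact: dp.
  apply: eq_bigr => i _; rewrite deriveM; [|exact/diff_derivable/dp|exact/diff_derivable/dp].
  have -> : 'D_v (p i) x = ('D_v phi x) 0 i.
    have [di /(_ v)[<- _]] := class_C2_coord i C2 Wx.
    have -> : p i = (fun x => phi x 0 i) - cst (c 0 i) by [].
    by rewrite deriveB ?derive_cst ?subr0//; exact: diff_derivable.
  by rewrite /GRing.scale/=; ring.
have Dh x : W x -> 0 < N x -> 'D_v h x = (\sum_i 2 * (p i x * ('D_v phi x) 0 i)) * (2 * h x)^-1.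
  move=> Wx Nx; rewrite -DN//.
  have hx : h x != 0 by rewrite /h gt_eqF// sqrtr_gt0.
  have -> : N = h * h by apply/funext => y; rewrite /N -enorm_sqr expr2.
  rewrite deriveM; [|exact/diff_derivable/dh|exact/diff_derivable/dh].
  by rewrite /GRing.scale/=; field.
apply: (@near_eq_differentiable _ _ (fun x => (\sum_i 2 * (p i x * ('D_v phi x) 0 i)) * (2 * h x)^-1)).
  by apply: filterS WN => x [Wx Nx]; rewrite Dh.
apply: differentiableM.
  rewrite (_ : (fun x => _) = \sum_i (fun x => 2 * (p i x * ('D_v phi x) 0 i))); last first.
    by apply/funext => x; rewrite fct_sumE.
  apply: differentiable_sum => i; apply: differentiableM => //.
  apply: differentiableM; first exact: dp.
  by have [_ /(_ v)[]] := class_C2_coord i C2 Wu.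
apply: differentiableV; last by rewrite mulf_neq0// gt_eqF// sqrtr_gt0.
by apply: differentiableM => //; exact: dh.
Qed.

End Distance.

(** * Eigenvalues of symmetric two-by-two Hessians *)

Section Hessian.
Variable R : realType.
Implicit Types (h : 'rV[R]_2 -> R) (u : 'rV[R]_2).
Local Notation e i := (delta_mx 0 i : 'rV[R]_2).

Lemma hessian_sym h u : (\forall x \near u, differentiable h x) ->
  (forall v, differentiable (fun x => 'D_v h x) u) ->
  hessian h u 0 1 = hessian h u 1 0.
Proof. by move=> d1 d2; rewrite !mxE; apply: derive_swap. Qed.

Lemma row2E (v : 'rV[R]_2) : v = v 0 0 *: e 0 + v 0 1 *: e 1.
Proof.
apply/rowP => i; rewrite !mxE.
case: i => -[|[|//]] i /=; rewrite ?mulr1 ?mulr0 ?addr0 ?add0r; congr (v _ _);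
  exact: val_inj.
Qed.

Lemma hessian_quad h u (v : 'rV[R]_2) : (\forall x \near u, differentiable h x) ->
  (forall v, differentiable (fun x => 'D_v h x) u) ->
  'D_v (fun x => 'D_v h x) u =
    v 0 0 ^+ 2 * hessian h u 0 0 + v 0 0 * v 0 1 * hessian h u 0 1 +
    v 0 0 * v 0 1 * hessian h u 1 0 + v 0 1 ^+ 2 * hessian h u 1 1.
Proof.
move=> d1 d2; set x := v 0 0; set y := v 0 1.
have lin (f : 'rV[R]_2 -> R) z : differentiable f z ->
    'D_v f z = x * 'D_(e 0) f z + y * 'D_(e 1) f z.
  by move=> df; rewrite !deriveE// {1}(row2E v) linearD !linearZ.
rewrite (lin _ _ (d2 v)).
have D w : 'D_w (fun x => 'D_v h x) u = x * 'D_w (fun z => 'D_(e 0) h z) u + y * 'D_w (fun z => 'D_(e 1) h z) u.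
  rewrite (@near_eq_derive _ _ _ _ (x *: (fun z => 'D_(e 0) h z) + y *: (fun z => 'D_(e 1) h z))).
    rewrite deriveD; [|exact/derivableZ/diff_derivable|exact/derivableZ/diff_derivable].
    by rewrite !deriveZ//; exact: diff_derivable.
  by apply: filterS d1 => z dz; rewrite lin.
have HE i j : hessian h u i j = 'D_(e i) (fun z => 'D_(e j) h z) u by rewrite mxE.
have alg (p r s t : R) : x * (x * p + y * r) + y * (x * s + y * t) =
  x ^+ 2 * p + x * y * r + x * y * s + y ^+ 2 * t by ring.
by rewrite (D (e 0)) (D (e 1)) !HE alg.
Qed.

Lemma char_poly2 (H : 'M[R]_2) :
  char_poly H = 'X^2 - (H 0 0 + H 1 1) *: 'X + (H 0 0 * H 1 1 - H 0 1 * H 1 0)%:P.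
Proof.
rewrite /char_poly (expand_det_row _ 0) !big_ord_recl big_ord0 addr0.
rewrite /cofactor !det_mx11 !mxE/= expr0 expr1 !mul1r.
have -> : lift 0 0 = 1 :> 'I_2 by exact: val_inj.
have -> : lift 1 0 = 0 :> 'I_2 by exact: val_inj.
rewrite -!mul_polyC !polyCD !polyCN !polyCM /=; ring.
Qed.

Lemma det2 (H : 'M[R]_2) : \det H = H 0 0 * H 1 1 - H 0 1 * H 1 0.
Proof.
rewrite (expand_det_row _ 0) !big_ord_recl big_ord0 addr0.
rewrite /cofactor !det_mx11 !mxE/= expr0 expr1 !mul1r.
have -> : lift 0 0 = 1 :> 'I_2 by exact: val_inj.
have -> : lift 1 0 = 0 :> 'I_2 by exact: val_inj.
ring.
Qed.

Lemma sym2_eigenvalues (H : 'M[R]_2) : H 0 1 = H 1 0 ->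
  exists a b : R, [/\ char_poly H = ('X - a%:P) * ('X - b%:P),
    a + b = H 0 0 + H 1 1 & a * b = \det H].
Proof.
move=> sym; set t := H 0 0 + H 1 1; pose D := (H 0 0 - H 1 1) ^+ 2 + 4 * H 0 1 ^+ 2.
have D0 : 0 <= D by rewrite addr_ge0 ?sqr_ge0// mulr_ge0 ?sqr_ge0.
have sD : Num.sqrt D ^+ 2 = D by rewrite sqr_sqrtr.
have E1 : (t + Num.sqrt D) / 2 + (t - Num.sqrt D) / 2 = t by field.
have E2 : (t + Num.sqrt D) / 2 * ((t - Num.sqrt D) / 2) = \det H.
  have -> : (t + Num.sqrt D) / 2 * ((t - Num.sqrt D) / 2) = (t ^+ 2 - Num.sqrt D ^+ 2) / 4 by field.
  by rewrite sD det2 /t /D -sym; field.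
move: E1 E2; move: ((t + _) / 2) ((t - _) / 2) => a b E1 E2.
exists a, b; split=> //; rewrite char_poly2 -/t -det2 -E2 -E1.
by rewrite -mul_polyC polyCD polyCM; ring.
Qed.

(** The vector [(- q, p)] gives [p] times the determinant. If [p = 0], the vector [(r, - q)] takes
    over, and if also [r = 0], the vectors [(1, 1)] and [(1, -1)] force [q = 0]. *)
Lemma quadratic_form_le0 (p q r : R) :
  (forall x y, x ^+ 2 * p + x * y * q + x * y * q + y ^+ 2 * r <= 0) ->
  [/\ p <= 0, r <= 0 & q ^+ 2 <= p * r].
Proof.
move=> neg; have p0 : p <= 0 by have := neg 1 0; lra.
have r0 : r <= 0 by have := neg 0 1; lra.
split=> //; have [p1|p1] := eqVneq p 0; last first.
  have pn : p < 0 by rewrite lt_neqAle p1.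
  have := neg (- q) p.
  have -> : (- q) ^+ 2 * p + - q * p * q + - q * p * q + p ^+ 2 * r =
    p * (p * r - q ^+ 2) by ring.
  by rewrite nmulr_rle0// subr_ge0.
rewrite p1 mul0r in neg *; have [r1|r1] := eqVneq r 0.
  have -> : q = 0 by have := neg 1 1; have := neg 1 (-1); rewrite r1; lra.
  by rewrite expr0n.
have rn : r < 0 by rewrite lt_neqAle r1.
have := neg r (- q).
have -> : r ^+ 2 * 0 + r * - q * q + r * - q * q + (- q) ^+ 2 * r = r * (- (q ^+ 2)) by ring.
by rewrite nmulr_rle0// oppr_ge0.
Qed.

(** Semidefiniteness makes the determinant nonnegative and invertibility makes it nonzero, so the
    eigenvalues have positive product and nonpositive sum. *)
Lemma semidefinite2_neg (H : 'M[R]_2) : H 0 1 = H 1 0 -> H \in unitmx ->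
  (forall x y, x ^+ 2 * H 0 0 + x * y * H 0 1 + x * y * H 1 0 + y ^+ 2 * H 1 1 <= 0) ->
  neg_eigenvalues H 2.
Proof.
move=> sym; rewrite unitmxE unitfE => det0.
have [a [b [cp ab pr]]] := sym2_eigenvalues sym.
rewrite -sym => /quadratic_form_le0[p0 r0 d0].
have ab0 : 0 < a * b by rewrite pr lt_neqAle eq_sym det0 det2 -sym subr_ge0 -expr2.
have ab1 : a + b <= 0 by rewrite ab; lra.
exists [:: a; b]; rewrite !big_cons big_nil mulr1; split=> //=.
have an : a < 0 by rewrite ltNge; apply/negP => ap; nra.
have bn : b < 0 by rewrite ltNge; apply/negP => bp; nra.
by rewrite an bn.
Qed.

Lemma semidefinite2_pos (H : 'M[R]_2) : H 0 1 = H 1 0 -> H \in unitmx ->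
  (forall x y, 0 <= x ^+ 2 * H 0 0 + x * y * H 0 1 + x * y * H 1 0 + y ^+ 2 * H 1 1) ->
  neg_eigenvalues H 0.
Proof.
move=> sym; rewrite unitmxE unitfE => det0 pos.
have [a [b [cp ab pr]]] := sym2_eigenvalues sym.
have [x y|p0 r0 d0] := @quadratic_form_le0 (- H 0 0) (- H 0 1) (- H 1 1).
  by have := pos x y; rewrite -sym; lra.
have ab0 : 0 < a * b.
  by rewrite pr lt_neqAle eq_sym det0 det2 -sym subr_ge0; move: d0; rewrite sqrrN mulrNN expr2.
have ab1 : 0 <= a + b by rewrite ab; lra.
exists [:: a; b]; rewrite !big_cons big_nil mulr1; split=> //=.
have an : 0 <= a by rewrite leNgt; apply/negP => ap; nra.
have bn : 0 <= b by rewrite leNgt; apply/negP => bp; nra.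
by rewrite !ltNge an bn.
Qed.

End Hessian.

Section Extremum_index.
Variable R : realType.
Implicit Types (K : set 'rV[R]_3) (c q : 'rV[R]_3).

(** The chart that witnesses nondegeneracy is also the one in which the index is computed, so no
    change of coordinates has to be studied. Here a property of boundary points near [q] is pulled
    back to that chart. *)
Lemma dist_hessian_chart K c q H (Q : set 'rV[R]_3) : q != c -> dist_hessian K c q H ->
  (exists2 W : set 'rV[R]_3, open W /\ W q & forall z, bd K z -> W z -> Q z) ->
  exists phi u, let h x := enorm (phi x - c) in
    [/\ phi u = q, H = hessian h u, \forall x \near u, differentiable h x,
        forall v, differentiable (fun x => 'D_v h x) u & \forall x \near u, Q (phi x)].
Proof.
move=> qc [U [phi [u [[oU sphi _ _ lp] Uu phiu HE]]]] [W [oW Wq] hQ].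
have [|d1 d2] := @enorm_C2 R 1 U 2 phi c u oU (sphi 2) Uu; first by rewrite phiu.
exists phi, u; split=> //.
have Un : \forall x \near u, U x by exact: open_nbhs_nbhs.
have cp : {for u, continuous phi} by apply: differentiable_continuous; have [/(_ _ Uu)] := sphi 1.
have Wn : \forall x \near u, W (phi x).
  by apply: (cp W); apply: open_nbhs_nbhs; rewrite phiu.
apply: filterS2 Un Wn => x Ux Wx; apply: hQ => //.
have [V _ E] := lp U oU (@subset_refl _ U).
by have : (phi @` U) (phi x) by [exists x]; rewrite E => -[].
Qed.

Lemma hessian_form (h : 'rV[R]_2 -> R) u x y : (\forall z \near u, differentiable h z) ->
  (forall v, differentiable (fun z => 'D_v h z) u) ->
  let v := x *: delta_mx 0 0 + y *: delta_mx 0 1 in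
  x ^+ 2 * hessian h u 0 0 + x * y * hessian h u 0 1 + x * y * hessian h u 1 0 +
    y ^+ 2 * hessian h u 1 1 = 'D_v (fun z => 'D_v h z) u.
Proof.
move=> d1 d2 v; rewrite (hessian_quad v d1 d2).
have -> : v 0 0 = x by rewrite !mxE/= mulr1 mulr0 addr0.
by have -> : v 0 1 = y by rewrite !mxE/= mulr1 mulr0 add0r.
Qed.

(* A local extremum of the distance on the boundary has a semidefinite Hessian,
   so nondegeneracy makes it definite. *)
Lemma smooth_max_index K c q : q != c -> smooth_nondegenerate K c q ->
  (exists2 W : set 'rV[R]_3, open W /\ W q &
     forall z, bd K z -> W z -> enorm (z - c) <= enorm (q - c)) ->
  smooth_index K c q 2.
Proof.
move=> qc [H dH uH] hmax; exists H => //.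
have [phi [u [phiu HE d1 d2 hm]]] := dist_hessian_chart qc dH hmax.
rewrite HE; apply: semidefinite2_neg; first exact: hessian_sym.
  by rewrite -HE.
move=> x y; rewrite hessian_form//; apply: second_derive_le0 => //.
by rewrite phiu.
Qed.

Lemma smooth_min_index K c q : q != c -> smooth_nondegenerate K c q ->
  (exists2 W : set 'rV[R]_3, open W /\ W q &
     forall z, bd K z -> W z -> enorm (q - c) <= enorm (z - c)) ->
  smooth_index K c q 0.
Proof.
move=> qc [H dH uH] hmin; exists H => //.
have [phi [u [phiu HE d1 d2 hm]]] := dist_hessian_chart qc dH hmin.
set h := fun x => _ in HE d1 d2.
rewrite HE; apply: semidefinite2_pos; first exact: hessian_sym.
  by rewrite -HE.
move=> x y; rewrite hessian_form//; set v := _ + _.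
(* The maximum test is applied to [- h]; differentiation commutes with the sign only where [h] is
   differentiable, hence the equality near [u]. *)
have E : \forall z \near u, - 'D_v h z = 'D_v (- h) z.
  by apply: filterS d1 => z dz; rewrite deriveN//; exact: diff_derivable.
rewrite -oppr_le0.
have -> : - 'D_v (fun z => 'D_v h z) u = 'D_v (fun z => 'D_v (- h) z) u.
  rewrite -(near_eq_derive v E) -[in RHS]/(- (fun z => 'D_v h z)) deriveN//.
  exact: diff_derivable.
apply: second_derive_le0.
- by apply: filterS d1 => z; exact: differentiableN.
- by apply: (near_eq_differentiable E); apply: differentiableN.
- by apply: filterS hm => z; rewrite -phiu /= lerN2.
Qed.

End Extremum_index.

(** * Local extrema of the distance from the centroid *)

Section Convex.
Variable R : realType.
Implicit Types (K F : set 'rV[R]_3) (c p q x y w : 'rV[R]_3).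

Lemma convex_setP K : convex_set K <->
  forall x y (t : R), K x -> K y -> 0 <= t -> t <= 1 -> K (t *: x + (1 - t) *: y).
Proof.
split=> [h x y t Kx Ky t0 t1|h x y t].
  by have := h x y (Itv01 t0 t1); rewrite !inE; apply.
by rewrite !inE => Kx Ky; apply: (h x y t%:num).
Qed.

Lemma convex_segment K x y (t : R) : convex_set K -> K x -> K y ->
  0 <= t -> t <= 1 -> K (x + t *: (y - x)).
Proof.
move=> /convex_setP cK Kx Ky t0 t1; have := cK y x t Ky Kx t0 t1.
by rewrite scalerBr scalerBl scale1r [_ + (x - _)]addrCA.
Qed.

(** The homothety with centre [y] and ratio [t] carries a neighbourhood of [x] inside [K] to one of
    the combination; [f] is its inverse. *)
Lemma interior_convex K x y (t : R) : convex_set K -> interior K x -> K y ->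
  0 < t -> t <= 1 -> interior K (t *: x + (1 - t) *: y).
Proof.
move=> /convex_setP cK Kx Ky t0 t1.
pose f z := t^-1 *: (z - (1 - t) *: y).
have cf : continuous f.
  have cB := @continuous_subr R 3 ((1 - t) *: y).
  by move=> z; apply: (continuous_comp (cB z)); exact: scaler_continuous.
have fz : f (t *: x + (1 - t) *: y) = x.
  by rewrite /f addrK scalerA mulVf ?scale1r// gt_eqF.
have Kf : nbhs (f (t *: x + (1 - t) *: y)) K by rewrite fz.
have Kz := cf _ K Kf; apply: (@filterS _ (nbhs (t *: x + (1 - t) *: y)) _ _ _ _ Kz).
move=> z Kfz; have := cK _ _ t Kfz Ky (ltW t0) t1.
by rewrite /f scalerA divff ?gt_eqF// scale1r subrK.
Qed.

Lemma interior_between K x y (t : R) : convex_set K -> interior K x -> K y ->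
  0 <= t -> t < 1 -> interior K (x + t *: (y - x)).
Proof.
move=> cK Kx Ky t0 t1; have := @interior_convex K x y (1 - t) cK Kx Ky.
rewrite subr_gt0 => /(_ t1); rewrite gerBl => /(_ t0).
by rewrite opprB addrCA subrr addr0 scalerBr scalerBl scale1r -addrA [- _ + _]addrC.
Qed.

Lemma dotv_add_scale x y (t : R) :
  dotv (x + t *: y) (x + t *: y) = dotv x x + 2 * t * dotv x y + t ^+ 2 * dotv y y.
Proof. by rewrite dotvDl !dotvDr !dotvZl !dotvZr [dotv y x]dotvC; ring. Qed.

Lemma enorm_le x y : (enorm x <= enorm y) = (dotv x x <= dotv y y).
Proof. by rewrite -!enorm_sqr ler_pXn2r// nnegrE enorm_ge0. Qed.

Lemma equilibrium_max K c q : closed K -> K q -> q != c ->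
  (forall y, K y -> dotv (q - c) (y - q) <= 0) -> equilibrium K c q.
Proof.
move=> clK Kq qc hK; have qc0 : q - c != 0 by rewrite subr_eq0.
split.
  split; first exact: subset_closure.
  move=> /(nbhs_line (q - c))[e e0 he].
  have /he/hK : `|e / 2| < e by rewrite gtr0_norm; lra.
  rewrite addrAC subrr add0r dotvZr pmulr_rle0; last by rewrite divr_gt0.
  by rewrite leNgt dotvv_gt0 qc0.
split=> //; last by right.
by exists q; split => //; rewrite /plane /= subrr dotv0.
Qed.

(** Complementary slackness: nonpositive terms with nonnegative sum all vanish, so weight sits only
    on vertices in the support plane. *)
Lemma polytope_face_weights n (v : 'I_n -> 'rV[R]_3) w q (l : 'I_n -> R) :
  (forall i, dotv w (v i - q) <= 0) -> (forall i, 0 <= l i) -> \sum_i l i = 1 ->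
  0 <= dotv w (\sum_i l i *: v i - q) -> forall i, l i != 0 -> dotv w (v i - q) = 0.
Proof.
move=> hv l0 l1 hx i li.
rewrite (dotv_average _ _ _ l1) in hx.
have np j : l j * dotv w (v j - q) <= 0 by rewrite mulr_ge0_le0.
have : \sum_i - (l i * dotv w (v i - q)) == 0.
  by rewrite sumrN oppr_eq0 eq_le hx sumr_le0.
rewrite psumr_eq0 => [/allP/(_ i (mem_index_enum _))|j _]; last by rewrite oppr_ge0.
by rewrite /= oppr_eq0 mulf_eq0 (negbTE li) => /eqP.
Qed.

Lemma conv_hull_vertex n (v : 'I_n -> 'rV[R]_3) i : conv_hull v (v i).
Proof.
exists (fun j => (j == i)%:R); split.
- by move=> j; rewrite ler0n.
- by rewrite (bigD1 i)//= eqxx big1 ?addr0// => j /negbTE ->.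
- by rewrite (bigD1 i)//= eqxx scale1r big1 ?addr0// => j /negbTE ->; rewrite scale0r.
Qed.

Lemma conv_hull_dot n (v : 'I_n -> 'rV[R]_3) w c (b : R) :
  (forall i, dotv w (v i - c) <= b) -> forall x, conv_hull v x -> dotv w (x - c) <= b.
Proof.
move=> h x [l [l0 l1 ->]].
rewrite (dotv_average _ _ _ l1) -[b]mul1r -l1 mulr_suml; apply: ler_sum => i _.
by rewrite ler_wpM2l.
Qed.

(** Vertices off the face contribute zero rows, which avoids reindexing and does not change the
    span. The rank is thus that of the directions from [q] to the vertices on the face. *)
Lemma aff_hull_face_dim n (v : 'I_n -> 'rV[R]_3) w q :
  (forall i, dotv w (v i - q) <= 0) -> conv_hull v q ->
  let A := \matrix_i (if dotv w (v i - q) == 0 then v i - q else 0) in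
  has_dim (conv_hull v `&` plane q w) (\rank A).
Proof.
move=> hv Kq A; exists q, (row_base A); split; first exact: row_base_free.
have -> : [set q + a *m row_base A | a in [set: 'rV[R]_(\rank A)]] =
          [set q + a *m A | a in [set: 'rV[R]_n]].
  apply/seteqP; split=> x [a _ <-].
    have /submxP[D ->] : (a *m row_base A <= A)%MS.
      by rewrite -(eq_row_base A) submxMl.
    by exists D.
  have /submxP[D ->] : (a *m A <= row_base A)%MS by rewrite (eq_row_base A) submxMl.
  by exists D.
have rowA (a : 'rV_n) : a *m A = \sum_i a 0 i *: (if dotv w (v i - q) == 0 then v i - q else 0).
  by rewrite mulmx_sum_row; apply: eq_bigr => i _; rewrite rowK.
have inF y : (conv_hull v `&` plane q w) y -> exists l : 'rV[R]_n, y - q = l *m A.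
  move=> [[l [l0 l1 yE]] yp]; exists (\row_i l i).
  rewrite rowA yE -[q in LHS]scale1r -l1 scaler_suml -sumrB; apply: eq_bigr => i _.
  rewrite mxE -scalerBr; case: ifPn => //= h.
  have [->|li] := eqVneq (l i) 0; first by rewrite !scale0r.
  have := @polytope_face_weights n v w q l hv l0 l1 _ i li.
  by rewrite -yE yp lexx => /(_ isT) E; rewrite E eqxx in h.
apply/seteqP; split=> x.
  move=> [m [y [u [yF u1 ->]]]].
  have /choice[L hL] : forall j, exists l : 'rV[R]_n, y j - q = l *m A.
    by move=> j; exact: inF.
  exists (\sum_j u j *: L j) => //.
  rewrite mulmx_suml -{1}[q]scale1r -u1 scaler_suml -big_split; apply: eq_bigr => j _ /=.
  by rewrite -scalemxAl -hL -scalerDr addrC subrK.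
move=> [a _ <-].
(* The additional index carries [q] itself and absorbs whatever weight is missing for an affine
   combination. *)
pose y (i : 'I_n.+1) := if unlift ord0 i is Some j then
  (if dotv w (v j - q) == 0 then v j else q) else q.
pose u (i : 'I_n.+1) := if unlift ord0 i is Some j then a 0 j else 1 - \sum_j a 0 j.
have u0 : u ord0 = 1 - \sum_j a 0 j by rewrite /u unlift_none.
have y0 : y ord0 = q by rewrite /y unlift_none.
have uS j : u (lift ord0 j) = a 0 j by rewrite /u liftK.
have yS j : y (lift ord0 j) = if dotv w (v j - q) == 0 then v j else q by rewrite /y liftK.
exists n.+1, y, u; split.
- move=> i; rewrite /y; case: unlift => [j|]; last by split=> //; rewrite /plane /= subrr dotv0.
  case: ifPn => [/eqP h|_]; first by split=> //; exact: conv_hull_vertex.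
  by split=> //; rewrite /plane /= subrr dotv0.
- rewrite big_ord_recl; under eq_bigr do rewrite uS.
  by rewrite u0 subrK.
- rewrite big_ord_recl; under eq_bigr do rewrite uS yS.
  rewrite u0 y0 rowA scalerBl scale1r scaler_suml -addrA; congr (_ + _).
  rewrite addrC -sumrB; apply: eq_bigr => i _.
  by case: ifP => _; [rewrite scalerBr|rewrite subrr scaler0].
Qed.

Lemma rank_orth n (A : 'M[R]_(n, 3)) w : w != 0 ->
  (forall i, dotv w (row i A) = 0) -> (\rank A <= 2)%N.
Proof.
move=> w0 h; have : A *m w^T = 0.
  apply/matrixP => i j; rewrite !mxE; have := h i; rewrite /dotv => {2}<-.
  by apply: eq_bigr => k _; rewrite !mxE ord1 mulrC.
move/mulmx0_rank_max; rewrite mxrank_tr rank_rV w0 addn1.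
by [].
Qed.

Lemma rank_orth_ex n (A : 'M[R]_(n, 3)) w : (\rank A < 2)%N ->
  exists m : 'rV[R]_3, [/\ m != 0, dotv w m = 0 & forall i, dotv m (row i A) = 0].
Proof.
move=> rA; pose C := col_mx A w.
have rC : (\rank C < 3)%N.
  have := mxrank_adds_leqif A w; rewrite addsmxE => -[h _].
  apply: leq_ltn_trans h _; have rw := rank_leq_row w.
  by rewrite -[3%N]/(2 + 1)%N -addSn leq_add.
have : kermx C^T != 0.
  by rewrite -mxrank_eq0 mxrank_ker mxrank_tr -lt0n subn_gt0.
move=> /rowV0Pn[m /sub_kermxP mC m0]; exists m; split=> //.
- have := congr1 (fun M : 'rV[R]_(n + 1) => M 0 (rshift n 0)) mC; rewrite !mxE => E.
  by rewrite dotvC /dotv -[RHS]E; apply: eq_bigr => k _; rewrite mxE /C col_mxEd.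
- move=> i; have := congr1 (fun M : 'rV[R]_(n + 1) => M 0 (lshift 1 i)) mC; rewrite !mxE => E.
  by rewrite /dotv -[RHS]E; apply: eq_bigr => k _; rewrite [row i A 0 k]mxE [C^T _ _]mxE /C col_mxEu.
Qed.

End Convex.

(** * Local extrema of the distance as unstable and stable points *)

Section Extrema.
Variable R : realType.
Implicit Types (K F : set 'rV[R]_3) (c p q x y w : 'rV[R]_3).

Lemma admissible_body K : admissible K -> convex_body K.
Proof. by move=> [[[]]|[[]]]. Qed.

(** The start of the segment from [q] to [y] stays in [K] and in [W], where the distance is at most
    that of [q]; expand the square and divide by [t]. Keeping the quadratic term forces the support
    plane to meet [K] in [q] alone, hence a vertex in the polytope case. *)
Lemma local_max_support K c q (W : set 'rV[R]_3) : convex_set K -> K q ->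
  open W -> W q -> (forall z, K z -> W z -> enorm (z - c) <= enorm (q - c)) ->
  forall y, K y -> exists2 e : R, 0 < e & 2 * dotv (q - c) (y - q) <= - (e * dotv (y - q) (y - q)).
Proof.
move=> cK Kq oW Wq hmax y Ky.
have Wn : nbhs q W by exact: open_nbhs_nbhs.
have [e e0 he] := nbhs_line (y - q) Wn.
pose t := Num.min (e / 2) 1.
have t0 : 0 < t by rewrite lt_min ltr01 divr_gt0.
have t1 : t <= 1 by rewrite ge_min lexx orbT.
have te : `|t| < e by rewrite gtr0_norm// gt_min; apply/orP; left; lra.
exists t => //.
have := hmax _ (convex_segment cK Kq Ky (ltW t0) t1) (he _ te).
rewrite enorm_le addrAC dotv_add_scale => h.
have : t * (2 * dotv (q - c) (y - q) + t * dotv (y - q) (y - q)) <= 0 by lra.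
by rewrite pmulr_rle0// -lerBrDr sub0r.
Qed.

Lemma local_max_unstable K q (W : set 'rV[R]_3) : admissible K -> K q ->
  q != centroid K -> open W -> W q ->
  (forall z, K z -> W z -> enorm (z - centroid K) <= enorm (q - centroid K)) ->
  unstable_points K q.
Proof.
set c := centroid K => aK Kq qc oW Wq hmax.
have [cptK cK _] := admissible_body aK.
have sup := local_max_support cK Kq oW Wq hmax.
have eq : equilibrium K c q.
  apply: equilibrium_max => // [|y Ky]; first exact: compact_closed_rV.
  have [e e0 h] := sup _ Ky.
  by have := mulr_ge0 (ltW e0) (dotvv_ge0 (y - q)); lra.
split=> //; case: aK => [[sK /(_ _ eq) nd]|[pK /(_ _ eq) nd]]; [left|right].
  split=> //; split=> //; apply: smooth_max_index => //.
  have clE : closure K = K by apply/esym/closure_id; exact: compact_closed_rV.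
  by exists W => // z [+ _]; rewrite clE => Kz; exact: hmax.
split=> //; split=> //; have [F [fF rF E]] := nd.
exists F; split=> //; have FE : F = [set q].
  apply/seteqP; split=> [y|y ->]; last by case: rF.
  rewrite -E => -[Ky /= py]; have [e e0] := sup _ Ky.
  rewrite py mulr0 oppr_ge0 pmulr_rle0// => h.
  by apply/eqP; rewrite -subr_eq0 -dotvv_eq0 eq_le h dotvv_ge0.
exists q, 0; split; first by rewrite /row_free -leqn0 rank_leq_row.
apply/seteqP; split=> x.
  rewrite FE => -[m [v [l [vq l1 ->]]]]; exists 0 => //.
  rewrite mul0mx addr0 -[q]scale1r -l1 scaler_suml; apply: eq_bigr => i _.
  by rewrite (vq i).
move=> [a _ <-]; rewrite mulmx0 addr0.
exists 1%N, (fun=> q), (fun=> 1); split; last by rewrite big_ord_recl big_ord0 addr0 scale1r.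
  by rewrite FE.
by rewrite big_ord_recl big_ord0 addr0.
Qed.

Lemma local_min_stable K q (W : set 'rV[R]_3) : admissible K -> bd K q ->
  q != centroid K -> open W -> W q ->
  (forall z, W z -> enorm (z - centroid K) < enorm (q - centroid K) -> K z) ->
  stable_points K q.
Proof.
set c := centroid K => aK bq qc oW Wq hmin.
have [cptK cK _] := admissible_body aK.
have clK := compact_closed_rV cptK.
have Kq : K q by case: bq => + _; rewrite -((closure_id K).1 clK).
have r0 : 0 < dotv (q - c) (q - c) by rewrite dotvv_gt0 subr_eq0.
have Wn : nbhs q W by exact: open_nbhs_nbhs.
have oB : open (W `&` [set z | enorm (z - c) < enorm (q - c)]).
  apply: openI => //.
  have -> : [set z | enorm (z - c) < enorm (q - c)] =
      (fun z => dotv (z - c) (z - c)) @^-1` [set r | r < dotv (q - c) (q - c)].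
    by apply/seteqP; split => z; rewrite /= -!enorm_sqr ltr_pXn2r// nnegrE enorm_ge0.
  apply: open_comp; last exact: open_lt.
  by move=> z _; apply: continuous_dotv; exact: continuous_subr.
have Bint z : W z -> enorm (z - c) < enorm (q - c) -> interior K z.
  move=> Wz hz; have : nbhs z (W `&` [set z | enorm (z - c) < enorm (q - c)]).
    by apply: open_nbhs_nbhs; split.
  by apply: filterS => y [Wy hy]; exact: hmin.
(* Directions pointing into the ball stay, for a short time, inside [K]. *)
have into d : dotv (q - c) d < 0 -> exists2 e : R, 0 < e &
    forall t, 0 < t -> t < e -> interior K (q + t *: d).
  move=> hd; have [e e0 he] := nbhs_line d Wn.
  have d1 : 0 < dotv d d + 1 by rewrite ltr_wpDl ?dotvv_ge0.
  pose e' := Num.min e (- dotv (q - c) d / (dotv d d + 1)).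
  exists e'; first by rewrite lt_min e0 divr_gt0// oppr_gt0.
  move=> t t0; rewrite lt_min => /andP[te]; rewrite ltr_pdivlMr// => td.
  apply: Bint; first by apply: he; rewrite gtr0_norm.
  rewrite ltNge enorm_le -ltNge addrAC dotv_add_scale -addrA gtrDl.
  have -> : 2 * t * dotv (q - c) d + t ^+ 2 * dotv d d = t * (2 * dotv (q - c) d + t * dotv d d) by ring.
  by rewrite pmulr_rlt0//; lra.
(* From a point [y] beyond the plane, the reflected direction leads from [q] into the ball, hence
   into the interior of [K]. Then [q] lies between an interior point and [y], so it would be
   interior; [s] is its position on that segment. *)
have sup y : K y -> dotv (q - c) (y - q) <= 0.
  move=> Ky; rewrite leNgt; apply/negP => h.
  have [|e e0 he] := into (- (y - q)); first by rewrite dotvNr oppr_lt0.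
  have e2 : 0 < e / 2 by rewrite divr_gt0.
  have := he (e / 2) e2 => /(_ _) Ke.
  have {}Ke : interior K (q + (e / 2) *: - (y - q)) by apply: Ke; lra.
  pose s := (e / 2) / (1 + e / 2).
  have s1 : s < 1 by rewrite /s ltr_pdivrMr; lra.
  have s0 : 0 <= s by rewrite /s divr_ge0; lra.
  have := interior_between cK Ke Ky s0 s1.
  have -> : q + e / 2 *: - (y - q) + s *: (y - (q + e / 2 *: - (y - q))) = q.
    have -> : y - (q + e / 2 *: - (y - q)) = (1 + e / 2) *: (y - q).
      by rewrite scalerN opprD opprK addrA scalerDl scale1r.
    rewrite scalerA /s divfK; last by rewrite gt_eqF; lra.
    by rewrite scalerN -addrA addNr addr0.
  by case: bq.
have eq : equilibrium K c q by exact: equilibrium_max.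
split=> //; case: aK => [[sK /(_ _ eq) nd]|[pK /(_ _ eq) nd]]; [left|right].
  split=> //; split=> //; apply: smooth_min_index => //.
  exists W => // z [_ iz] Wz; rewrite leNgt; apply/negP => hz; apply: iz.
  exact: Bint.
split=> //; split=> //; have [F [fF rF E]] := nd.
exists F; split=> //; rewrite -E subn0.
have [_ [n [v KE]]] := pK.
have hv i : dotv (q - c) (v i - q) <= 0 by apply: sup; rewrite KE; exact: conv_hull_vertex.
have Kq' : conv_hull v q by rewrite -KE.
have := aff_hull_face_dim hv Kq'; rewrite -KE /=.
set A := \matrix_i _ => hd; suff rA : \rank A = 2%N by rewrite rA in hd.
have qc0 : q - c != 0 by rewrite subr_eq0.
apply/eqP; rewrite eqn_leq; apply/andP; split.
  apply: (@rank_orth _ _ _ (q - c)) => // i; rewrite rowK.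
  by case: eqP => // _; rewrite dotv0.
(* If the face had dimension below 2, some [m] in the support plane would be orthogonal to it,
   leaving room to tilt the plane. *)
rewrite leqNgt; apply/negP => /(rank_orth_ex (q - c))[m [m0 mw mA]].
have mm : 0 < dotv m m by rewrite dotvv_gt0.
(* Tilting the support plane slightly towards [m] keeps [K] on one side. *)
have [s s0 hs] : exists2 s : R, 0 < s &
    forall i, dotv (q - c + s *: m) (v i - q) <= 0.
  have [s s0 hs] : exists2 s : R, 0 < s & forall i, dotv (q - c) (v i - q) != 0 ->
      s * `|dotv m (v i - q)| <= - dotv (q - c) (v i - q).
    pose f i : R := if dotv (q - c) (v i - q) == 0 then 1 else
      - dotv (q - c) (v i - q) / (`|dotv m (v i - q)| + 1).
    have f0 i : 0 < f i.
      rewrite /f; case: ifPn => // h; rewrite divr_gt0// ?ltr_wpDl//.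
      by rewrite oppr_gt0 lt_neqAle h hv.
    exists (\big[Num.min/1]_i f i); first by elim/big_ind: _ => // x y x0 y0; rewrite lt_min x0.
    move=> i h; have := bigmin_le 1 i f.
    rewrite {2}/f (negbTE h) ler_pdivlMr ?ltr_wpDl//; apply: le_trans.
    rewrite ler_wpM2l ?lerDl//.
    by apply/ltW; elim/big_ind: _ => // x y x0 y0; rewrite lt_min x0.
  exists s => // i; rewrite dotvDl dotvZl.
  have [h|h] := eqVneq (dotv (q - c) (v i - q)) 0.
    have := mA i; rewrite rowK h eqxx => ->; by rewrite mulr0 addr0.
  have := hs i h; have : s * dotv m (v i - q) <= s * `|dotv m (v i - q)|.
    by rewrite ler_wpM2l ?(ltW s0)// ler_norm.
  by lra.
(* The direction [d] points into the ball, so a short step along it stays in [K]. The size of [b]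
   gives the tilted functional the value [dotv (q - c) (q - c) > 0] on [d], against the tilted
   support. *)
pose b := 2 * dotv (q - c) (q - c) / (s * dotv m m).
pose d := - (q - c) + b *: m.
have [|e e0 he] := into d.
  by rewrite /d dotvDr dotvZr mw mulr0 addr0 dotvNr oppr_lt0.
have e2 : 0 < e / 2 by rewrite divr_gt0.
have e2' : e / 2 < e by lra.
have Ke : K (q + (e / 2) *: d) := interior_subset (he _ e2 e2').
have := @conv_hull_dot _ _ v (q - c + s *: m) q 0 hs; rewrite -KE => /(_ _ Ke).
have -> : q + (e / 2) *: d - q = (e / 2) *: d by rewrite addrAC subrr add0r.
rewrite dotvZr pmulr_rle0// /d dotvDr dotvNr dotvZr.
rewrite !(dotvDl (q - c) (s *: m)) !dotvZl mw.
rewrite [dotv m (q - c)]dotvC mw mulr0 addr0 add0r /b.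
have -> : 2 * dotv (q - c) (q - c) / (s * dotv m m) * (s * dotv m m) = 2 * dotv (q - c) (q - c).
  by rewrite divfK// mulf_neq0// gt_eqF.
by lra.
Qed.

End Extrema.

(** * Faces, simplices and corners *)

Section Faces.
Variable R : realType.
Implicit Types (K F : set 'rV[R]_3) (c p q y w : 'rV[R]_3).

Lemma has_dim_le F d d' : has_dim F d -> has_dim F d' -> (d <= d')%N.
Proof.
move=> [p [B [fB E]]] [p' [B' [fB' E']]].
have inB' a : exists a', p + a *m B = p' + a' *m B'.
  have : aff_hull F (p + a *m B) by rewrite E; exists a.
  by rewrite E' => -[a' _ <-]; exists a'.
have sub : (B <= B')%MS.
  apply/row_subP => i; have [a1 h1] := inB' (delta_mx 0 i).
  have [a0] := inB' 0; rewrite mul0mx addr0 => h0.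
  have -> : row i B = (a1 - a0) *m B'.
    by rewrite mulmxBl rowE -[LHS](addKr p) h1 h0 opprD addrACA addNr add0r addrC.
  exact: submxMl.
by have := mxrankS sub; rewrite (eqP fB) (eqP fB').
Qed.

Lemma has_dim_unique F d d' : has_dim F d -> has_dim F d' -> d = d'.
Proof. by move=> h h'; apply/eqP; rewrite eqn_leq !(@has_dim_le F). Qed.

Lemma aff_hull_line F x q (t : R) : F x -> F q -> aff_hull F (q + t *: (x - q)).
Proof.
move=> Fx Fq; exists 2%N, (fun i => if i == 0 then x else q), (fun i => if i == 0 then t else 1 - t).
split; first by move=> i; case: ifP.
  by rewrite !big_ord_recl big_ord0 /=; ring.
rewrite !big_ord_recl big_ord0 /= addr0 scalerBr scalerBl scale1r.
by rewrite [RHS]addrCA.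
Qed.

(** From [x] in [F1] the segment can be prolonged a little beyond [q] inside [F1]. The functional of
    [F2] is extremal at the inner point [q], hence constant along the segment. *)
Lemma relint_face_sub K F1 F2 q : face K F1 -> face K F2 -> relint F1 q -> F2 q ->
  F1 `<=` F2.
Proof.
move=> [p1 [n1 [_ E1]]] [p2 [n2 [[_ _ sup] E2]]] [F1q [W [oW Wq] WF]] F2q x F1x.
have F1K : F1 `<=` K by rewrite E1 => y [].
have q2 : dotv n2 (q - p2) = 0 by move: F2q; rewrite E2 => -[].
have Wn : nbhs q W by exact: open_nbhs_nbhs.
have [e e0 he] := nbhs_line (x - q) Wn.
have Ky : K (q + (- (e / 2)) *: (x - q)).
  apply: F1K; apply: WF; split; last exact: aff_hull_line.
  by apply: he; rewrite normrN gtr0_norm; lra.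
rewrite E2; split; first exact: F1K.
have xq : dotv n2 (x - p2) = dotv n2 (x - q) + dotv n2 (q - p2).
  by rewrite -dotvDr addrA subrK.
have yq : dotv n2 (q + (- (e / 2)) *: (x - q) - p2) = - (e / 2) * dotv n2 (x - q) + dotv n2 (q - p2).
  have -> : q + (- (e / 2)) *: (x - q) - p2 = (- (e / 2)) *: (x - q) + (q - p2).
    by rewrite [q + _]addrC addrA.
  by rewrite [LHS]dotvDr dotvZr.
rewrite /plane /= xq q2 addr0; apply/eqP; rewrite eq_le.
have h2 : e / 2 * dotv n2 (x - q) = - (- (e / 2) * dotv n2 (x - q)) by ring.
have e2 : 0 < e / 2 by rewrite divr_gt0.
case: sup => sup; have := sup _ Ky; have := sup _ (F1K _ F1x);
  rewrite xq yq q2 !addr0 => h3 h4.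
  by rewrite h3 andbT -(pmulr_rle0 _ e2) h2 oppr_le0.
by rewrite h3 /= -(pmulr_rge0 _ e2) h2 oppr_ge0.
Qed.

(** A point lies in the relative interior of only one face, so its index is well defined. *)
Lemma index_dim K F q d k : face K F -> relint F q -> has_dim F d ->
  poly_index K q k -> d = (2 - k)%N.
Proof.
move=> fF rF hd [F' [fF' rF' hd']].
have FF' : F = F'.
  apply/seteqP; split; apply: relint_face_sub; eauto; [by case: rF'|by case: rF].
by rewrite FF' in hd; exact: has_dim_unique hd hd'.
Qed.

Section Simplex.
Variables (d : nat) (u : 'I_d.+1 -> 'rV[R]_3).
Let B : 'M[R]_(d, 3) := \matrix_i (u (lift ord0 i) - u ord0).
Hypothesis fB : row_free B.

Let coords (l : 'I_d.+1 -> R) : \sum_i l i = 1 ->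
  \sum_i l i *: u i = u ord0 + (\row_i l (lift ord0 i)) *m B.
Proof.
move=> l1; rewrite mulmx_sum_row.
under [in RHS]eq_bigr do rewrite rowK mxE scalerBr.
rewrite sumrB -scaler_suml big_ord_recl.
move: l1; rewrite big_ord_recl => /(canRL (addKr _)) ->.
move: (\sum_j _) (l ord0) (u ord0) => S a v.
by apply/rowP => k; rewrite !mxE; ring.
Qed.

Let weights (a : 'rV[R]_d) (i : 'I_d.+1) :=
  if unlift ord0 i is Some j then a 0 j else 1 - \sum_j a 0 j.

Let weights_sum a : \sum_i weights a i = 1.
Proof.
rewrite big_ord_recl {1}/weights unlift_none.
have -> : \sum_(i < d) weights a (lift ord0 i) = \sum_j a 0 j.
  by apply: eq_bigr => j _; rewrite /weights liftK.
by rewrite subrK.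
Qed.

Let weights_coords a : u ord0 + a *m B = \sum_i weights a i *: u i.
Proof.
rewrite coords ?weights_sum//; congr (_ + _ *m _).
by apply/rowP => j; rewrite mxE /weights liftK.
Qed.

Lemma simplex_aff_hull :
  aff_hull (conv_hull u) = [set u ord0 + a *m B | a in [set: 'rV[R]_d]].
Proof.
apply/seteqP; split=> x.
  move=> [m [v [w [vu w1 ->]]]].
  have /choice[L hL] : forall j, exists a : 'rV[R]_d, v j = u ord0 + a *m B.
    by move=> j; have [l [_ l1 ->]] := vu j; rewrite coords//; exists (\row_i l (lift ord0 i)).
  exists (\sum_j w j *: L j) => //.
  rewrite mulmx_suml -{1}[u ord0]scale1r -w1 scaler_suml -big_split; apply: eq_bigr => j _ /=.
  by rewrite -scalemxAl -scalerDr -hL.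
move=> [a _ <-]; rewrite weights_coords; exists d.+1, u, (weights a); split=> //.
by move=> i; exact: conv_hull_vertex.
Qed.

Lemma simplex_dim : has_dim (conv_hull u) d.
Proof. by exists (u ord0), B; split=> //; exact: simplex_aff_hull. Qed.

(** The pseudoinverse of [B] extends the barycentric coordinates to affine functions on the whole
    space, and positivity of all of them is an open condition. *)
Lemma simplex_relint (l : 'I_d.+1 -> R) : (forall i, 0 < l i) -> \sum_i l i = 1 ->
  relint (conv_hull u) (\sum_i l i *: u i).
Proof.
move=> l0 l1; split; first by exists l; split=> // i; exact: ltW.
set q := \sum_i _.
pose A x := (x - u ord0) *m pinvmx B.
have AK a : A (u ord0 + a *m B) = a by rewrite /A addrC addKr -mulmxA mulmxVp// mulmx1.
pose wt i : 'rV[R]_3 := (col i (pinvmx B))^T.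
have AE x i : A x 0 i = dotv (wt i) (x - u ord0).
  by rewrite !mxE /dotv; apply: eq_bigr => k _; rewrite !mxE mulrC.
have Aq : A q = \row_i l (lift ord0 i) by rewrite /q coords// AK.
exists (interior [set x | (forall i, 0 < A x 0 i) /\ \sum_i A x 0 i < 1]).
  split; first exact: open_interior.
  have n1 : \forall x \near q, forall i, 0 < A x 0 i.
    apply: (@filter_forall _ _ (fun i x => 0 < A x 0 i) (nbhs q)) => i.
    have : nbhs q [set x | 0 < dotv (wt i) (x - u ord0)].
      by apply: open_nbhs_nbhs; split; [exact: open_dot_gt|rewrite /= -AE Aq mxE].
    by apply: filterS => x /=; rewrite -AE.
  have n2 : \forall x \near q, \sum_i A x 0 i < 1.
    have SE x : \sum_i A x 0 i = dotv (\sum_i 1 *: wt i) (x - u ord0).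
      by rewrite dotvC dotv_sumr; apply: eq_bigr => i _; rewrite AE dotvC mul1r.
    have : nbhs q [set x | dotv (\sum_i 1 *: wt i) (x - u ord0) < 1].
      apply: open_nbhs_nbhs; split; [exact: open_dot_lt|rewrite /= -SE Aq].
      under eq_bigr do rewrite mxE.
      by rewrite -l1 big_ord_recl ltrDr.
    by apply: filterS => x /=; rewrite -SE.
  by apply: filterS2 n1 n2.
move=> x [/interior_subset[h1 h2]]; rewrite simplex_aff_hull => -[a _ xE].
move: h1 h2; rewrite -xE AK => h1 h2; rewrite weights_coords.
exists (weights a); split=> // i; rewrite /weights.
by case: unlift => [j|]; [exact: ltW|rewrite subr_ge0 ltW].
Qed.
End Simplex.

(* The tangent plane of a smooth surface leaves room for only one supporting
   direction. *)
Lemma not_smooth_corner K q w1 w2 : closed K -> bd K q ->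
  (\rank (col_mx w1 w2) = 2)%N ->
  (forall y, K y -> dotv w1 (y - q) <= 0) ->
  (forall y, K y -> dotv w2 (y - q) <= 0) -> ~ smooth_body K.
Proof.
move=> clK bq rw s1 s2 [_ /(_ _ bq)[U [phi [u [[oU sphi fJ _ lp] Uu phiu]]]]].
have bK z : bd K z -> K z by case=> + _; rewrite -((closure_id K).1 clK).
have Un : \forall x \near u, U x by exact: open_nbhs_nbhs.
have phiK x : U x -> K (phi x).
  move=> Ux; apply: bK; have [V _ E] := lp U oU (@subset_refl _ U).
  by have : (phi @` U) (phi x) by [exists x]; rewrite E => -[].
have key w v : (forall y, K y -> dotv w (y - q) <= 0) -> dotv w (v *m 'J phi u) = 0.
  move=> hw; pose f x := dotv w (phi x - q).
  have fE : f = \sum_i (fun x => w 0 i * (phi x 0 i - q 0 i)).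
    by apply/funext => x; rewrite /f /dotv fct_sumE; apply: eq_bigr => i _; rewrite !mxE.
  have dp x i : U x -> differentiable (fun x => phi x 0 i - q 0 i) x.
    by move=> Ux; apply: differentiableB => //; have [] := class_C2_coord i (sphi 2) Ux.
  have df : \forall x \near u, differentiable f x.
    apply: filterS Un => x Ux; rewrite fE; apply: differentiable_sum => i.
    by apply: differentiableM => //; exact: dp.
  have fmax : \forall x \near u, f x <= f u.
    apply: filterS Un => x Ux; rewrite {2}/f phiu subrr dotv0.
    exact: hw (phiK _ Ux).
  have dphi : differentiable phi u by have [/(_ _ Uu)] := sphi 1.
  have <- := derive_max0 v df fmax.
  rewrite -(deriveEjacobian v dphi) fE derive_sum => [|i]; last first.
    by apply: diff_derivable; apply: differentiableM => //; exact: dp.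
  apply: eq_bigr => i _; rewrite deriveM//; last by apply: diff_derivable; exact: dp.
  have [di /(_ v)[<- _]] := class_C2_coord i (sphi 2) Uu.
  have -> : (fun x => phi x 0 i - q 0 i) = (fun x => phi x 0 i) - cst (q 0 i) by [].
  rewrite deriveB//; last exact: diff_derivable.
  by rewrite !derive_cst subr0 scaler0 addr0.
have J0 : 'J phi u *m (col_mx w1 w2)^T = 0.
  apply/row_matrixP => i; rewrite row_mul row0 rowE.
  have h1 := key w1 (delta_mx 0 i) s1; have h2 := key w2 (delta_mx 0 i) s2.
  rewrite tr_col_mx mul_mx_row.
  have E w : dotv w (delta_mx 0 i *m 'J phi u) = 0 -> (delta_mx 0 i : 'rV[R]_2) *m 'J phi u *m w^T = 0.
    move=> h; apply/matrixP => a b; rewrite !ord1 mxE [RHS]mxE -[RHS]h.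
    by rewrite /dotv ; apply: eq_bigr => k _; rewrite [w^T _ _]mxE mulrC.
  by rewrite !E// row_mx0.
(* The tangent plane and two independent normals would need dimension [2 + 2], more than 3. *)
have := mulmx0_rank_max J0; rewrite mxrank_tr rw (eqP (fJ u Uu)).
by [].
Qed.

End Faces.

(** * Two stable points in a flat body, two unstable points in a long one *)

Section Halves.
Variable R : realType.
Implicit Types (K F : set 'rV[R]_3) (c p q y z w e : 'rV[R]_3).

Lemma dot_sub_le_enorm e y : dotv e e = 1 -> dotv e y <= enorm y.
Proof. by move=> e1; rewrite (le_trans (dotv_le_enorm _ _))// {1}/enorm e1 sqrtr1 mul1r. Qed.

Lemma continuous_enorm c : continuous (fun z : 'rV[R]_3 => enorm (z - c)).
Proof.
have cD : continuous (fun z : 'rV[R]_3 => dotv (z - c) (z - c)).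
  by apply: continuous_dotv; exact: continuous_subr.
by move=> z; apply: (continuous_comp (cD z)); exact: sqrt_continuous.
Qed.

(** On the cutting plane through the centroid distances are at most [D], while [u] is farther away.
    The maximum over the closed half therefore avoids the plane and is a local maximum on all of
    [K]. *)
Lemma unstable_half K e (D : R) : admissible K -> dotv e e = 1 -> 0 < D ->
  (forall y, K y -> dotv e (y - centroid K) = 0 -> enorm (y - centroid K) <= D) ->
  (exists2 u, K u & D < dotv e (u - centroid K)) ->
  exists2 q, unstable_points K q & 0 < dotv e (q - centroid K).
Proof.
set c := centroid K => aK e1 D0 hD [u Ku hu].
have [cptK cK _] := admissible_body aK.
have cptA : compact (K `&` [set z | 0 <= dotv e (z - c)]).
  by apply: compact_closedI => //; exact: closed_dot_ge.
have [||q] := EVT_max_rV (f := fun z => enorm (z - c)) _ cptA.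
- by exists u; split => //; rewrite /= ltW// (lt_trans D0).
- by apply: continuous_subspaceT; exact: continuous_enorm.
rewrite inE => -[Kq /= q0] qmax.
have Dq : D < enorm (q - c).
  apply: (lt_le_trans hu); apply: le_trans (dot_sub_le_enorm _ e1) _; apply: qmax.
  by rewrite inE; split=> //=; rewrite ltW// (lt_trans D0).
have q1 : 0 < dotv e (q - c).
  rewrite lt_neqAle q0 andbT eq_sym; apply/eqP => /(hD _ Kq).
  by rewrite leNgt Dq.
exists q => //; apply: (@local_max_unstable _ K q [set z | 0 < dotv e (z - c)]) => //.
- by apply/eqP => qc; move: q1; rewrite qc subrr dotv0 ltxx.
- exact: open_dot_gt.
- by move=> z Kz /= /ltW z0; apply: qmax; rewrite inE.
Qed.

Lemma exit_point K c z : compact K -> K c -> ~ K z ->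
  exists s : R, [/\ 0 <= s, s < 1 & bd K (c + s *: (z - c))].
Proof.
move=> cptK Kc Kz; have clK := compact_closed_rV cptK.
have cptC : compact (`[0, 1] `&` [set s : R | K (c + s *: (z - c))]).
  apply: compact_closedI; first exact: segment_compact.
  by apply: closed_comp => // s _; exact: continuous_line.
have [||s] := @compact_EVT_max _ R (fun s : R => s) _ _ cptC.
- by exists 0; split; rewrite /= ?in_itv/= ?lexx ?ler01// scale0r addr0.
- by apply: continuous_subspaceT => s; exact: cvg_id.
rewrite inE /= in_itv/= => -[/andP[s0 s1] Ks] smax.
have {}s1 : s < 1.
  rewrite lt_neqAle s1 andbT; apply/eqP => s1'; apply: Kz.
  by move: Ks; rewrite s1' scale1r addrC subrK.
exists s; split=> //; split; first exact: subset_closure.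
move=> /(nbhs_line (z - c))[e e0 he].
pose t := Num.min (e / 2) (1 - s).
have t0 : 0 < t by rewrite lt_min divr_gt0//= subr_gt0.
have te : `|t| < e by rewrite gtr0_norm// gt_min; apply/orP; left; lra.
have t1 : t <= 1 - s by rewrite ge_min lexx orbT.
have /smax : s + t \in (`[0, 1] `&` [set s : R | K (c + s *: (z - c))]).
  rewrite inE /= in_itv/=; split; first by lra.
  by have := he t te; rewrite -addrA -scalerDl.
by lra.
Qed.

Lemma stable_half K e (h : R) : admissible K -> dotv e e = 1 -> 0 < h ->
  interior K (centroid K) ->
  (forall y, bd K y -> dotv e (y - centroid K) = 0 -> h < enorm (y - centroid K)) ->
  (forall y, K y -> dotv e (y - centroid K) <= h) ->
  exists2 q, stable_points K q & 0 < dotv e (q - centroid K).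
Proof.
set c := centroid K => aK e1 h0 ic hD htop.
have [cptK cK _] := admissible_body aK; have clK := compact_closed_rV cptK.
have Kc := interior_subset ic.
have bK z : bd K z -> K z by case=> + _; rewrite -((closure_id K).1 clK).
have clbd : closed (bd K).
  by apply: closedI; [exact: closed_closure|apply: open_closedC; exact: open_interior].
have cptA : compact (bd K `&` [set z | 0 <= dotv e (z - c)]).
  apply: (@subclosed_compact _ _ K) => //; last by move=> z [/bK].
  by apply: closedI => //; exact: closed_dot_ge.
(* The ray from the centroid in direction [e] leaves [K] at distance at most [h], whereas the
   boundary points in the cutting plane are farther than [h]; so the minimum is off the plane. *)
have [u [bu u0 uh]] : exists u, [/\ bd K u, 0 <= dotv e (u - c) & enorm (u - c) <= h].
  have [|s [s0 s1 bs]] := @exit_point K c (c + (h + 1) *: e) cptK Kc.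
    by move=> /htop; rewrite addrAC subrr add0r dotvZr e1 mulr1; lra.
  exists (c + s *: (c + (h + 1) *: e - c)).
  move: bs; rewrite addrAC subrr add0r scalerA => bs; split=> //.
    by rewrite addrAC subrr add0r dotvZr e1 mulr1 mulr_ge0//; lra.
  have := htop _ (bK _ bs); rewrite addrAC subrr add0r dotvZr e1 mulr1 => hs.
  rewrite /enorm dotvZl dotvZr e1 mulr1 -expr2 sqrtr_sqr ger0_norm//.
  by rewrite mulr_ge0//; lra.
have [||q] := EVT_min_rV (f := fun z => enorm (z - c)) _ cptA.
- by exists u.
- by apply: continuous_subspaceT; exact: continuous_enorm.
rewrite inE => -[bq /= q0] qmin.
have hq : enorm (q - c) <= h by apply: le_trans uh; apply: qmin; rewrite inE.
have q1 : 0 < dotv e (q - c).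
  rewrite lt_neqAle q0 andbT eq_sym; apply/eqP => /(hD _ bq).
  by rewrite ltNge hq.
exists q => //; apply: (@local_min_stable _ K q [set z | 0 < dotv e (z - c)]) => //.
- by apply/eqP => qc; move: q1; rewrite qc subrr dotv0 ltxx.
- exact: open_dot_gt.
- move=> z /= z0 zq; apply: contrapT => Kz.
  (* If [z] were outside [K], the segment from the centroid to [z] would leave [K] at a boundary
     point closer than [q] and on the same side. *)
  have [s [s0 s1 bs]] := exit_point cptK Kc Kz.
  have : enorm (q - c) <= enorm (c + s *: (z - c) - c).
    apply: qmin; rewrite inE; split=> //=.
    by rewrite addrAC subrr add0r dotvZr mulr_ge0// ltW.
  rewrite addrAC subrr add0r leNgt => /negP; apply.
  rewrite /enorm dotvZl dotvZr mulrA -expr2 sqrtrM ?sqr_ge0// sqrtr_sqr ger0_norm//.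
  by rewrite (le_lt_trans _ zq)// ler_piMl ?enorm_ge0// ltW.
Qed.

(** With [q] the point of [K] nearest to [p], the vector [w = p - q] separates with gap [dotv w w].
    The explicit gap settles the case of a vertical [w] in [flat_disc]. *)
Lemma separation K p : compact K -> convex_set K -> K !=set0 -> ~ K p ->
  exists2 w, w != 0 & forall y, K y -> dotv w y <= dotv w p - dotv w w.
Proof.
move=> cptK cK K0 Kp.
have [|q] := EVT_min_rV (f := fun z => enorm (z - p)) K0 cptK.
  by apply: continuous_subspaceT; exact: continuous_enorm.
rewrite inE => Kq qmin; exists (p - q).
  by rewrite subr_eq0; apply/eqP => pq; rewrite pq in Kp.
move=> y Ky; suff h : dotv (p - q) (y - q) <= 0.
  rewrite -dotvBr opprB addrCA subrr addr0.
  by move: h; rewrite dotvBr subr_le0.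
rewrite leNgt; apply/negP => h.
have yy := dotvv_ge0 (y - q).
pose t := Num.min 1 (dotv (p - q) (y - q) / (dotv (y - q) (y - q) + 1)).
have t0 : 0 < t by rewrite lt_min ltr01 divr_gt0//; lra.
have t1 : t <= 1 by rewrite ge_min lexx.
have th : t * (dotv (y - q) (y - q) + 1) <= dotv (p - q) (y - q).
  by rewrite -ler_pdivlMr; [rewrite ge_min lexx orbT|lra].
have : enorm (q - p) <= enorm (q + t *: (y - q) - p).
  by apply: qmin; rewrite inE; apply: convex_segment => //; exact: ltW.
have e2 : dotv (q - p) (y - q) = - dotv (p - q) (y - q) by rewrite -opprB dotvNl.
rewrite enorm_le addrAC dotv_add_scale e2.
have -> : dotv (q - p) (q - p) + 2 * t * - dotv (p - q) (y - q) + t ^+ 2 * dotv (y - q) (y - q) =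
  dotv (q - p) (q - p) - t * (2 * dotv (p - q) (y - q) - t * dotv (y - q) (y - q)) by ring.
rewrite lerBrDr gerDl leNgt => /negP; apply; rewrite mulr_gt0//; lra.
Qed.

End Halves.

(** * Volume thresholds for two unstable and two stable points *)

Section Two_points.
Variable R : realType.
Local Notation mu := (@lebesgue_measure R).
Local Notation mu2 := (@lebesgue2 R).
Local Notation mu3 := (@lebesgue3 R).
Local Notation R1 := (measurableTypeR R).
Local Notation pre K := (@point3 R @^-1` K : set (R1 * R1 * R1)).
Implicit Types (K : set 'rV[R]_3) (c w e : 'rV[R]_3).

Lemma subvE n (x y : 'rV[R]_n) i : (x - y) 0 i = x 0 i - y 0 i.
Proof. by rewrite !mxE. Qed.

Definition ez : 'rV[R]_3 := vec3 0 0 1.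

Lemma dot_ez y : dotv ez y = y 0 i2.
Proof. by rewrite dotv3 /ez !vec3E; ring. Qed.

Lemma ez_unit : dotv ez ez = 1.
Proof. by rewrite dot_ez /ez vec3E. Qed.

Lemma Nez_unit : dotv (- ez) (- ez) = 1.
Proof. by rewrite dotvNl dotvNr opprK ez_unit. Qed.

Lemma enorm_sub3 (b : R) (y : 'rV[R]_3) : 0 <= b -> `|y 0 0| <= b -> `|y 0 i1| <= b -> y 0 i2 = 0 ->
  enorm y <= 2 * b.
Proof.
move=> b0 h0 h1 h2; rewrite -(ler_pXn2r (ltn0Sn 1)) ?nnegrE ?enorm_ge0 ?mulr_ge0//.
have sq (x : R) : `|x| <= b -> x * x <= b ^+ 2.
  by move=> h; rewrite -expr2 -(real_normK (num_real x)) ler_pXn2r// nnegrE.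
rewrite enorm_sqr dotv3 h2 mulr0 addr0 exprMn.
have := sq _ h0; have := sq _ h1; have := sqr_ge0 b; lra.
Qed.

Lemma centroid_coord_le K w (b : R) : convex_body K ->
  (forall x, K x -> `|dotv w x| <= b) -> `|dotv w (centroid K)| <= b.
Proof.
move=> bK h; rewrite ler_norml; apply/andP; split.
  rewrite lerNl -dotvNl; apply: centroid_le => // x /h.
  by rewrite ler_norml dotvNl => /andP[? _]; lra.
by apply: centroid_le => // x /h; rewrite ler_norml => /andP[].
Qed.

Lemma coord_dot (i : 'I_3) (y : 'rV[R]_3) : dotv (delta_mx 0 i) y = y 0 i.
Proof.
rewrite /dotv (bigD1 i)//= mxE !eqxx mul1r big1 ?addr0// => j ji.
by rewrite mxE eqxx (negbTE ji) mul0r.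
Qed.

Lemma centroid_coord K (i : 'I_3) (b : R) : convex_body K ->
  (forall x, K x -> `|x 0 i| <= b) -> `|centroid K 0 i| <= b.
Proof.
move=> bK h; rewrite -coord_dot; apply: centroid_coord_le => // x Kx.
by rewrite coord_dot; exact: h.
Qed.

Lemma vol_box_le K a b : measurable (pre K) -> a.1.1 < b.1.1 -> a.1.2 < b.1.2 -> a.2 < b.2 ->
  pre K `<=` box a b ->
  fine (vol K) <= (b.1.1 - a.1.1) * (b.1.2 - a.1.2) * (b.2 - a.2).
Proof.
move=> mK h1 h2 h3 sK; have le : (vol K <= ((b.1.1 - a.1.1) * (b.1.2 - a.1.2) * (b.2 - a.2))%:E)%E.
  by rewrite -lebesgue3_box//; apply: le_measure; rewrite ?inE//; exact: measurable_box.
have fK : vol K \is a fin_num by rewrite ge0_fin_numE ?measure_ge0// (le_lt_trans le)// ltry.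
by rewrite -lee_fin fineK.
Qed.

(** Otherwise [centroid_markov] with [d = 4] confines half of [K] to heights between 8 below and 4
    above the centroid. The value 4 bounds the distances in the horizontal section through the
    centroid. *)
Lemma long_reach K e : convex_body K -> e = ez \/ e = - ez ->
  (forall x, K x -> `|x 0 0| <= 1 /\ `|x 0 i1| <= 1) -> 600 < fine (vol K) ->
  exists2 u, K u & 4 < dotv e (u - centroid K).
Proof.
set c := centroid K => bK he hK hv; apply: contrapT => no.
have top y : K y -> dotv e (y - c) <= 4.
  by move=> Ky; rewrite leNgt; apply/negP => h; apply: no; exists y.
have [cK _ _] := bK.
have := centroid_markov bK (ltr0Sn R 3) top; set S := K `&` _ => hS.
have mS : measurable (pre S).
  by apply: closed_point3_measurable; apply: closedI; [exact: compact_closed_rV|exact: closed_dot_ge].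
suff : fine (vol S) <= 288 by lra.
clear no hv hS; have [g gE] : exists g, c 0 i2 = g by exists (c 0 i2).
(* The box has volume [4 * 4 * 18 = 288], so [K] would have at most 576. Its sides exceed what is
   needed because boxes are half-open. *)
have := @vol_box_le S (- 2, - 2, g - 9) (2, 2, g + 9) mS.
rewrite /= => H; apply: le_trans (H _ _ _ _) _; [lra|lra|lra| |lra].
move=> t [Kt /= St]; have [h0 h1] := hK _ Kt; have := top _ Kt; move: St.
move: h0 h1; rewrite !ler_norml !point3E => /andP[h01 h02] /andP[h11 h12] h2 h3.
have {h2 h3}[h4 h5] : - 8 <= t.2 - g /\ t.2 - g <= 8.
  have E : dotv ez (point3 t - c) = t.2 - g by rewrite dot_ez subvE point3E gE.
  by move: h2 h3; case: he => ->; rewrite ?dotvNl E; lra.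
clear top mS he; rewrite /box/= !in_itv/=.
by split; [split|]; apply/andP; split; lra.
Qed.

Lemma long_two_unstable K : admissible K ->
  (forall x, K x -> `|x 0 0| <= 1 /\ `|x 0 i1| <= 1) -> 600 < fine (vol K) ->
  exists q1 q2, [/\ unstable_points K q1, unstable_points K q2 & q1 != q2].
Proof.
move=> aK hK hv; have bK := admissible_body aK; set c := centroid K.
have c0 : `|c 0 0| <= 1 by apply: centroid_coord => // x /hK[].
have c1 : `|c 0 i1| <= 1 by apply: centroid_coord => // x /hK[].
have hD y : K y -> dotv ez (y - c) = 0 -> enorm (y - c) <= 4.
  move=> /hK[y0 y1]; rewrite dot_ez => y2; have -> : 4 = 2 * 2 :> R by ring.
  by apply: (enorm_sub3 _ _ _ y2) => //; rewrite !subvE (le_trans (ler_normB _ _))//; lra.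
have d4 : (0 : R) < 4 by [].
have [|q1 s1 p1] := unstable_half aK ez_unit d4 hD.
  by apply: long_reach => //; left.
have hD' y : K y -> dotv (- ez) (y - c) = 0 -> enorm (y - c) <= 4.
  by move=> Ky /eqP; rewrite dotvNl oppr_eq0 => /eqP; exact: hD.
have [|q2 s2 p2] := unstable_half aK Nez_unit d4 hD'.
  by apply: long_reach => //; right.
exists q1, q2; split=> //; apply/eqP => q12; move: p1 p2.
by rewrite q12 dotvNl oppr_gt0 => /lt_trans h /h; rewrite ltxx.
Qed.

Lemma ysectionE T1 T2 (A : set (T1 * T2)) y x : ysection A y x = A (x, y).
Proof. by rewrite /ysection /= inE. Qed.

Lemma xsectionE T1 T2 (A : set (T1 * T2)) y x : xsection A x y = A (x, y).
Proof. by rewrite /xsection /= inE. Qed.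

Lemma le_integral_support (f : R1 -> \bar R) (B : set R1) (k : R) :
  measurable_fun setT f -> measurable B -> 0 <= k -> (forall y, 0 <= f y)%E ->
  (forall y, ~ B y -> f y = 0%E) -> (forall y, f y <= k%:E)%E ->
  (\int[mu]_y f y <= k%:E * mu B)%E.
Proof.
move=> mf mB k0 f0 hB hk.
have -> : (\int[mu]_y f y = \int[mu]_(y in B) f y)%E.
  rewrite [RHS]integral_mkcond; apply: eq_integral => y _.
  by rewrite patchE; case: ifPn => //; rewrite notin_setE => /hB ->.
rewrite -integral_cst//; apply: ge0_le_integral => //.
exact: measurable_funTS.
Qed.

Lemma lebesgue_le_slab (A : set R1) (a b k : R) : measurable A -> 0 <= k -> a != 0 ->
  (forall x, A x -> `|a * x - b| <= k * `|a|) -> (mu A <= (2 * k)%:E)%E.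
Proof.
move=> mA k0 a0 hA.
have -> : (2 * k)%:E = mu `[b / a - k, b / a + k].
  rewrite lebesgue_measure_itv/= lte_fin; case: ifPn => h; first by rewrite -EFinB; congr (_%:E); ring.
  by congr (_%:E); move: h; rewrite -leNgt; lra.
apply: le_measure; rewrite ?inE// => x /hA h; rewrite /= in_itv/=.
have : `|x - b / a| <= k.
  rewrite -(ler_pM2r (x := `|a|)) ?normr_gt0// -normrM mulrBl divfK// mulrC.
  exact: h.
by rewrite ler_distlC => /andP[? ?]; lra.
Qed.

(** Slice by height (length [h]), then by the horizontal coordinate with the smaller coefficient
    (length 2). The other one is confined to an interval of length [12 * h], whatever the vertical
    coefficient [a2] may be. *)
Lemma flat_slab_vol (S : set (R1 * R1 * R1)) (a0 a1 a2 b h : R) : measurable S -> 0 < h ->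
  (forall t, S t -> [/\ `|t.1.1| <= 1, `|t.1.2| <= 1 & 0 <= t.2 <= h]) ->
  0 < Num.max `|a0| `|a1| ->
  (forall t, S t -> `|a0 * t.1.1 + a1 * t.1.2 + a2 * t.2 - b| <= 6 * h * Num.max `|a0| `|a1|) ->
  (mu3 S <= (24 * h ^+ 2)%:E)%E.
Proof.
move=> mS h0 hS m0 hb.
have -> : (24 * h ^+ 2)%:E = ((24 * h)%:E * mu `[0%R, h])%E.
  by rewrite lebesgue_measure_itv/= lte_fin h0 -EFinB -EFinM; congr (_%:E); ring.
have m11 : mu `[(-1)%R, 1%R] = 2%:E.
  rewrite lebesgue_measure_itv/= lte_fin ifT; last by lra.
  have -> : 2%:E = (1 - -1)%:E :> \bar R by congr (_%:E); ring.
  by rewrite EFinB.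
rewrite (lebesgue3E' mS); apply: le_integral_support => //.
- exact: measurable_fun_ysection.
- by rewrite mulr_ge0 ?ltW.
- move=> z /= nz; rewrite (_ : ysection S z = set0) ?measure0//.
  apply/seteqP; split=> // p; rewrite ysectionE => /hS[_ _].
  by move=> hz; apply: nz; rewrite in_itv.
move=> z; have mSz : measurable (ysection S z) by exact: measurable_ysection.
have -> : (24 * h)%:E = ((2 * (6 * h))%:E * mu `[(-1)%R, 1%R])%E.
  by rewrite m11 -EFinM; congr (_%:E); ring.
have h12 : 0 <= 2 * (6 * h) by lra.
have [le01|/ltW le01] := leP `|a1| `|a0|.
- rewrite lebesgue2E'//; apply: le_integral_support => //.
  + exact: measurable_fun_ysection.
  + move=> y /= ny; rewrite (_ : ysection _ y = set0) ?measure0//.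
    apply/seteqP; split=> // x; rewrite !ysectionE => /hS[_ hy _].
    by apply: ny; rewrite in_itv/= -ler_norml.
  + move=> y; apply: (@lebesgue_le_slab _ a0 (b - a1 * y - a2 * z)); [exact: measurable_ysection|lra| |].
    by apply/eqP => a00; move: m0; rewrite (max_l le01) a00 normr0 ltxx.
  move=> x; rewrite !ysectionE => /hb /=; rewrite (max_l le01).
  by have -> : a0 * x + a1 * y + a2 * z - b = a0 * x - (b - a1 * y - a2 * z) by ring.
- rewrite lebesgue2E; apply: le_integral_support => //.
  + exact: measurable_fun_xsection.
  + move=> y /= ny; rewrite (_ : xsection _ y = set0) ?measure0//.
    apply/seteqP; split=> // x; rewrite xsectionE ysectionE => /hS[hy _ _].
    by apply: ny; rewrite in_itv/= -ler_norml.
  + move=> y; apply: (@lebesgue_le_slab _ a1 (b - a0 * y - a2 * z)); [exact: measurable_xsection|lra| |].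
    by apply/eqP => a00; move: m0; rewrite (max_r le01) a00 normr0 ltxx.
  move=> x; rewrite xsectionE ysectionE => /hb /=; rewrite (max_r le01).
  by have -> : a0 * y + a1 * x + a2 * z - b = a1 * x - (b - a0 * y - a2 * z) by ring.
Qed.

Lemma flat_disc K (h : R) (p : 'rV[R]_3) : convex_body K -> 0 < h ->
  (forall x, K x -> [/\ `|x 0 0| <= 1, `|x 0 i1| <= 1 & 0 <= x 0 i2 <= h]) ->
  48 * h ^+ 2 < fine (vol K) -> dotv ez (p - centroid K) = 0 ->
  enorm (p - centroid K) <= 2 * h -> K p.
Proof.
set c := centroid K => bK h0 hK hv pc ph; apply: contrapT => Kp.
have [cK cxK [x0 /interior_subset Kx0]] := bK.
have [w w0 sep] : exists2 w, w != 0 & forall y, K y -> dotv w y <= dotv w p - dotv w w.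
  by apply: separation => //; exists x0.
have ww : 0 < dotv w w by rewrite dotvv_gt0.
pose m := Num.max `|w 0 0| `|w 0 i1|.
have m0 : 0 <= m by rewrite le_max normr_ge0.
have wpc : dotv w (p - c) <= m * (4 * h).
  have p2 : (p - c) 0 i2 = 0 by rewrite -dot_ez.
  have hc i : `|(p - c) 0 i| <= 2 * h := le_trans (coord_le_enorm _ i) ph.
  rewrite dotv3 p2 mulr0 addr0.
  have b0 : w 0 0 * (p - c) 0 0 <= m * (2 * h).
    by rewrite (le_trans (ler_norm _))// normrM ler_pM// le_max lexx.
  have b1 : w 0 i1 * (p - c) 0 i1 <= m * (2 * h).
    by rewrite (le_trans (ler_norm _))// normrM ler_pM// le_max lexx orbT.
  by lra.
have top y : K y -> dotv w (y - c) <= m * (4 * h) - dotv w w.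
  by move=> /sep sy; move: wpc; rewrite !dotvBr => wpc'; lra.
(* If [w] is vertical, all of [K] lies below the level of the centroid by the gap [dotv w w], and so
   would the centroid. *)
have [m00|mn0] := eqVneq m 0.
  have := centroid_le bK sep; rewrite -/c; move: wpc; rewrite dotvBr m00 mul0r => h1 h2; lra.
have mp : 0 < m by rewrite lt_neqAle eq_sym mn0.
have d0 : 0 < m * (4 * h) by rewrite !mulr_gt0.
have topd y : K y -> dotv w (y - c) <= m * (4 * h) by move=> /top; lra.
have := centroid_markov bK d0 topd; set S := K `&` _ => hS.
have mS : measurable (pre S).
  by apply: closed_point3_measurable; apply: closedI; [exact: compact_closed_rV|exact: closed_dot_ge].
have le1 : (mu3 (pre S) <= (24 * h ^+ 2)%:E)%E.
  (* On the slab the functional about the centroid runs from [- 8 * h * m] to [4 * h * m]: the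
     midpoint is [- 2 * h * m] and the half width [6 * h * m]. *)
  apply: (@flat_slab_vol _ (w 0 0) (w 0 i1) (w 0 i2) (dotv w c - 2 * h * m)) => //.
    by move=> t [/hK]; rewrite !point3E.
  move=> t [/topd] /=; rewrite -/c -/m !dotvBr [dotv w (point3 t)]dotv3 !point3E ler_norml => ? ?.
  by lra.
have : fine (vol S) <= 24 * h ^+ 2.
  have fS : vol S \is a fin_num by rewrite ge0_fin_numE ?measure_ge0// (le_lt_trans le1)// ltry.
  by rewrite -lee_fin fineK.
by rewrite -/c; lra.
Qed.

(** The radius is halved to gain room: [p] is pushed away from an interior point [z] at the height
    of the centroid and still lands in the disc of radius [2 * h], so [p] lies between an interior
    point and a point of [K]. *)
Lemma flat_interior K (h : R) (p : 'rV[R]_3) : convex_body K -> 0 < h ->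
  (forall x, K x -> [/\ `|x 0 0| <= 1, `|x 0 i1| <= 1 & 0 <= x 0 i2 <= h]) ->
  48 * h ^+ 2 < fine (vol K) -> dotv ez (p - centroid K) = 0 ->
  enorm (p - centroid K) <= h -> interior K p.
Proof.
set c := centroid K => bK h0 hK hv pc ph.
have disc y : dotv ez (y - c) = 0 -> enorm (y - c) <= 2 * h -> K y by exact: flat_disc.
have [cptK cK [x0 ix0]] := bK.
have ez0 : ez != 0 by apply/eqP => E; have := ez_unit; rewrite E dot0v => /eqP; rewrite eq_sym oner_eq0.
have side e : e != 0 -> exists2 y, K y & 0 < dotv e (y - c).
  move=> e0; apply: contrapT => no.
  have hle y : K y -> dotv e y <= dotv e c.
    move=> Ky; rewrite leNgt; apply/negP => lt; apply: no; exists y => //.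
    by rewrite dotvBr subr_gt0.
  by have := centroid_lt bK e0 hle; rewrite ltxx.
(* The centroid has points of [K] strictly on both sides of its horizontal plane, so a segment from
   the interior point [x0] can be made to cross that plane. *)
have [z iz zc] : exists2 z, interior K z & dotv ez (z - c) = 0.
  have cross e y : K y -> dotv e (x0 - c) < 0 -> 0 < dotv e (y - c) ->
      exists2 z, interior K z & dotv e (z - c) = 0.
    move=> Ky l0 y0; pose s := - dotv e (x0 - c) / (dotv e (y - c) - dotv e (x0 - c)).
    have D0 : 0 < dotv e (y - c) - dotv e (x0 - c) by lra.
    exists (x0 + s *: (y - x0)).
      apply: interior_between => //; first by rewrite divr_ge0//; lra.
      by rewrite ltr_pdivrMr// mul1r; lra.
    rewrite addrAC dotvDr dotvZr.
    have -> : dotv e (y - x0) = dotv e (y - c) - dotv e (x0 - c).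
      by rewrite !dotvBr; ring.
    by rewrite /s divfK ?gt_eqF// subrr.
  have [l|g|E] := ltgtP (dotv ez (x0 - c)) 0.
  - by have [y Ky y0] := side ez ez0; exact: (cross _ y).
  - have [|y Ky y0] := side (- ez); first by rewrite oppr_eq0.
    have [|z iz] := cross (- ez) y Ky _ y0; first by rewrite dotvNl oppr_lt0.
    by rewrite dotvNl => /eqP; rewrite oppr_eq0 => /eqP; exists z.
  - by exists x0.
pose t := h / (enorm (p - z) + 1).
have pz0 : 0 < enorm (p - z) + 1 by rewrite ltr_wpDl ?enorm_ge0.
have t0 : 0 < t by rewrite divr_gt0.
have Kp : K (p + t *: (p - z)).
  apply: disc.
    rewrite addrAC dotvDr dotvZr pc add0r.
    have -> : dotv ez (p - z) = dotv ez (p - c) - dotv ez (z - c) by rewrite !dotvBr; ring.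
    by rewrite pc zc subrr mulr0.
  have h7 : 0 <= 2 * h by lra.
  rewrite addrAC -(ler_pXn2r (ltn0Sn 1)) ?nnegrE ?enorm_ge0//.
  rewrite enorm_sqr dotv_add_scale -!enorm_sqr.
  have h1 : t * enorm (p - z) <= h.
    by rewrite /t mulrAC ler_pdivrMr// ler_pM2l// lerDl.
  have h2 : dotv (p - c) (p - z) <= enorm (p - c) * enorm (p - z) := dotv_le_enorm _ _.
  have h3 : 0 <= enorm (p - c) := enorm_ge0 _.
  have h4 : 0 <= t * enorm (p - z) by rewrite mulr_ge0 ?enorm_ge0// ltW.
  have h5 : 2 * t * dotv (p - c) (p - z) <= 2 * enorm (p - c) * (t * enorm (p - z)).
    have -> : 2 * enorm (p - c) * (t * enorm (p - z)) = 2 * t * (enorm (p - c) * enorm (p - z)) by ring.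
    by rewrite ler_pM2l// mulr_gt0.
   apply: (@le_trans _ _ ((enorm (p - c) + t * enorm (p - z)) ^+ 2)).
    have -> : (enorm (p - c) + t * enorm (p - z)) ^+ 2 = enorm (p - c) ^+ 2 +
      2 * enorm (p - c) * (t * enorm (p - z)) + t ^+ 2 * enorm (p - z) ^+ 2 by ring.
    by rewrite lerD2r lerD2l.
  have h6 : 0 <= enorm (p - c) + t * enorm (p - z) by rewrite addr_ge0.
  by rewrite ler_pXn2r ?nnegrE//; lra.
have s1 : (1 + t)^-1 < 1 by rewrite invf_lt1; lra.
have s0 : 0 <= (1 + t)^-1 by rewrite invr_ge0; lra.
have := interior_between cK iz Kp s0 s1.
have -> : p + t *: (p - z) - z = (1 + t) *: (p - z).
  by rewrite scalerDl scale1r addrAC.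
by rewrite scalerA mulVf ?scale1r ?gt_eqF//; [rewrite addrC subrK|lra].
Qed.

Lemma flat_two_stable K (h : R) : admissible K -> 0 < h ->
  (forall x, K x -> [/\ `|x 0 0| <= 1, `|x 0 i1| <= 1 & 0 <= x 0 i2 <= h]) ->
  48 * h ^+ 2 < fine (vol K) ->
  exists q1 q2, [/\ stable_points K q1, stable_points K q2 & q1 != q2].
Proof.
move=> aK h0 hK hv; have bK := admissible_body aK; set c := centroid K.
have ii p : dotv ez (p - c) = 0 -> enorm (p - c) <= h -> interior K p by exact: flat_interior.
have ic : interior K c.
  by apply: ii; rewrite subrr ?dotv0// /enorm dot0v sqrtr0 ltW.
have hD y : bd K y -> dotv ez (y - c) = 0 -> h < enorm (y - c).
  by move=> [_ iy] y0; rewrite ltNge; apply/negP => yh; apply: iy; exact: ii.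
have hD' y : bd K y -> dotv (- ez) (y - c) = 0 -> h < enorm (y - c).
  by move=> Ky /eqP; rewrite dotvNl oppr_eq0 => /eqP; exact: hD.
have [_ _ /andP[c2 c2']] := hK _ (interior_subset ic).
have ht y : K y -> dotv ez (y - c) <= h.
  by move=> /hK[_ _ /andP[? ?]]; rewrite dot_ez subvE; lra.
have ht' y : K y -> dotv (- ez) (y - c) <= h.
  by move=> /hK[_ _ /andP[? ?]]; rewrite dotvNl dot_ez subvE; lra.
have [q1 s1 p1] := stable_half aK ez_unit h0 ic hD ht.
have [q2 s2 p2] := stable_half aK Nez_unit h0 ic hD' ht'.
exists q1, q2; split=> //; apply/eqP => q12; move: p1 p2.
by rewrite q12 dotvNl oppr_gt0 => /lt_trans H /H; rewrite ltxx.
Qed.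

End Two_points.

(** * The regular polygon *)

Section Polygon.
Variables (R : realType) (n : nat).
Hypothesis n3 : (2 < n)%N.

(** Half of the central angle: vertices use even multiples of it, while sums of neighbouring
    vertices produce odd ones. *)
Definition pang : R := pi / n%:R.
Definition ec (k : nat) : R := cos ((2 * k)%:R * pang).
Definition es (k : nat) : R := sin ((2 * k)%:R * pang).
Let n0 : 0 < n%:R :> R. Proof. by rewrite ltr0n; apply: leq_trans n3. Qed.

Lemma pang_gt0 : 0 < pang.
Proof. by rewrite divr_gt0// pi_gt0. Qed.

Lemma npang : n%:R * pang = pi.
Proof. by rewrite /pang mulrCA divff ?mulr1// gt_eqF. Qed.

Lemma ec_es k : ec k ^+ 2 + es k ^+ 2 = 1.
Proof. exact: cos2Dsin2. Qed.

Lemma ecDn k : ec (k + n) = ec k.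
Proof.
rewrite /ec mulnDr natrD mulrDl [(2 * n)%:R]natrM -mulrA npang (mulr_natl pi).
exact: cosD2pi.
Qed.

Lemma esDn k : es (k + n) = es k.
Proof.
rewrite /es mulnDr natrD mulrDl [(2 * n)%:R]natrM -mulrA npang (mulr_natl pi).
exact: sinD2pi.
Qed.

Lemma ec_mod k : ec (k %% n) = ec k.
Proof.
rewrite [in RHS](divn_eq k n) addnC; elim: (k %/ n)%N => [|q IH]; first by rewrite mul0n addn0.
by rewrite mulSn addnCA addnC ecDn.
Qed.

Lemma es_mod k : es (k %% n) = es k.
Proof.
rewrite [in RHS](divn_eq k n) addnC; elim: (k %/ n)%N => [|q IH]; first by rewrite mul0n addn0.
by rewrite mulSn addnCA addnC esDn.
Qed.

Lemma ecD k l : ec (k + l) = ec k * ec l - es k * es l.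
Proof. by rewrite /ec mulnDr natrD mulrDl cosD. Qed.

Lemma esD k l : es (k + l) = es k * ec l + ec k * es l.
Proof. by rewrite /es mulnDr natrD mulrDl sinD. Qed.

Lemma ec0 : ec 0 = 1. Proof. by rewrite /ec muln0 mul0r cos0. Qed.
Lemma es0 : es 0 = 0. Proof. by rewrite /es muln0 mul0r sin0. Qed.
Lemma ecn : ec n = 1. Proof. by rewrite -[n]add0n ecDn ec0. Qed.
Lemma esn : es n = 0. Proof. by rewrite -[n]add0n esDn es0. Qed.

Lemma cos_lt1 (x : R) : 0 < x < pi *+ 2 -> cos x < 1.
Proof.
move=> /andP[x0 x2]; have sx : 0 < sin (x / 2).
  by apply: sin_gt0_pi; rewrite divr_gt0//= ltr_pdivrMr// mulr_natr.
have -> : x = (x / 2) *+ 2 by rewrite -mulr_natr divfK.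
rewrite cos_mulr2n cos2sin2 -mulr_natr; have : 0 < sin (x / 2) ^+ 2 by rewrite exprn_gt0.
by lra.
Qed.

Lemma ec_lt1 k : (0 < k < n)%N -> ec k < 1.
Proof.
move=> /andP[k0 kn]; apply: cos_lt1; apply/andP; split.
  by rewrite mulr_gt0 ?pang_gt0// ltr0n muln_gt0.
have -> : pi *+ 2 = (2 * n)%:R * pang by rewrite natrM -mulrA npang (mulr_natl pi).
by rewrite ltr_pM2r ?pang_gt0// ltr_nat ltn_mul2l.
Qed.

Lemma edot_lt1 (k l : nat) : (k < n)%N -> (l < n)%N -> k != l ->
  ec k * ec l + es k * es l < 1.
Proof.
wlog kl : k l / (k < l)%N => [W|].
  move=> kn ln; rewrite neq_ltn => /orP[kl|lk]; first by apply: W; rewrite // ltn_eqF.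
  by rewrite mulrC [es k * _]mulrC; apply: W; rewrite // ltn_eqF.
move=> kn ln _; have -> : ec k * ec l + es k * es l = ec (l - k).
  rewrite -(subnKC (ltnW kl)) addKn ecD esD; move: (l - k)%N => d.
  transitivity ((ec k ^+ 2 + es k ^+ 2) * ec d); first by ring.
  by rewrite ec_es mul1r.
by apply: ec_lt1; rewrite subn_gt0 kl (leq_ltn_trans (leq_subr _ _)).
Qed.

Lemma e_inj (k l : nat) : (k < n)%N -> (l < n)%N -> ec k = ec l -> es k = es l -> k = l.
Proof.
move=> kn ln h1 h2; apply/eqP; case: eqP => // /eqP kl.
by have := edot_lt1 kn ln kl; rewrite -h1 -h2 -!expr2 ec_es ltxx.
Qed.

(** Shifting the index cyclically shows that the vector of the two sums is fixed by a nontrivial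
    rotation. *)
Lemma rotation_sum0 (c s : R) (f g : nat -> R) : c != 1 -> c ^+ 2 + s ^+ 2 = 1 ->
  (forall k, f k.+1 = c * f k - s * g k) -> (forall k, g k.+1 = s * f k + c * g k) ->
  f n = f 0 -> g n = g 0 -> \sum_(k < n) f k = 0 /\ \sum_(k < n) g k = 0.
Proof.
move=> c1 cs hf hg fn gn.
have shift (h : nat -> R) : h n = h 0%N -> \sum_(k < n) h k.+1 = \sum_(k < n) h k.
  move=> hn; apply: (addrI (h 0%N)); rewrite -[in RHS]hn [h n + _]addrC.
  have <- : \sum_(k < n.+1) h k = \sum_(k < n) h k + h n by rewrite big_ord_recr.
  by rewrite big_ord_recl.
apply: (rotation_fixed c1 cs).
  by rewrite -{1}(shift _ fn) !mulr_sumr -sumrB; apply: eq_bigr => k _; exact: hf.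
by rewrite -{1}(shift _ gn) !mulr_sumr -big_split; apply: eq_bigr => k _; exact: hg.
Qed.

Lemma es1_neq0 : es 1 != 0.
Proof.
apply/eqP => E; have := ec_es 1; rewrite E expr0n addr0 => /eqP.
have l1 : ec 1 < 1 by apply: ec_lt1; lia.
have l2 : ec 2 < 1 by exact: ec_lt1.
rewrite sqrf_eq1 => /orP[/eqP E1|/eqP E1]; first by rewrite E1 ltxx in l1.
by move: l2; rewrite -[2%N]/(1 + 1)%N ecD E E1; lra.
Qed.

Lemma sum_e : \sum_(k < n) ec k = 0 /\ \sum_(k < n) es k = 0.
Proof.
apply: (@rotation_sum0 (ec 1) (es 1)).
- by rewrite lt_eqF// ec_lt1//= (leq_trans _ n3).
- exact: ec_es.
- by move=> k; rewrite -addn1 ecD; ring.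
- by move=> k; rewrite -addn1 esD; ring.
- by rewrite ecn ec0.
- by rewrite esn es0.
Qed.

(** Doubled angles still step by a nontrivial rotation because [2 < n]; this is what makes the
    second moments isotropic. *)
Lemma sum_e2 : \sum_(k < n) ec (2 * k) = 0 /\ \sum_(k < n) es (2 * k) = 0.
Proof.
apply: (@rotation_sum0 (ec 2) (es 2) (fun k => ec (2 * k)) (fun k => es (2 * k))).
- by rewrite lt_eqF// ec_lt1.
- exact: ec_es.
- by move=> k; rewrite mulnS addnC ecD; ring.
- by move=> k; rewrite mulnS addnC esD; ring.
- by rewrite mul2n -addnn ecDn ecn muln0 ec0.
- by rewrite mul2n -addnn esDn esn muln0 es0.
Qed.

Lemma sum_quadratic : [/\ \sum_(k < n) ec k ^+ 2 = n%:R / 2,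
  \sum_(k < n) es k ^+ 2 = n%:R / 2 & \sum_(k < n) ec k * es k = 0].
Proof.
have [s1 s2] := sum_e2.
have c2 k : ec (2 * k) = ec k ^+ 2 - es k ^+ 2 by rewrite mul2n -addnn ecD; ring.
have d2 k : es (2 * k) = 2 * (ec k * es k) by rewrite mul2n -addnn esD; ring.
have sum1 : \sum_(k < n) (1 : R) = n%:R by rewrite sumr_const card_ord.
split.
- have -> : \sum_(k < n) ec k ^+ 2 = (\sum_(k < n) 1 + \sum_(k < n) ec (2 * k)) / 2.
    rewrite -big_split mulr_suml; apply: eq_bigr => k _ /=.
    by rewrite c2; have := ec_es k; lra.
  by rewrite sum1 s1 addr0.
- have -> : \sum_(k < n) es k ^+ 2 = (\sum_(k < n) 1 - \sum_(k < n) ec (2 * k)) / 2.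
    rewrite -sumrB mulr_suml; apply: eq_bigr => k _ /=.
    by rewrite c2; have := ec_es k; lra.
  by rewrite sum1 s1 subr0.
- have -> : \sum_(k < n) ec k * es k = (\sum_(k < n) es (2 * k)) / 2.
    by rewrite mulr_suml; apply: eq_bigr => k _ /=; rewrite d2; field.
  by rewrite s2 mul0r.
Qed.

(* The weights [(1 + 2 <x, e_k>) / n] represent [x], because the [e_k] have sum
   zero and second moment [n / 2] times the identity. *)
Lemma polygon_disc (x y : R) : x ^+ 2 + y ^+ 2 <= 4^-1 ->
  exists l : 'I_n -> R, [/\ forall k, 0 <= l k, \sum_k l k = 1,
    \sum_k l k * ec k = x & \sum_k l k * es k = y].
Proof.
move=> xy; exists (fun k => (1 + 2 * (x * ec k + y * es k)) / n%:R).
have [c1 s1] := sum_e; have [q1 q2 q3] := sum_quadratic.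
have sum1 : \sum_(k < n) (1 : R) = n%:R by rewrite sumr_const card_ord.
split.
- move=> k; rewrite divr_ge0 ?(ltW n0)//.
  have : (x * ec k + y * es k) ^+ 2 <= 4^-1.
    apply: le_trans xy; rewrite -[leRHS]mulr1 -(ec_es k).
    have := sqr_ge0 (x * es k - y * ec k); nra.
  have -> : 4^-1 = (2^-1) ^+ 2 :> R by field.
  rewrite -ler_sqrt ?exprn_gt0// !sqrtr_sqr [`|2^-1|]ger0_norm// ler_norml => /andP[h _].
  lra.
- rewrite -mulr_suml big_split /= sum1 -mulr_sumr big_split /= -!mulr_sumr c1 s1.
  by rewrite !mulr0 addr0 mulr0 addr0 divff// gt_eqF.
- have -> : \sum_(k < n) (1 + 2 * (x * ec k + y * es k)) / n%:R * ec k =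
    (\sum_(k < n) ec k + 2 * (x * \sum_(k < n) ec k ^+ 2 + y * \sum_(k < n) ec k * es k)) / n%:R.
    rewrite !mulr_sumr -big_split mulr_sumr -big_split mulr_suml.
    by apply: eq_bigr => k _ /=; field; rewrite gt_eqF.
  by rewrite c1 q1 q3; field; rewrite gt_eqF.
- have -> : \sum_(k < n) (1 + 2 * (x * ec k + y * es k)) / n%:R * es k =
    (\sum_(k < n) es k + 2 * (y * \sum_(k < n) es k ^+ 2 + x * \sum_(k < n) ec k * es k)) / n%:R.
    rewrite !mulr_sumr -big_split mulr_sumr -big_split mulr_suml.
    by apply: eq_bigr => k _ /=; field; rewrite gt_eqF.
  by rewrite s1 q2 q3; field; rewrite gt_eqF.
Qed.

(** The polygon contains the disc of radius 1/2 by [polygon_disc], so its support value in direction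
    [(x, y)] is at least half the length of that vector. *)
Lemma polygon_width (x y m : R) : (forall k : 'I_n, x * ec k + y * es k <= m) ->
  0 <= m /\ x ^+ 2 + y ^+ 2 <= 4 * m ^+ 2.
Proof.
move=> hm.
have avg (a b : R) : a ^+ 2 + b ^+ 2 <= 4^-1 -> x * a + y * b <= m.
  move=> /polygon_disc[l [l0 l1 <- <-]]; rewrite !mulr_sumr -big_split -[m]mul1r -l1 mulr_suml.
  apply: ler_sum => k _; rewrite -[leLHS]/(x * (l k * ec k) + y * (l k * es k)).
  by rewrite !(mulrCA _ (l k)) -mulrDr ler_wpM2l.
have m0 : 0 <= m by have := avg 0 0; rewrite !mulr0 addr0; apply; rewrite expr0n/=; lra.
split=> //; pose N := Num.sqrt (x ^+ 2 + y ^+ 2).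
have N2 : N ^+ 2 = x ^+ 2 + y ^+ 2 by rewrite sqr_sqrtr// addr_ge0 ?sqr_ge0.
have N0 : 0 <= N by exact: sqrtr_ge0.
suff Nm : N <= 2 * m.
  rewrite -N2; have -> : 4 * m ^+ 2 = (2 * m) ^+ 2 by ring.
  by rewrite ler_pXn2r// nnegrE; lra.
have [->|Nn] := eqVneq N 0; first by lra.
have Np : 0 < N by rewrite lt_neqAle eq_sym Nn.
have := avg (x / (2 * N)) (y / (2 * N)).
have -> : (x / (2 * N)) ^+ 2 + (y / (2 * N)) ^+ 2 = (x ^+ 2 + y ^+ 2) / (4 * N ^+ 2) by field.
have -> : x * (x / (2 * N)) + y * (y / (2 * N)) = (x ^+ 2 + y ^+ 2) / (2 * N) by field.
rewrite -N2 invfM mulrCA divff ?sqrf_eq0// mulr1 => /(_ (lexx _)).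
rewrite expr2 invfM mulrACA divff// mulr1; lra.
Qed.

(** The component [t] along the line is determined up to sign, so a line carries at most two
    vertices. *)
Lemma line_circle (x y m : R) (i j k : nat) : (i < n)%N -> (j < n)%N -> (k < n)%N ->
  (x != 0) || (y != 0) ->
  x * ec i + y * es i = m -> x * ec j + y * es j = m -> x * ec k + y * es k = m ->
  [|| i == j, i == k | j == k].
Proof.
move=> ni nj nk xy hi hj hk; pose t l := x * es l - y * ec l.
have D0 : x ^+ 2 + y ^+ 2 != 0.
  by rewrite paddr_eq0 ?sqr_ge0// !sqrf_eq0 negb_and.
have tsq l : x * ec l + y * es l = m -> t l ^+ 2 = x ^+ 2 + y ^+ 2 - m ^+ 2.
  move=> <-; rewrite -[in RHS](mulr1 (x ^+ 2 + y ^+ 2)) -(ec_es l) /t; ring.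
have eq_t a b : (a < n)%N -> (b < n)%N -> x * ec a + y * es a = m ->
    x * ec b + y * es b = m -> t a = t b -> a = b.
  move=> an bn ha hb tab; apply: e_inj => //; apply: (mulfI D0).
    have E l : (x ^+ 2 + y ^+ 2) * ec l = x * (x * ec l + y * es l) - y * t l by rewrite /t; ring.
    by rewrite !E ha hb tab.
  have E l : (x ^+ 2 + y ^+ 2) * es l = y * (x * ec l + y * es l) + x * t l by rewrite /t; ring.
  by rewrite !E ha hb tab.
have [//|ij] := eqVneq i j; have [//|ik] := eqVneq i k.
have opp b : (b < n)%N -> i != b -> x * ec b + y * es b = m -> t b = - t i.
  move=> bn ib hb; have : t b ^+ 2 = t i ^+ 2 by rewrite (tsq _ hi) (tsq _ hb).
  move=> /eqP; rewrite eqf_sqr => /orP[/eqP tb|/eqP //].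
  by rewrite (eq_t _ _ bn ni hb hi tb) eqxx in ib.
have tj := opp j nj ij hj; have tk := opp k nk ik hk.
by apply/eqP/(eq_t _ _ nj nk hj hk); rewrite tj tk.
Qed.

End Polygon.

(** * Edges of the regular polygon and their midpoints *)

Section Polygon_edges.
Variables (R : realType) (n : nat).
Hypothesis n3 : (2 < n)%N.
Local Notation ec := (ec R n).
Local Notation es := (es R n).
Local Notation pang := (pang R n).

Lemma edot_sub (k d : nat) : ec (k + d) * ec k + es (k + d) * es k = ec d.
Proof.
rewrite ecD esD; transitivity ((ec k ^+ 2 + es k ^+ 2) * ec d); first by ring.
by rewrite ec_es mul1r.
Qed.

(** The vertices carrying weight lie on one line, so there are one or two of them. In the second
    case the equal products of [(x, y)] with both vertices force equal weights: a planar equilibrium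
    is a multiple of a vertex or of the midpoint of two vertices. *)
Lemma polygon_equilibrium (l : 'I_n -> R) (x y m b g : R) :
  (forall k, 0 <= l k) -> \sum_k l k = g -> 0 < g -> 0 < b ->
  x = b * \sum_k l k * ec k -> y = b * \sum_k l k * es k ->
  (x != 0) || (y != 0) ->
  (forall k : 'I_n, x * ec k + y * es k <= m) ->
  (forall k, l k != 0 -> x * ec k + y * es k = m) ->
  (exists k : 'I_n, [/\ l k = g, forall j, j != k -> l j = 0 &
     forall j : 'I_n, j != k -> x * ec j + y * es j < m]) \/
  (exists k j : 'I_n, [/\ k != j, l k = g / 2, l j = g / 2,
     forall i, i != k -> i != j -> l i = 0 &
     forall i : 'I_n, i != k -> i != j -> x * ec i + y * es i < m]).
Proof.
move=> l0 lg g0 b0 xE yE xy hm hl.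
have [k lk] : exists k, l k != 0.
  apply: contrapT => no; move: g0; rewrite -lg big1 ?ltxx// => k _.
  by apply/eqP; apply: contrapT => /negP lk; apply: no; exists k.
have [[j /andP[jk lj]]|no] := pselect (exists j, (j != k) && (l j != 0)).
  right; exists k, j; have kj : k != j by rewrite eq_sym.
  have only i : i != k -> i != j -> x * ec i + y * es i != m.
    move=> ik ij; apply/eqP => him.
    have := line_circle n3 (ltn_ord i) (ltn_ord k) (ltn_ord j) xy him (hl _ lk) (hl _ lj).
    rewrite -!val_eqE /= in ik ij kj.
    by rewrite (negbTE ik) (negbTE ij) (negbTE kj).
  have li i : i != k -> i != j -> l i = 0.
    move=> ik ij; apply/eqP; apply: contrapT => /negP li.
    by have := only i ik ij; rewrite (hl _ li) eqxx.
  have S (f : 'I_n -> R) : \sum_i l i * f i = l k * f k + l j * f j.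
    rewrite (bigD1 k)//= (bigD1 j)//= big1 ?addr0// => i /andP[ik ij].
    by rewrite li// mul0r.
  have S1 : l k + l j = g.
    by rewrite -lg; have := S (fun=> 1); rewrite !mulr1; under eq_bigr do rewrite mulr1.
  have E : (l k - l j) * (1 - (ec k * ec j + es k * es j)) = 0.
    have := hl _ lk; rewrite -(hl _ lj) xE yE !S => /eqP; rewrite -subr_eq0 => /eqP E.
    apply: (mulfI (lt0r_neq0 b0)); rewrite mulr0 -[RHS]E.
    have := ec_es R n k; have := ec_es R n j.
    move: (ec k) (es k) (ec j) (es j) (l k) (l j) => a c d e u v h1 h2.
    transitivity (b * (u * ((a ^+ 2 + c ^+ 2) - (a * d + c * e)) + v * ((a * d + c * e) - (d ^+ 2 + e ^+ 2)))).
      by rewrite h1 h2; ring.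
    by ring.
  have c1 : ec k * ec j + es k * es j < 1 by apply: (edot_lt1 R n3).
  have lkj : l k = l j.
    move/eqP: E; rewrite mulf_eq0 subr_eq0 => /orP[/eqP//|/eqP h]; lra.
  split=> //; [by lra|by lra|].
  by move=> i ik ij; rewrite lt_neqAle only//=; exact: hm.
left; exists k; have li j : j != k -> l j = 0.
  by move=> jk; apply/eqP; apply: contrapT => /negP lj; apply: no; exists j; rewrite jk lj.
have S (f : 'I_n -> R) : \sum_i l i * f i = l k * f k.
  by rewrite (bigD1 k)//= big1 ?addr0// => i ik; rewrite li// mul0r.
have lkg : l k = g.
  by rewrite -lg; have := S (fun=> 1); rewrite mulr1; under eq_bigr do rewrite mulr1.
split=> // j jk; rewrite -(hl k lk) xE yE !S lkg.
have c1 : ec k * ec j + es k * es j < 1 by apply: (edot_lt1 R n3); rewrite // eq_sym.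
have bg : 0 < b * g by rewrite mulr_gt0.
have -> : b * (g * ec k) * ec j + b * (g * es k) * es j = b * g * (ec k * ec j + es k * es j) by ring.
have -> : b * (g * ec k) * ec k + b * (g * es k) * es k = b * g * (ec k ^+ 2 + es k ^+ 2) by ring.
by rewrite ec_es ltr_pM2l.
Qed.

Lemma ec1_gtN1 : 0 < 1 + ec 1.
Proof.
have := es1_neq0 R n3; have := ec_es R n 1; have e1 : -1 <= ec 1 := cos_geN1 _.
move=> E s1.
rewrite lt_neqAle; apply/andP; split; last by lra.
apply: contra s1 => /eqP h; have e : ec 1 = -1 by lra.
by rewrite -(sqrf_eq0 (es 1)); apply/eqP; move: E; rewrite e sqrrN expr1n; lra.
Qed.

Lemma mid_norm (k : nat) :
  (ec k + ec k.+1) ^+ 2 + (es k + es k.+1) ^+ 2 = 2 * (1 + ec 1).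
Proof.
rewrite -addn1 ecD esD; have h1 := ec_es R n k; have h2 := ec_es R n 1.
set a := ec k in h1 *; set b := es k in h1 *; set c := ec 1 in h2 *; set s := es 1 in h2 *.
have -> : (a + (a * c - b * s)) ^+ 2 + (b + (b * c + a * s)) ^+ 2 =
  (a ^+ 2 + b ^+ 2) * (1 + 2 * c + (c ^+ 2 + s ^+ 2)) by ring.
by rewrite h1 h2; ring.
Qed.

Lemma mid_dot (k : nat) : (ec k + ec k.+1) * ec k + (es k + es k.+1) * es k = 1 + ec 1.
Proof.
have h1 := ec_es R n k; have := edot_sub k 1; rewrite addn1 => h2.
have -> : (ec k + ec k.+1) * ec k + (es k + es k.+1) * es k = (ec k ^+ 2 + es k ^+ 2) + (ec k.+1 * ec k + es k.+1 * es k) by ring.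
by rewrite h1 h2.
Qed.

Lemma mid_dotS (k : nat) :
  (ec k + ec k.+1) * ec k.+1 + (es k + es k.+1) * es k.+1 = 1 + ec 1.
Proof.
have h1 := ec_es R n k.+1; have := edot_sub k 1; rewrite addn1 => h2.
have -> : (ec k + ec k.+1) * ec k.+1 + (es k + es k.+1) * es k.+1 = (ec k.+1 ^+ 2 + es k.+1 ^+ 2) + (ec k.+1 * ec k + es k.+1 * es k) by ring.
by rewrite h1 h2.
Qed.

Lemma mid_inj (i j : nat) : (i < n)%N -> (j < n)%N ->
  ec i + ec i.+1 = ec j + ec j.+1 -> es i + es i.+1 = es j + es j.+1 -> i = j.
Proof.
move=> ni nj; rewrite -!(addn1 i, addn1 j) !ecD !esD => h1 h2.
have p := ec1_gtN1; have e1 := ec_es R n 1.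
set c := ec 1 in h1 h2 p e1 *; set s := es 1 in h1 h2 p e1 *.
have nz : (1 + c) ^+ 2 + s ^+ 2 != 0.
  have -> : (1 + c) ^+ 2 + s ^+ 2 = 2 * (1 + c) + (c ^+ 2 + s ^+ 2) - 1 by ring.
  by rewrite e1 addrK; apply: lt0r_neq0; lra.
apply: (@e_inj R n n3 _ _ ni nj); apply: (mulfI nz).
  have -> : ((1 + c) ^+ 2 + s ^+ 2) * ec i = (1 + c) * (ec i + (ec i * c - es i * s)) + s * (es i + (es i * c + ec i * s)) by ring.
  by rewrite h1 h2; ring.
have -> : ((1 + c) ^+ 2 + s ^+ 2) * es i = (1 + c) * (es i + (es i * c + ec i * s)) - s * (ec i + (ec i * c - es i * s)) by ring.
by rewrite h1 h2; ring.
Qed.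

Definition cs (a : nat) : R := cos (a%:R * pang).

Let n0 : 0 < n%:R :> R. Proof. by rewrite ltr0n; apply: leq_trans n3. Qed.
Let pang_gt0 : 0 < pang := pang_gt0 R n3.

Lemma cs_lt a b : (a < b)%N -> (b <= n)%N -> cs b < cs a.
Proof.
have inp c : (c <= n)%N -> c%:R * pang \in `[0, pi].
  move=> cn; rewrite in_itv/= mulr_ge0 ?(ltW pang_gt0)//=.
  by rewrite -(npang R n3) ler_pM2r// ler_nat.
move=> ab bn; have an : (a <= n)%N := leq_trans (ltnW ab) bn.
by rewrite /cs ltr_cos ?inp// ltr_pM2r// ltr_nat.
Qed.

Lemma cs_sub a : (a <= 2 * n)%N -> cs (2 * n - a) = cs a.
Proof.
move=> an; rewrite /cs natrB// mulrBl natrM -mulrA (npang R n3) (mulr_natl pi).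
by rewrite -cosN opprB cosB cos2pi sin2pi mulr1 mulr0 addr0.
Qed.

Lemma cs_le1 a : (0 < a < 2 * n)%N -> cs a <= cs 1.
Proof.
move=> /andP[a0 an].
have small c : (0 < c)%N -> (c <= n)%N -> cs c <= cs 1.
  move=> c0 cn; have [->//|c1] := eqVneq c 1%N.
  by apply/ltW/cs_lt => //; rewrite ltn_neqAle eq_sym c1.
have [le|lt] := leqP a n; first exact: small.
by rewrite -cs_sub; [apply: small; lia|lia].
Qed.

Lemma cs_prod a b : (b <= a)%N -> cs (a + b) + cs (a - b) = 2 * cs a * cs b.
Proof. by move=> ba; rewrite /cs natrD natrB// mulrDl mulrBl cosD cosB; ring. Qed.

Lemma ec_cs k : ec k = cs (2 * k). Proof. by []. Qed.

(** After rotating [k] to 0, sum-to-product formulas turn the left side into [2 * cs a * cs 1] with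
    [a] odd, and the right side into [2 * cs 1 * cs 1]. *)
Lemma adjacent_max (k j : nat) : (k < n)%N -> (j < n)%N ->
  (ec k + ec k.+1) * ec j + (es k + es k.+1) * es j <= 1 + ec 1.
Proof.
move=> kn jn; pose d := ((j + (n - k)) %% n)%N.
have dn : (d < n)%N by rewrite ltn_mod; lia.
have jE : j = (k + d) %[mod n].
  rewrite /d modnDmr addnCA subnKC; last exact: ltnW.
  by rewrite modnDr.
rewrite -(ec_mod R n3 j) -(es_mod R n3 j) jE (ec_mod R n3) (es_mod R n3).
have -> : (ec k + ec k.+1) * ec (k + d) + (es k + es k.+1) * es (k + d) = ec d + (ec d * ec 1 + es d * es 1).
  rewrite -addn1 !ecD !esD; have := ec_es R n k.
  move: (ec k) (es k) (ec d) (es d) (ec 1) (es 1) => a b c e u v h.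
  transitivity ((a ^+ 2 + b ^+ 2) * c + (a ^+ 2 + b ^+ 2) * (c * u + e * v)); first by ring.
  by rewrite h; ring.
case: d dn {jE} => [|d] dn; first by rewrite ec0 es0 !mul1r mul0r addr0.
have -> : ec d.+1 * ec 1 + es d.+1 * es 1 = ec d by rewrite -add1n edot_sub.
have -> : 1 = ec 0 by rewrite ec0.
rewrite !ec_cs; have -> : cs (2 * d.+1) + cs (2 * d) = 2 * cs (2 * d + 1) * cs 1.
  by rewrite -cs_prod; [congr (cs _ + cs _); lia|lia].
have -> : cs (2 * 0) + cs (2 * 1) = 2 * cs 1 * cs 1.
  by rewrite -cs_prod// addrC; congr (cs _ + cs _); lia.
have c1 : 0 < cs 1.
  apply: cos_gt0_pihalf; rewrite mul1r; apply/andP; split.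
    by rewrite (lt_trans _ pang_gt0)// oppr_lt0 divr_gt0// pi_gt0.
  by rewrite /pang ltr_pM2l ?pi_gt0// ltf_pV2 ?posrE// ltr_nat.
rewrite ler_pM2r// ler_pM2l//; apply: cs_le1; lia.
Qed.

(** If the midpoint of a chord, used as a functional, is maximal at its ends, the chord is an edge.
    For [cs d > 0] the vertex after [k] would do better unless [d = 1]; for [cs d < 0] the midpoint
    points to the other arc and the vertex after [j] would, unless the chord is the closing edge. *)
Lemma edge_adjacent (x y a : R) (k j : nat) : (k < j)%N -> (j < n)%N -> 0 < a ->
  x = a * (ec k + ec j) -> y = a * (es k + es j) -> (x != 0) || (y != 0) ->
  (forall i : 'I_n, x * ec i + y * es i <= x * ec k + y * es k) ->
  j = k.+1 \/ (k = 0%N /\ j = n.-1).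
Proof.
move=> kj jn a0 xE yE xy hm.
have hmn (i : nat) : x * ec i + y * es i <= x * ec k + y * es k.
  have ni : (i %% n < n)%N by rewrite ltn_mod; lia.
  by have := hm (Ordinal ni); rewrite /= (ec_mod R n3) (es_mod R n3).
have [d jE] : exists d, j = (k + d)%N by exists (j - k)%N; rewrite subnKC// ltnW.
have d0 : (0 < d)%N by lia.
have dot (i : nat) : x * ec i + y * es i =
    a * ((ec k * ec i + es k * es i) + (ec j * ec i + es j * es i)).
  by rewrite xE yE; ring.
have wk : x * ec k + y * es k = a * (2 * cs d * cs d).
  rewrite dot jE edot_sub -!expr2 ec_es; congr (_ * _).
  by rewrite -cs_prod// subnn addnn -mul2n /cs mul0r cos0 addrC.
(* The chord is not a diameter, since its midpoint is not the centre. *)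
have cd0 : cs d != 0.
  apply/eqP => c0; have ecd : ec d = - 1.
    have := cs_prod (leqnn d); rewrite subnn addnn -mul2n c0 mulr0 /cs mul0r cos0.
    by rewrite ec_cs /cs; lra.
  have : x ^+ 2 + y ^+ 2 = 0.
    have := edot_sub k d; rewrite ecd xE yE jE; have := ec_es R n k; have := ec_es R n (k + d).
    move: (ec k) (es k) (ec (k + d)) (es (k + d)) => p q r s h1 h2 h3.
    transitivity (a ^+ 2 * ((p ^+ 2 + q ^+ 2) + (r ^+ 2 + s ^+ 2) + 2 * (r * p + s * q))); first by ring.
    by rewrite h1 h2 h3; ring.
  move/eqP; rewrite paddr_eq0 ?sqr_ge0// !sqrf_eq0 => /andP[x0 y0].
  by rewrite x0 y0 in xy.
have e1 : (1 < d)%N -> ec k.+1 * ec k + es k.+1 * es k + (ec j * ec k.+1 + es j * es k.+1) = 2 * cs d * cs (d - 2).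
  move=> d1; rewrite -addn1 edot_sub jE.
  have -> : (k + d = (k + 1) + (d - 1))%N by lia.
  rewrite edot_sub !ec_cs -cs_prod; last by lia.
  by rewrite addrC; congr (cs _ + cs _); lia.
have e2 : ec j.+1 * ec k + es j.+1 * es k + (ec j * ec j.+1 + es j * es j.+1) = 2 * cs (d + 2) * cs d.
  have -> : ec j.+1 * ec k + es j.+1 * es k = ec d.+1 by rewrite jE -addnS edot_sub.
  have -> : ec j * ec j.+1 + es j * es j.+1 = ec 1.
    by rewrite mulrC [es j * _]mulrC -addn1 edot_sub.
  rewrite !ec_cs -cs_prod; last by lia.
  by congr (cs _ + cs _); lia.
have [cp|cn] : 0 < cs d \/ cs d < 0 by move: cd0; rewrite neq_lt => /orP[]; [right|left].
  left; rewrite jE; have [d1|d1] := leqP d 1; first by lia.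
  have := hmn k.+1; rewrite wk dot [ec k * _]mulrC [es k * _]mulrC (e1 d1) ler_pM2l// ler_pM2l ?mulr_gt0//.
  by rewrite leNgt cs_lt//; lia.
right; have [dn|dn] := leqP (d + 2) n; last by lia.
have := hmn j.+1; rewrite wk dot [ec k * _]mulrC [es k * _]mulrC e2 ler_pM2l//.
rewrite -!mulrA [cs (d + 2) * _]mulrC ler_pM2l// ler_nM2l//.
by rewrite leNgt cs_lt//; lia.
Qed.

End Polygon_edges.

(** * Equilibria of polytopes *)

Section Polytope.
Variable R : realType.
Implicit Types (K F : set 'rV[R]_3) (c q w : 'rV[R]_3).

Lemma conv_hull_convex n (v : 'I_n -> 'rV[R]_3) : convex_set (conv_hull v).
Proof.
apply/convex_setP => x y t [a [a0 a1 ->]] [b [b0 b1 ->]] t0 t1.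
exists (fun i => t * a i + (1 - t) * b i); split.
- by move=> i; rewrite addr_ge0// mulr_ge0// subr_ge0.
- by rewrite big_split /= -!mulr_sumr a1 b1 !mulr1 addrC subrK.
- rewrite !scaler_sumr -big_split; apply: eq_bigr => i _ /=.
  by rewrite [RHS]scalerDl !scalerA.
Qed.

Lemma conv_hull_compact n (v : 'I_n -> 'rV[R]_3) : compact (conv_hull v).
Proof.
pose S := [set w : 'rV[R]_n | (forall i, 0 <= w 0 i) /\ \sum_i w 0 i = 1].
have cS : compact S.
  apply: bounded_closed_compact.
    exists 1; split; first exact: num_real.
    move=> M M1 w [w0 w1] /=; apply: le_trans (ltW M1).
    rewrite [leLHS]/Num.norm/= mx_normrE; apply/bigmax_leP; split=> // -[i j] _ /=.
    rewrite ord1 ger0_norm// -w1 (bigD1 j)//= lerDl.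
    by apply: sumr_ge0 => k _.
  have -> : S = \bigcap_i [set w : 'rV[R]_n | 0 <= w 0 i] `&` [set w | \sum_i w 0 i = 1].
    apply/seteqP; split=> w /=; first by move=> [w0 w1]; split=> // i _; exact: w0.
    by move=> [w0 w1]; split=> // i; exact: w0.
  apply: closedI.
    apply: closed_bigI => i _.
    have := @closed_comp _ _ (fun w : 'rV[R]_n => w 0 i) [set y | 0 <= y].
    by apply; [move=> x _; exact: coord_continuous|exact: closed_ge].
  have := @closed_comp _ _ (fun w : 'rV[R]_n => \sum_i w 0 i) [set y | y = 1].
  apply; last exact: closed_eq.
  by move=> x _; apply: continuous_sum => i; exact: coord_continuous.
have -> : conv_hull v = (fun w : 'rV[R]_n => \sum_i w 0 i *: v i) @` S.
  apply/seteqP; split=> x.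
    move=> [a [a0 a1 ->]]; exists (\row_i a i).
      by split=> [i|]; [rewrite mxE|under eq_bigr do rewrite mxE].
    by apply: eq_bigr => i _; rewrite mxE.
  by move=> [w [w0 w1] <-]; exists (w 0).
apply: continuous_compact => //; apply: continuous_subspaceT.
apply: continuous_sum => i w; apply: (@cvgZr_tmp _ _ _ (nbhs w)).
exact: coord_continuous.
Qed.

Lemma conv_hull_polytope n (v : 'I_n -> 'rV[R]_3) :
  interior (conv_hull v) !=set0 -> polytope (conv_hull v).
Proof.
move=> ne; split; last by exists n, v.
by split=> //; [exact: conv_hull_compact|exact: conv_hull_convex].
Qed.

Lemma sum_codom n m (s : 'I_m -> 'I_n) (V : zmodType) (f : 'I_n -> V) :
  injective s -> (forall i, i \notin codom s -> f i = 0) ->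
  \sum_i f i = \sum_j f (s j).
Proof.
move=> inj f0; rewrite (bigID (mem (codom s)))/= [X in _ + X]big1// addr0.
rewrite -big_uniq; last by apply/injectiveP.
by rewrite big_map big_enum.
Qed.

Lemma face_conv n (v : 'I_n -> 'rV[R]_3) w q m (s : 'I_m -> 'I_n) : injective s ->
  (forall i, dotv w (v i - q) <= 0) -> (forall j, dotv w (v (s j) - q) = 0) ->
  (forall i, i \notin codom s -> dotv w (v i - q) < 0) ->
  conv_hull v `&` plane q w = conv_hull (v \o s).
Proof.
move=> inj hv h0 hlt; apply/seteqP; split=> x.
  move=> [[l [l0 l1 xE]] px].
  have ls i : i \notin codom s -> l i = 0.
    move=> si; apply/eqP; apply: contrapT => /negP li.
    have : dotv w (v i - q) = 0.
      by apply: (polytope_face_weights hv l0 l1) => //; rewrite -xE px.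
    by move=> E; have := hlt i si; rewrite E ltxx.
  exists (l \o s); split=> //.
  - by move=> j; exact: l0.
  - by rewrite -l1; apply/esym/sum_codom.
  - by rewrite xE; apply: sum_codom => // i /ls ->; rewrite scale0r.
move=> [l [l0 l1 ->]]; split; last first.
  by rewrite /plane /= dotv_average// big1// => j _; rewrite h0 mulr0.
pose l' i := \sum_(j | s j == i) l j.
exists l'; split.
- by move=> i; apply: sumr_ge0 => j _.
- by rewrite -l1 [RHS](partition_big s predT).
- rewrite [LHS](partition_big s predT)//=; apply: eq_bigr => i _.
  by rewrite scaler_suml; apply: eq_bigr => j /eqP <-.
Qed.

(** One face serving both [poly_nondegenerate] and [poly_index]. *)
Definition face_type K c q (d : nat) :=
  exists F, [/\ face K F, relint F q, K `&` plane q (q - c) = F & has_dim F d].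

Lemma equilibrium_le K c q : K c -> equilibrium K c q ->
  q != c /\ forall y, K y -> dotv (q - c) (y - q) <= 0.
Proof.
move=> Kc [_ [qc _ sup]]; rewrite -subr_eq0; split=> //.
have E : dotv (q - c) (c - q) = - dotv (q - c) (q - c) by rewrite -[c - q]opprB dotvNr.
by case: sup => // /(_ _ Kc); rewrite E oppr_ge0 leNgt dotvv_gt0 qc.
Qed.

(** Excluding [smooth_body] removes the other disjunct of [equilibria], and the index is then read
    off from the dimension of the unique face around [q]. *)
Lemma equilibria_face_type K q (d k : nat) : polytope K -> ~ smooth_body K ->
  equilibrium K (centroid K) q -> face_type K (centroid K) q d ->
  equilibria k K q <-> d = (2 - k)%N.
Proof.
move=> pK sK eq [F [fF rF E hd]]; split=> [[_ [[/sK//]|[_ [_ ik]]]]|dk].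
  exact: index_dim fF rF hd ik.
split=> //; right; split=> //; split; first by exists F; split.
by exists F; split=> //; rewrite -dk.
Qed.

Lemma simplex_face_type n (v : 'I_n -> 'rV[R]_3) c q d (s : 'I_d.+1 -> 'I_n)
    (l : 'I_d.+1 -> R) :
  q != c -> injective s ->
  row_free (\matrix_(i < d) (v (s (lift ord0 i)) - v (s ord0))) ->
  (forall j, 0 < l j) -> \sum_j l j = 1 -> q = \sum_j l j *: v (s j) ->
  (forall i, dotv (q - c) (v i - q) <= 0) ->
  (forall i, i \notin codom s -> dotv (q - c) (v i - q) < 0) ->
  face_type (conv_hull v) c q d.
Proof.
move=> qc inj fB l0 l1 qE hv hlt.
have Kq : conv_hull (v \o s) q by rewrite qE; exists l; split=> // j; exact: ltW.
have h0 j : dotv (q - c) (v (s j) - q) = 0.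
  apply: (@polytope_face_weights _ _ (v \o s) (q - c) q l) => //.
  - by move=> i; exact: hv.
  - by move=> i; exact: ltW.
  - by rewrite -qE subrr dotv0.
  - by rewrite gt_eqF.
have FE := face_conv inj hv h0 hlt.
have Kq' : conv_hull v q by have : conv_hull (v \o s) q by []; rewrite -FE => -[].
exists (conv_hull v `&` plane q (q - c)); split=> //.
- exists q, (q - c); split=> //; split; first by rewrite subr_eq0.
    by exists q; split=> //; rewrite /plane /= subrr dotv0.
  right; exact: conv_hull_dot.
- by rewrite FE qE; exact: (@simplex_relint _ _ (v \o s)).
- by rewrite FE; exact: (@simplex_dim _ _ (v \o s)).
Qed.

Lemma weights_face_type n (v : 'I_n -> 'rV[R]_3) c q (l : 'I_n -> R) d
    (s : 'I_d.+1 -> 'I_n) :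
  q != c -> injective s ->
  row_free (\matrix_(i < d) (v (s (lift ord0 i)) - v (s ord0))) ->
  \sum_i l i = 1 -> q = \sum_i l i *: v i -> (forall j, 0 < l (s j)) ->
  (forall i, dotv (q - c) (v i - q) <= 0) ->
  (forall i, i \notin codom s -> l i = 0 /\ dotv (q - c) (v i - q) < 0) ->
  face_type (conv_hull v) c q d.
Proof.
move=> qc sI rf l1 qE ls hv out.
apply: (@simplex_face_type _ v c q d s (fun j => l (s j))) => //.
- by rewrite -l1 (sum_codom sI)// => i /out[].
- by rewrite {1}qE (sum_codom sI)// => i /out[-> _]; rewrite scale0r.
- by move=> i /out[].
Qed.

Lemma vertex_face_type n (v : 'I_n -> 'rV[R]_3) c i0 : v i0 != c ->
  (forall i, i != i0 -> dotv (v i0 - c) (v i - v i0) < 0) ->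
  equilibrium (conv_hull v) c (v i0) /\ face_type (conv_hull v) c (v i0) 0.
Proof.
move=> qc st; have hv i : dotv (v i0 - c) (v i - v i0) <= 0.
  by have [->|/st/ltW//] := eqVneq i i0; rewrite subrr dotv0.
split.
  apply: equilibrium_max => //; first by apply: compact_closed_rV; exact: conv_hull_compact.
    exact: conv_hull_vertex.
  exact: conv_hull_dot.
apply: (@simplex_face_type _ v c (v i0) 0 (fun=> i0) (fun=> 1)) => //.
- by move=> i j _; rewrite !ord1.
- by apply: inj_row_free => u _; apply/rowP => -[].
- by rewrite big_ord1.
- by rewrite big_ord1 scale1r.
- move=> i iC; apply: st; apply: contra iC => /eqP ->.
  by apply/codomP; exists 0.
Qed.

(** Meant for the bases of the frustum, which are not simplices in general: a piece of the support
    plane around [q] inside [K] already gives the relative interior. *)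
Lemma disc_face_type K c q (W : set 'rV[R]_3) : polytope K -> K q -> c != q ->
  (forall y, K y -> dotv (q - c) (y - q) <= 0) -> open W -> W q ->
  (forall y, W y -> dotv (q - c) (y - q) = 0 -> K y) ->
  poly_nondegenerate K c q.
Proof.
move=> pK Kq cq sup oW Wq hW; exists (K `&` plane q (q - c)); split=> //.
  exists q, (q - c); split=> //; split; first by rewrite subr_eq0 eq_sym.
    by exists q; split=> //; rewrite /plane /= subrr dotv0.
  by right.
split; first by split=> //; rewrite /plane /= subrr dotv0.
exists W => // y [Wy [m [u [l [uF l1 yE]]]]].
have py : dotv (q - c) (y - q) = 0.
  by rewrite yE dotv_average// big1// => j _; have [_ /= ->] := uF j; rewrite mulr0.
by split=> //; exact: hW.
Qed.

End Polytope.

(** * Hulls of two vertex families, rotations and small rank computations *)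

Section Tools.
Variable R : realType.
Implicit Types (K F : set 'rV[R]_3) (q w : 'rV[R]_3).

Definition glue n m (v1 : 'I_n -> 'rV[R]_3) (v2 : 'I_m -> 'rV[R]_3) (i : 'I_(n + m)) :=
  match fintype.split i with inl k => v1 k | inr k => v2 k end.

Lemma glueL n m (v1 : 'I_n -> 'rV[R]_3) (v2 : 'I_m -> 'rV[R]_3) k :
  glue v1 v2 (lshift m k) = v1 k.
Proof. by rewrite /glue (unsplitK (inl k)). Qed.

Lemma glueR n m (v1 : 'I_n -> 'rV[R]_3) (v2 : 'I_m -> 'rV[R]_3) k :
  glue v1 v2 (rshift n k) = v2 k.
Proof. by rewrite /glue (unsplitK (inr k)). Qed.

Lemma glue_ind n m (P : 'I_(n + m) -> Prop) :
  (forall k, P (lshift m k)) -> (forall k, P (rshift n k)) -> forall i, P i.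
Proof. by move=> h1 h2 i; rewrite -(fintype.splitK i); case: (fintype.split i). Qed.

Lemma conv_glue n m (v1 : 'I_n -> 'rV[R]_3) (v2 : 'I_m -> 'rV[R]_3)
    (a : 'I_n -> R) (b : 'I_m -> R) :
  (forall k, 0 <= a k) -> (forall k, 0 <= b k) -> \sum_k a k + \sum_k b k = 1 ->
  conv_hull (glue v1 v2) (\sum_k a k *: v1 k + \sum_k b k *: v2 k).
Proof.
move=> a0 b0 ab.
exists (fun i => match fintype.split i with inl k => a k | inr k => b k end); split.
- by move=> i; case: fintype.split.
- rewrite big_split_ord /= -ab; congr (_ + _); apply: eq_bigr => k _.
    by rewrite (unsplitK (inl k)).
  by rewrite (unsplitK (inr k)).
- rewrite big_split_ord /=; congr (_ + _); apply: eq_bigr => k _.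
    by rewrite (unsplitK (inl k)) glueL.
  by rewrite (unsplitK (inr k)) glueR.
Qed.

Lemma sumvE (I : finType) (a : I -> R) (v : I -> 'rV[R]_3) j :
  (\sum_i a i *: v i) 0 j = \sum_i a i * v i 0 j.
Proof. by rewrite summxE; apply: eq_bigr => i _; rewrite mxE. Qed.

Lemma conv_hull_coord n (v : 'I_n -> 'rV[R]_3) j (a b : R) q :
  (forall i, a <= v i 0 j <= b) -> conv_hull v q -> a <= q 0 j <= b.
Proof.
move=> hv [l [l0 l1 ->]]; rewrite sumvE -[a]mul1r -[b]mul1r -l1 !mulr_suml.
by apply/andP; split; apply: ler_sum => i _; rewrite ler_wpM2l//; have /andP[] := hv i.
Qed.

Lemma addvE (x y : 'rV[R]_3) i : (x + y) 0 i = x 0 i + y 0 i.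
Proof. by rewrite mxE. Qed.

Lemma scalevE (a : R) (x : 'rV[R]_3) i : (a *: x) 0 i = a * x 0 i.
Proof. by rewrite mxE. Qed.

Lemma rotz_sum (c s : R) (I : finType) (a : I -> R) (v : I -> 'rV[R]_3) :
  rotz c s (\sum_i a i *: v i) = \sum_i a i *: rotz c s (v i).
Proof.
apply: row3P; rewrite /rotz !vec3E !sumvE.
- rewrite !mulr_sumr -sumrB; apply: eq_bigr => i _; rewrite vec3E; ring.
- rewrite !mulr_sumr -big_split; apply: eq_bigr => i _ /=; rewrite vec3E; ring.
- by apply: eq_bigr => i _; rewrite vec3E.
Qed.

Lemma rotzK (c s : R) : c ^+ 2 + s ^+ 2 = 1 -> cancel (rotz c s) (rotz c (- s)).
Proof.
move=> cs x; apply: row3P; rewrite /rotz !vec3E //.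
- transitivity ((c ^+ 2 + s ^+ 2) * x 0 0); [ring|by rewrite cs mul1r].
- transitivity ((c ^+ 2 + s ^+ 2) * x 0 i1); [ring|by rewrite cs mul1r].
Qed.

Lemma conv_hull_rotz n (v : 'I_n -> 'rV[R]_3) (c s : R) : c ^+ 2 + s ^+ 2 = 1 ->
  (forall i, conv_hull v (rotz c s (v i))) ->
  (forall i, conv_hull v (rotz c (- s) (v i))) ->
  rotz c s @^-1` conv_hull v = conv_hull v.
Proof.
move=> cs h1 h2.
have stab t : (forall i, conv_hull v (rotz c t (v i))) -> forall x, conv_hull v x ->
    conv_hull v (rotz c t x).
  move=> ht x [l [l0 l1 ->]]; rewrite rotz_sum.
  have /choice[b hb] : forall i, exists b : 'I_n -> R,
      [/\ forall i, 0 <= b i, \sum_i b i = 1 & rotz c t (v i) = \sum_i b i *: v i].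
    by move=> i; exact: ht.
  exists (fun j => \sum_i l i * b i j); split.
  - by move=> j; apply: sumr_ge0 => i _; have [b0 _ _] := hb i; rewrite mulr_ge0.
  - rewrite exchange_big /= -l1; apply: eq_bigr => i _.
    by rewrite -mulr_sumr; have [_ -> _] := hb i; rewrite mulr1.
  - under [RHS]eq_bigr do rewrite scaler_suml.
    rewrite exchange_big /=; apply: eq_bigr => i _.
    have [_ _ ->] := hb i; rewrite scaler_sumr.
    by apply: eq_bigr => j _; rewrite scalerA.
apply/seteqP; split=> x /= Kx; last exact: stab.
by rewrite -(rotzK cs x); exact: stab.
Qed.

Lemma rank_col_mx2 w1 w2 :
  (forall a b : R, a *: w1 + b *: w2 = 0 -> a = 0 /\ b = 0) ->
  (\rank (col_mx w1 w2) = 2)%N.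
Proof.
move=> h; apply/eqP; rewrite -[(_ == _)]/(row_free _); apply: inj_row_free => v.
rewrite -[v]hsubmxK mul_row_col [lsubmx v]mx11_scalar [rsubmx v]mx11_scalar.
rewrite !mul_scalar_mx => /h[-> ->].
by rewrite -row_mx0; congr row_mx; apply/rowP => i; rewrite !mxE mul0rn.
Qed.

Lemma row_free1 w : w != 0 -> row_free (\matrix_(i < 1) w).
Proof.
move=> w0; apply: inj_row_free => v; rewrite mulmx_sum_row big_ord1 rowK => /eqP.
rewrite scaler_eq0 (negbTE w0) orbF => /eqP v0.
by apply/rowP => i; rewrite ord1 v0 mxE.
Qed.

Lemma row_free2 (u : 'I_2 -> 'rV[R]_3) :
  (forall a b : R, a *: u 0 + b *: u 1 = 0 -> a = 0 /\ b = 0) ->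
  row_free (\matrix_(i < 2) u i).
Proof.
move=> h; apply: inj_row_free => v; rewrite mulmx_sum_row !big_ord_recl big_ord0 addr0 !rowK.
have -> : lift ord0 ord0 = 1 :> 'I_2 by exact: val_inj.
move=> /h[h0 h1]; apply/rowP => -[[|[|//]] i]; rewrite mxE.
- by rewrite -[RHS]h0; congr (v _ _); exact: val_inj.
- by rewrite -[RHS]h1; congr (v _ _); exact: val_inj.
Qed.

Lemma equilibria_index K q k k' : ~ smooth_body K -> equilibria k K q ->
  equilibria k' K q -> (2 - k = 2 - k')%N.
Proof.
move=> nK [_ [[/nK//]|[_ [_ [F [fF rF hd]]]]]] [_ [[/nK//]|[_ [_ h]]]].
exact: index_dim fF rF hd h.
Qed.

Lemma open_brick (a lo hi : R) :
  open [set x : 'rV[R]_3 | [/\ `|x 0 0| < a, `|x 0 i1| < a, lo < x 0 i2 & x 0 i2 < hi]].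
Proof.
pose d i : 'rV[R]_3 := delta_mx 0 i.
have dE i (x : 'rV[R]_3) : dotv (d i) (x - 0) = x 0 i by rewrite coord_dot subr0.
have -> : [set x : 'rV[R]_3 | [/\ `|x 0 0| < a, `|x 0 i1| < a, lo < x 0 i2 & x 0 i2 < hi]] =
  ([set x | dotv (d 0) (x - 0) < a] `&` [set x | - a < dotv (d 0) (x - 0)]) `&`
  ([set x | dotv (d i1) (x - 0) < a] `&` [set x | - a < dotv (d i1) (x - 0)]) `&`
  ([set x | dotv (d i2) (x - 0) < hi] `&` [set x | lo < dotv (d i2) (x - 0)]).
  apply/seteqP; split=> x /=; rewrite !dE !ltr_norml.
    by move=> [/andP[? ?] /andP[? ?] ? ?].
  by move=> [[[-> ->] [-> ->]] [-> ->]].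
by do 2! (apply: openI; last by apply: openI; [exact: open_dot_lt|exact: open_dot_gt]);
  apply: openI; [exact: open_dot_lt|exact: open_dot_gt].
Qed.

Lemma polygon_rotz n (r z : R) k :
  rotz (ec R n 1) (es R n 1) (vec3 (r * ec R n k) (r * es R n k) z) =
  vec3 (r * ec R n k.+1) (r * es R n k.+1) z.
Proof.
have -> : k.+1 = (k + 1)%N by rewrite addn1.
rewrite ecD esD; move: (ec R n k) (es R n k) (ec R n 1) (es R n 1) => a b c d.
by apply: row3P; rewrite /rotz !vec3E //; ring.
Qed.

Lemma polygon_rotzV n (r z : R) k : (2 < n)%N ->
  rotz (ec R n 1) (- es R n 1) (vec3 (r * ec R n k) (r * es R n k) z) =
  vec3 (r * ec R n (k + n.-1)) (r * es R n (k + n.-1)) z.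
Proof.
move=> n3; rewrite -[in LHS](ecDn R n3 k) -[in LHS](esDn R n3 k).
have -> : (k + n = (k + n.-1).+1)%N by lia.
by rewrite -polygon_rotz rotzK// ec_es.
Qed.

End Tools.

Lemma ord2P (x : 'I_2) : x = 0 \/ x = 1.
Proof. by case: x => -[|[|//]] x; [left|right]; exact: val_inj. Qed.

(** * The flat frustum *)

Section Frustum.
Variables (R : realType) (n : nat) (h : R).
Hypotheses (n3 : (2 < n)%N) (h0 : 0 < h) (h4 : h < 4^-1).
Local Notation ec := (ec R n).
Local Notation es := (es R n).
Implicit Types (q w : 'rV[R]_3).

Definition rim (k : 'I_n) : 'rV[R]_3 := vec3 (ec k) (es k) 0.
Definition frus_top (k : 'I_n) : 'rV[R]_3 := vec3 (2^-1 * ec k) (2^-1 * es k) h.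
Definition frustum := conv_hull (glue rim frus_top).
Local Notation K := frustum.

(** The base contains the disc of radius 1/2 and the half-sized top that of radius 1/4, so a whole
    cylinder of radius 1/4 fits inside. *)
Lemma frus_disc (x y z : R) : x ^+ 2 + y ^+ 2 <= 16^-1 -> 0 <= z <= h -> K (vec3 x y z).
Proof.
move=> xy /andP[z0 zh]; pose t := z / h.
have t0 : 0 <= t by rewrite divr_ge0// ltW.
have t1 : t <= 1 by rewrite ler_pdivrMr// mul1r.
have [|a [a0 a1 ax ay]] := @polygon_disc R n n3 x y; first by lra.
have [|b [b0 b1 bx bY]] := @polygon_disc R n n3 (2 * x) (2 * y).
  by have -> : (2 * x) ^+ 2 + (2 * y) ^+ 2 = 4 * (x ^+ 2 + y ^+ 2) by [ring|lra]; lra.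
have -> : vec3 x y z = \sum_k ((1 - t) * a k) *: rim k + \sum_k (t * b k) *: frus_top k.
  have S (c : R) (f g : 'I_n -> R) : \sum_k c * f k * g k = c * \sum_k f k * g k.
    by rewrite mulr_sumr; apply: eq_bigr => k _; rewrite mulrA.
  apply: row3P; rewrite addvE !sumvE !vec3E.
  - under eq_bigr do rewrite vec3E.
    under [X in _ = _ + X]eq_bigr do rewrite vec3E.
    rewrite S ax (eq_bigr (fun k => t * 2^-1 * b k * ec k)) => [|k _]; last by ring.
    by rewrite S bx; field.
  - under eq_bigr do rewrite vec3E.
    under [X in _ = _ + X]eq_bigr do rewrite vec3E.
    rewrite S ay (eq_bigr (fun k => t * 2^-1 * b k * es k)) => [|k _]; last by ring.
    by rewrite S bY; field.
  - under eq_bigr do rewrite vec3E mulr0.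
    under [X in _ = _ + X]eq_bigr do rewrite vec3E.
    by rewrite big1// add0r -mulr_suml -mulr_sumr b1 /t mulr1 divfK ?gt_eqF.
apply: (@conv_glue _ _ _ rim frus_top (fun k => (1 - t) * a k) (fun k => t * b k)).
- by move=> k; rewrite mulr_ge0// subr_ge0.
- by move=> k; rewrite mulr_ge0.
- by rewrite -!mulr_sumr a1 b1 !mulr1 subrK.
Qed.

Lemma frus_brick q : `|q 0 0| < 8^-1 -> `|q 0 i1| < 8^-1 -> 0 <= q 0 i2 <= h -> K q.
Proof.
move=> q0 q1 q2; rewrite -(vec3K q); apply: frus_disc => //.
have sq (x : R) : `|x| < 8^-1 -> x ^+ 2 <= 64^-1.
  move=> hx; have -> : 64^-1 = (8^-1) ^+ 2 :> R by field.
  by rewrite -(real_normK (num_real x)) ler_pXn2r ?nnegrE//; lra.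
by have s0 := sq _ q0; have s1 := sq _ q1; lra.
Qed.

Lemma e_norm_le1 k : (-1 <= ec k <= 1) && (-1 <= es k <= 1).
Proof. by rewrite cos_geN1 cos_le1 sin_geN1 sin_le1. Qed.

Lemma frus_bounds q : K q -> [/\ `|q 0 0| <= 1, `|q 0 i1| <= 1 & 0 <= q 0 i2 <= h].
Proof.
have hh := h0 => Kq; split; rewrite ?ler_norml; apply: (conv_hull_coord _ Kq); apply: glue_ind => k;
  rewrite ?glueL ?glueR !vec3E; have /andP[/andP[? ?] /andP[? ?]] := e_norm_le1 k; lra.
Qed.

Lemma frus_polytope : polytope K.
Proof.
apply: conv_hull_polytope; exists (vec3 0 0 (h / 2)).
have := @open_brick R 8^-1 0 h; set W := [set x | _] => oW.
have : nbhs (vec3 0 0 (h / 2)) W.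
  apply: open_nbhs_nbhs; split=> //; rewrite /W /= !vec3E normr0.
  have hh := h0; split; lra.
apply: filterS => x [x0 x1 x2 x2']; apply: frus_brick => //.
by rewrite !ltW.
Qed.

Lemma frus_body : convex_body K.
Proof. by case: frus_polytope. Qed.

Local Notation c := (centroid frustum).

Lemma frus_vertex_nat (k : nat) : K (vec3 (1 * ec k) (1 * es k) 0) /\
  K (vec3 (2^-1 * ec k) (2^-1 * es k) h).
Proof.
have kn : (k %% n < n)%N by rewrite ltn_mod; lia.
rewrite -(ec_mod R n3 k) -(es_mod R n3 k) !mul1r; split.
  by have := conv_hull_vertex (glue rim frus_top) (lshift n (Ordinal kn)); rewrite glueL.
by have := conv_hull_vertex (glue rim frus_top) (rshift n (Ordinal kn)); rewrite glueR.
Qed.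

Lemma frus_centroid : [/\ c 0 0 = 0, c 0 i1 = 0 & 0 < c 0 i2 < h].
Proof.
have s1 := es1_neq0 R n3; have hh := h0.
have [||c0 c1] := centroid_rotz s1 (ec_es R n 1) frus_body
  (conv_hull_rotz (ec_es R n 1) _ _).
- apply: glue_ind => k; rewrite ?glueL ?glueR /rim /frus_top.
    by rewrite -[ec k]mul1r -[es k]mul1r polygon_rotz; exact: (frus_vertex_nat _).1.
  by rewrite polygon_rotz; exact: (frus_vertex_nat _).2.
- apply: glue_ind => k; rewrite ?glueL ?glueR /rim /frus_top.
    by rewrite -[ec k]mul1r -[es k]mul1r polygon_rotzV//; exact: (frus_vertex_nat _).1.
  by rewrite polygon_rotzV//; exact: (frus_vertex_nat _).2.
have ez0 : (ez R) != 0.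
  by apply/eqP => E; have := ez_unit R; rewrite E dot0v => /eqP; rewrite eq_sym oner_eq0.
split=> //; apply/andP; split.
  have := @centroid_lt _ K (- ez R) 0 frus_body; rewrite oppr_eq0 dotvNl dot_ez oppr_lt0.
  by apply=> // x /frus_bounds[_ _ /andP[? _]]; rewrite dotvNl dot_ez oppr_le0.
have := @centroid_lt _ K (ez R) h frus_body ez0; rewrite dot_ez.
by apply=> x /frus_bounds[_ _ /andP[_ ?]]; rewrite dot_ez.
Qed.

Local Notation g := (centroid frustum 0 i2).
Local Notation v := (glue rim frus_top).

Lemma frus_c_in : K c.
Proof.
have [c0 c1 /andP[c2 c2']] := frus_centroid.
by apply: frus_brick; rewrite ?c0 ?c1 ?normr0//; lra.
Qed.

Lemma rim_dot q k : dotv (q - c) (rim k - q) =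
  q 0 0 * ec k + q 0 i1 * es k - (q 0 0 ^+ 2 + q 0 i1 ^+ 2) - (q 0 i2 - g) * q 0 i2.
Proof.
have [c0 c1 _] := frus_centroid.
by rewrite dotv3 !subvE c0 c1 /rim !vec3E; ring.
Qed.

Lemma frus_top_dot q k : dotv (q - c) (frus_top k - q) =
  2^-1 * (q 0 0 * ec k + q 0 i1 * es k) - (q 0 0 ^+ 2 + q 0 i1 ^+ 2) + (q 0 i2 - g) * (h - q 0 i2).
Proof.
have [c0 c1 _] := frus_centroid.
by rewrite dotv3 !subvE c0 c1 /frus_top !vec3E; ring.
Qed.

Lemma frus_axis q : K q -> q != c -> (forall i, dotv (q - c) (v i - q) <= 0) ->
  q 0 0 = 0 -> q 0 i1 = 0 -> q = vec3 0 0 0 \/ q = vec3 0 0 h.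
Proof.
move=> Kq qc hv q0 q1; have [c0 c1 /andP[g0 gh]] := frus_centroid.
have [_ _ /andP[z0 zh]] := frus_bounds Kq.
have k0 : 'I_n by exists 0%N; lia.
have hb := hv (lshift n k0); rewrite glueL rim_dot q0 q1 in hb.
have ht := hv (rshift n k0); rewrite glueR frus_top_dot q0 q1 in ht.
have gz : q 0 i2 != g.
  by apply: contra qc => /eqP E; apply/eqP; apply: row3P; rewrite ?q0 ?q1 ?c0 ?c1.
have [lt|gt|E] := ltgtP (q 0 i2) g; last by rewrite E eqxx in gz.
  left; apply: row3P; rewrite !vec3E//.
  have : (g - q 0 i2) * q 0 i2 <= 0 by lra.
  by rewrite pmulr_rle0 ?subr_gt0// => h1; lra.
right; apply: row3P; rewrite !vec3E//.
have : (q 0 i2 - g) * (h - q 0 i2) <= 0 by lra.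
by rewrite pmulr_rle0 ?subr_gt0// => h1; lra.
Qed.

(** Let [B] be the weight on the top vertices and [M] the largest product of the horizontal part
    with a rim direction. If [B > 0], then [N <= (1 - B / 2) * M], and support at the rim gives
    [M <= 2 * h * (q 0 i2 - g) <= 2 * h ^+ 2]. Support at the top gives [M <= 2 * N], and
    [N <= 4 * M ^+ 2] by [polygon_width], so [M >= 8^-1]. This contradicts [h < 4^-1], the origin of
    that bound. *)
Lemma frus_off_axis q : K q -> (forall i, dotv (q - c) (v i - q) <= 0) ->
  (q 0 0 != 0) || (q 0 i1 != 0) ->
  q 0 i2 = 0 /\ exists a : 'I_n -> R, [/\ forall k, 0 <= a k, \sum_k a k = 1,
    q = \sum_k a k *: rim k &
    forall k, a k != 0 -> q 0 0 * ec k + q 0 i1 * es k = q 0 0 ^+ 2 + q 0 i1 ^+ 2].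
Proof.
move=> Kq hv q01; have [c0 c1 /andP[g0 gh]] := frus_centroid.
have [_ _ /andP[z0 zh]] := frus_bounds Kq.
have [l [l0 l1 qE]] := Kq.
have attain : forall i, l i != 0 -> dotv (q - c) (v i - q) = 0.
  by apply: (polytope_face_weights hv l0 l1); rewrite -qE subrr dotv0.
pose a k := l (lshift n k); pose b k := l (rshift n k).
have ab : \sum_k a k + \sum_k b k = 1 by rewrite -l1 big_split_ord.
have qE' : q = \sum_k a k *: rim k + \sum_k b k *: frus_top k.
  rewrite qE big_split_ord; congr (_ + _); apply: eq_bigr => k _; rewrite ?glueL ?glueR//.
set N := q 0 0 ^+ 2 + q 0 i1 ^+ 2.
have N0 : 0 < N.
  by rewrite lt_neqAle eq_sym addr_ge0 ?sqr_ge0// andbT paddr_eq0 ?sqr_ge0// !sqrf_eq0 negb_and.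
pose d (k : nat) := q 0 0 * ec k + q 0 i1 * es k.
have Q0 : q 0 0 = \sum_k a k * ec k + 2^-1 * \sum_k b k * ec k.
  rewrite {1}qE' addvE !sumvE mulr_sumr; congr (_ + _); apply: eq_bigr => k _; rewrite vec3E //; ring.
have Q1 : q 0 i1 = \sum_k a k * es k + 2^-1 * \sum_k b k * es k.
  rewrite {1}qE' addvE !sumvE mulr_sumr; congr (_ + _); apply: eq_bigr => k _; rewrite vec3E //; ring.
have Q2 : q 0 i2 = h * \sum_k b k.
  rewrite {1}qE' addvE !sumvE big1 ?add0r; last by move=> k _; rewrite vec3E mulr0.
  by rewrite mulr_sumr; apply: eq_bigr => k _; rewrite vec3E mulrC.
have NE : N = \sum_k a k * d k + 2^-1 * \sum_k b k * d k.
  have S (f : 'I_n -> R) : \sum_k f k * d k = q 0 0 * \sum_k f k * ec k + q 0 i1 * \sum_k f k * es k.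
    by rewrite !mulr_sumr -big_split; apply: eq_bigr => k _ /=; rewrite /d; ring.
  by rewrite !S /N !expr2 {2}Q0 {2}Q1; ring.
have hb (k : 'I_n) : d k <= N + (q 0 i2 - g) * q 0 i2.
  by have := hv (lshift n k); rewrite glueL rim_dot -/N -/(d k) => H; lra.
have ht (k : 'I_n) : 2^-1 * d k <= N - (q 0 i2 - g) * (h - q 0 i2).
  by have := hv (rshift n k); rewrite glueR frus_top_dot -/N -/(d k) => H; lra.
have k0 : 'I_n by exists 0%N; lia.
have [kM dM] : exists kM : 'I_n, forall k : 'I_n, d k <= d kM.
  by exists [arg max_(k > k0) d k]%O; case: Order.TotalTheory.arg_maxP => // i _ H k; exact: H.
have b0 k : 0 <= b k by exact: l0.
have a0 k : 0 <= a k by exact: l0.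
have B0 : 0 <= \sum_k b k by apply: sumr_ge0.
have Bz : \sum_k b k = 0.
  apply/eqP; rewrite eq_le B0 andbT leNgt; apply/negP => Bp.
  have [M0 NM] := polygon_width n3 dM; rewrite -/N -/(d kM) in M0 NM.
  set M := d kM in dM M0 NM; set B := \sum_k b k in ab Q2 B0 Bp.
  have NM2 : N <= (1 - B / 2) * M.
    have s1 : \sum_k a k * d k <= (1 - B) * M.
      have -> : 1 - B = \sum_k a k by rewrite -ab addrK.
      by rewrite mulr_suml; apply: ler_sum => k _; rewrite ler_wpM2l.
    have s2 : \sum_k b k * d k <= B * M.
      by rewrite mulr_suml; apply: ler_sum => k _; rewrite ler_wpM2l.
    by rewrite NE; lra.
  have hbM := hb kM; have htM := ht kM; rewrite -/M in hbM htM.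
  have hh := h0; have hh4 := h4.
  have M1 : M <= 2 * h * (q 0 i2 - g).
    have : B * M <= B * (2 * h * (q 0 i2 - g)).
      have : M <= (1 - B / 2) * M + (q 0 i2 - g) * (h * B) by rewrite -Q2; lra.
      lra.
    by rewrite ler_pM2l.
  have zg : 0 <= q 0 i2 - g.
    by have : 0 <= 2 * h * (q 0 i2 - g); [exact: le_trans M1|rewrite pmulr_rge0// mulr_gt0].
  have Mp : 0 < M.
    rewrite lt_neqAle M0 andbT eq_sym; apply/eqP => MZ; move: NM2; rewrite MZ mulr0; lra.
  have zz : 0 <= (q 0 i2 - g) * (h - q 0 i2) by rewrite mulr_ge0// subr_ge0.
  have M8 : 8^-1 <= M.
    have : M * 1 <= M * (8 * M) by lra.
    by rewrite ler_pM2l//; lra.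
  have : 2 * h * (q 0 i2 - g) <= 2 * h * h by rewrite ler_pM2l ?mulr_gt0//; lra.
  have : h * h < 4^-1 * 4^-1 by rewrite ltr_pM// ltW.
  lra.
have bz k : b k = 0.
  apply/eqP; rewrite eq_le b0 andbT -Bz (bigD1 k)//= lerDl.
  by apply: sumr_ge0.
have z00 : q 0 i2 = 0 by rewrite Q2 Bz mulr0.
split=> //; exists a; split=> //.
- by rewrite -ab Bz addr0.
- by rewrite {1}qE' [X in _ + X]big1 ?addr0// => k _; rewrite bz scale0r.
- move=> k ak; have := attain _ ak; rewrite glueL rim_dot z00 -/N mulr0 subr0.
  by move/eqP; rewrite subr_eq0 => /eqP.
Qed.

Lemma frus_strict q i : q 0 i2 = 0 -> (q 0 0 != 0) || (q 0 i1 != 0) ->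
  (forall k : 'I_n, q 0 0 * ec k + q 0 i1 * es k <= q 0 0 ^+ 2 + q 0 i1 ^+ 2) ->
  dotv (q - c) (v i - q) <= 0 /\
  ((forall k, i = lshift n k -> q 0 0 * ec k + q 0 i1 * es k < q 0 0 ^+ 2 + q 0 i1 ^+ 2) ->
   dotv (q - c) (v i - q) < 0).
Proof.
move=> z0 q01 hm; have [_ _ /andP[g0 gh]] := frus_centroid.
set N := _ + _ in hm *.
have N0 : 0 < N.
  by rewrite lt_neqAle eq_sym addr_ge0 ?sqr_ge0// andbT paddr_eq0 ?sqr_ge0// !sqrf_eq0 negb_and.
move: i; apply: glue_ind => k.
  rewrite glueL rim_dot z0 mulr0 subr0 -/N subr_le0 subr_lt0; split=> //.
  by apply.
have gh0 : 0 < g * h by rewrite mulr_gt0.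
by rewrite glueR frus_top_dot z0 -/N; have := hm k; split=> [|_]; lra.
Qed.

Lemma frus_vertex_type (k : 'I_n) : equilibrium K c (rim k) /\
  face_type K c (rim k) 0.
Proof.
have [c0 c1 /andP[g0 gh]] := frus_centroid.
have z0 : rim k 0 i2 = 0 by rewrite vec3E.
have q01 : (rim k 0 0 != 0) || (rim k 0 i1 != 0).
  rewrite !vec3E -negb_and; apply/negP => /andP[/eqP e1 /eqP e2].
  by have := ec_es R n k; rewrite e1 e2 expr0n addr0 => /eqP; rewrite eq_sym oner_eq0.
have NE : rim k 0 0 ^+ 2 + rim k 0 i1 ^+ 2 = 1 by rewrite !vec3E ec_es.
have strict (j : 'I_n) : j != k -> rim k 0 0 * ec j + rim k 0 i1 * es j < 1.
  by move=> jk; rewrite !vec3E; apply: (edot_lt1 R n3); rewrite // eq_sym.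
have hm (j : 'I_n) : rim k 0 0 * ec j + rim k 0 i1 * es j <= rim k 0 0 ^+ 2 + rim k 0 i1 ^+ 2.
  have [->|/strict jk] := eqVneq j k; last by rewrite NE ltW.
  by rewrite !vec3E -!expr2.
have := @vertex_face_type _ _ v c (lshift n k); rewrite glueL; apply.
- by apply/eqP => E; move: g0; rewrite -E z0 ltxx.
- move=> i ik; have [_] := frus_strict i z0 q01 hm; apply=> j ij; rewrite NE; apply: strict.
  by apply: contra ik; rewrite ij => /eqP ->.
Qed.

Lemma frus_classify q : equilibrium K c q ->
  (q = vec3 0 0 0 \/ q = vec3 0 0 h) \/
  ((exists k, q = rim k) \/ face_type K c q 1).
Proof.
move=> eq; have [qc sup] := equilibrium_le frus_c_in eq.
have Kq : K q.
  have [[+ _] _] := eq; rewrite -((closure_id K).1 _)//.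
  by apply: compact_closed_rV; exact: conv_hull_compact.
have hv i : dotv (q - c) (v i - q) <= 0 by apply: sup; exact: conv_hull_vertex.
have [q01|] := boolP ((q 0 0 != 0) || (q 0 i1 != 0)); last first.
  by rewrite negb_or !negbK => /andP[/eqP q0 /eqP q1]; left; exact: frus_axis.
right; have [z0 [a [a0 a1 qE ha]]] := frus_off_axis Kq hv q01.
have hm (k : 'I_n) : q 0 0 * ec k + q 0 i1 * es k <= q 0 0 ^+ 2 + q 0 i1 ^+ 2.
  by have := hv (lshift n k); rewrite glueL rim_dot z0 mulr0 subr0 subr_le0.
have S i := frus_strict i z0 q01 hm.
have Q0 : q 0 0 = 1 * \sum_k a k * ec k.
  by rewrite mul1r {1}qE sumvE; apply: eq_bigr => k _; rewrite vec3E.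
have Q1 : q 0 i1 = 1 * \sum_k a k * es k.
  by rewrite mul1r {1}qE sumvE; apply: eq_bigr => k _; rewrite vec3E.
have [[k [ak az _]]|[k [j [kj ak aj az st]]]] :=
  polygon_equilibrium n3 a0 a1 ltr01 ltr01 Q0 Q1 q01 hm ha.
  left; exists k; rewrite qE (bigD1 k)//= ak scale1r big1 ?addr0// => j jk.
  by rewrite az// scale0r.
right.
(* Adjacency of [k] and [j] need not be checked: the strict inequalities at all other vertices
   already make their segment a face. *)
pose s (i : 'I_2) := if i == 0 then lshift n k else lshift n j.
have skj : lshift n k != lshift n j by rewrite eq_lshift.
apply: (@simplex_face_type _ _ v c q 1 s (fun=> 1 / 2)) => //.
- move=> x y; rewrite /s; case: (ord2P x) => ->; case: (ord2P y) => -> //= E.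
  + by move: skj; rewrite E eqxx.
  + by move: skj; rewrite E eqxx.
- have -> : \matrix_(i < 1) (v (s (lift ord0 i)) - v (s ord0)) = \matrix_(i < 1) (rim j - rim k).
    by apply/row_matrixP => i; rewrite !rowK ord1 /s /= !glueL.
  apply: row_free1; rewrite subr_eq0; apply: contra kj => /eqP /esym E; apply/eqP/val_inj.
  apply: (@e_inj R n n3 _ _ (ltn_ord k) (ltn_ord j)).
    by have := congr1 (fun x : 'rV_3 => x 0 0) E; rewrite !vec3E.
  by have := congr1 (fun x : 'rV_3 => x 0 i1) E; rewrite !vec3E.
- by rewrite !big_ord_recl big_ord0; field.
- rewrite !big_ord_recl big_ord0 addr0 /s /= !glueL.
  rewrite {1}qE (bigD1 k)//= (bigD1 j) 1?eq_sym//= ak aj big1 ?addr0// => i /andP[ik ij].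
  by rewrite az// scale0r.
- move=> i iC; have [_] := S i; apply=> i' ii; apply: st.
    by apply: contra iC => /eqP E; rewrite ii E; apply/codomP; exists 0.
  by apply: contra iC => /eqP E; rewrite ii E; apply/codomP; exists 1.
Qed.

End Frustum.

(** * Comparing cardinalities with a pair *)

Section Cardinality.
Variable T : choiceType.

Lemma card_pair (a b : T) : a != b -> [set a; b] #= `I_2.
Proof.
move=> ab; pose f (k : nat) := if k == 0%N then a else b.
have -> : [set a; b] = f @` `I_2.
  apply/seteqP; split=> [x [->|->]|x [k _ <-]]; first by exists 0%N.
    by exists 1%N.
  by rewrite /f; case: eqP => _; [left|right].
apply: inj_card_eq => i j; rewrite !inE /= /f => hi hj.
case: i hi => [|[|//]] _; case: j hj => [|[|//]] _ //= E; by move: ab; rewrite E eqxx.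
Qed.

Lemma pair_card_le (A B : set T) a b : A #= `I_2 -> B a -> B b -> a != b -> A #<= B.
Proof.
move=> A2 Ba Bb ab; have AB : A #= [set a; b].
  by apply: card_eq_trans A2 _; rewrite card_eq_sym; exact: card_pair.
rewrite (card_le_eql AB); apply: subset_card_le => x [->|->] //.
Qed.
End Cardinality.

Section Brick.
Variable R : realType.

Lemma vol_brick_ge (K : set 'rV[R]_3) (a lo hi : R) : compact K -> 0 < a -> lo < hi ->
  (forall x : 'rV[R]_3, `|x 0 0| < a -> `|x 0 i1| < a -> lo <= x 0 i2 <= hi -> K x) ->
  (2 * a) ^+ 2 * (hi - lo) <= fine (vol K).
Proof.
move=> cK a0 lh sK; rewrite -lee_fin fineK; last exact: vol_fin.
have -> : (2 * a) ^+ 2 * (hi - lo) = (a - - a) * (a - - a) * (hi - lo) by ring.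
have := @lebesgue3_box R (- a, - a, lo) (a, a, hi); rewrite /= => <-; [|lra|lra|lra].
apply: le_measure; rewrite ?inE; [exact: measurable_box|exact: compact_measurable_pre|].
move=> t; rewrite /box/= !in_itv/= => -[[h1 h2] h3].
by apply: sK; rewrite point3E ?ltr_norml//; lra.
Qed.
End Brick.

(** * The frustum has two stable and [n] unstable points *)

Section FrustumClass.
Variables (R : realType) (n : nat) (h : R).
Hypotheses (n3 : (2 < n)%N) (h0 : 0 < h) (h4 : h < 4^-1).
Local Notation K := (frustum n h).
Local Notation c := (centroid K).
Local Notation g := (c 0 i2).

Lemma frus_not_smooth : ~ smooth_body K.
Proof.
have k0 : 'I_n by exists 0%N; lia.
have [eq _] := frus_vertex_type n3 h0 h4 k0.
have [c0 c1 /andP[g0 gh]] := frus_centroid n3 h0 h4.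
have [qc sup] := equilibrium_le (frus_c_in n3 h0 h4) eq.
(* At a rim vertex both the base plane and the plane of the equilibrium support the frustum. *)
apply: (@not_smooth_corner _ _ (rim R k0) (- ez R) (rim R k0 - c)) => //.
- by apply: compact_closed_rV; case: (frus_body n3 h0).
- by case: eq.
- apply: rank_col_mx2 => a b E.
  have E0 := congr1 (fun x : 'rV_3 => x 0 0) E.
  have E1 := congr1 (fun x : 'rV_3 => x 0 i1) E.
  have E2 := congr1 (fun x : 'rV_3 => x 0 i2) E.
  have Z : (0 : 'rV[R]_3) 0 0 = 0 /\ (0 : 'rV[R]_3) 0 i1 = 0 /\ (0 : 'rV[R]_3) 0 i2 = 0 by rewrite !mxE.
  have N i : (- ez R) 0 i = - ez R 0 i by rewrite mxE.
  move: E0 E1 E2; rewrite !addvE !scalevE !subvE !N Z.1 Z.2.1 Z.2.2 c0 c1 !vec3E => E0 E1 E2.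
  have b0 : b = 0.
    have : b * (ec R n k0 ^+ 2 + es R n k0 ^+ 2) = 0.
      have -> : b * (ec R n k0 ^+ 2 + es R n k0 ^+ 2) = (a * - 0 + b * (ec R n k0 - 0)) * ec R n k0 + (a * - 0 + b * (es R n k0 - 0)) * es R n k0 by ring.
      by rewrite E0 E1 !mul0r addr0.
    by rewrite ec_es mulr1.
  by split=> //; move: E2; rewrite b0; lra.
- move=> y /(frus_bounds h0)[_ _ /andP[y0 _]].
  by rewrite dotvNl dot_ez subvE vec3E subr0 oppr_le0.
Qed.

Lemma frus_centre (z : R) : z = 0 \/ z = h ->
  equilibrium K c (vec3 0 0 z) /\ poly_nondegenerate K c (vec3 0 0 z).
Proof.
move=> hz; have [c0 c1 /andP[g0 gh]] := frus_centroid n3 h0 h4; have hh := h0; have hh4 := h4.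
have zg : z - g != 0 by apply/eqP => E; case: hz => ez; lra.
have dE y : dotv (vec3 0 0 z - c) (y - vec3 0 0 z) = (z - g) * (y 0 i2 - z).
  by rewrite dotv3 !subvE c0 c1 !vec3E; ring.
have sup y : K y -> dotv (vec3 0 0 z - c) (y - vec3 0 0 z) <= 0.
  move=> /(frus_bounds h0)[_ _ /andP[y0 yh]]; rewrite dE; case: hz => ->.
    by rewrite sub0r subr0 mulNr oppr_le0 mulr_ge0// ltW.
  by rewrite mulr_ge0_le0 ?subr_ge0 ?subr_le0 ?(ltW gh).
have Kz : K (vec3 0 0 z).
  by apply: (frus_brick n3 h0); rewrite !vec3E ?normr0//; case: hz => ->; lra.
have qc : vec3 0 0 z != c.
  by apply: contra zg => /eqP <-; rewrite vec3E subrr.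
split; first by apply: equilibrium_max => //; apply: compact_closed_rV; case: (frus_body n3 h0).
have := @disc_face_type _ _ _ _ _ (frus_polytope n3 h0) Kz _ sup (@open_brick R 8^-1 (-1) 1).
apply.
- by rewrite eq_sym.
- by rewrite /= !vec3E normr0; case: hz => ->; split; lra.
- move=> y [y0 y1 _ _]; rewrite dE => /eqP; rewrite mulf_eq0 (negbTE zg) subr_eq0 => /= /eqP y2.
  by apply: (frus_brick n3 h0) => //; rewrite y2; case: hz => ->; lra.
Qed.

Lemma frus_admissible : admissible K.
Proof.
right; split; first exact: frus_polytope.
move=> q eq; case: (frus_classify n3 h0 h4 eq) => [[->|->]|[[k ->]|[F [fF rF E _]]]].
- by have [] := @frus_centre 0 (or_introl erefl).
- by have [] := @frus_centre h (or_intror erefl).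
- by have [_ [F [fF rF E _]]] := frus_vertex_type n3 h0 h4 k; exists F.
- by exists F.
Qed.

Lemma frus_centre_stable (z : R) : z = 0 \/ z = h -> stable_points K (vec3 0 0 z).
Proof.
move=> hz; have [c0 c1 /andP[g0 gh]] := frus_centroid n3 h0 h4; have hh := h0; have hh4 := h4.
have [eq _] := frus_centre hz.
have [qc _] := equilibrium_le (frus_c_in n3 h0 h4) eq.
have dE y : dotv (y - c) (y - c) = y 0 0 ^+ 2 + y 0 i1 ^+ 2 + (y 0 i2 - g) ^+ 2.
  by rewrite dotv3 !subvE c0 c1; ring.
(* For a point nearer than [z], the ball bounds the height on the side of the base at [z], and the
   window from [z - g] to [z - g + h] bounds it on the other side. *)
have := @local_min_stable _ _ _ _ frus_admissible eq.1 qc (@open_brick R 8^-1 (z - g) (z - g + h)).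
apply.
  by rewrite /= !vec3E normr0; split; lra.
move=> y [y0 y1 y2 y2']; rewrite ltNge enorm_le -ltNge !dE !vec3E expr0n/= !add0r => lt.
have lt2 : (y 0 i2 - g) ^+ 2 < (z - g) ^+ 2.
  by have := sqr_ge0 (y 0 0); have := sqr_ge0 (y 0 i1); lra.
apply: (frus_brick n3 h0) => //.
move: lt2; rewrite -ltr_sqrt; last first.
  by rewrite lt_neqAle sqr_ge0 andbT eq_sym sqrf_eq0; apply/eqP => E; case: hz => ez; lra.
rewrite !sqrtr_sqr; case: hz y2 y2' => -> y2 y2'.
  by rewrite sub0r normrN (gtr0_norm g0) ltr_norml => /andP[? ?]; lra.
by rewrite (@gtr0_norm _ (h - g)) ?subr_gt0// ltr_norml => /andP[? ?]; lra.
Qed.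

Lemma frus_class : body_class 2 n K.
Proof.
have ns := frus_not_smooth; have pK := frus_polytope n3 h0.
have vu (k : 'I_n) : unstable_points K (rim R k).
  have [eq t] := frus_vertex_type n3 h0 h4 k.
  exact: ((equilibria_face_type 2 pK ns eq t).2 _).
split; first exact: frus_admissible.
- have -> : stable_points K = [set vec3 0 0 0; vec3 0 0 h]; last first.
    apply: card_pair; apply/eqP => /(congr1 (fun x : 'rV_3 => x 0 i2)); rewrite !vec3E => E.
    by move: h0; rewrite -E ltxx.
  apply/seteqP; split=> [q sq|q [->|->]]; [|by apply: frus_centre_stable; left|by apply: frus_centre_stable; right].
  case: (frus_classify n3 h0 h4 sq.1) => [//|[[k E]|t]].
    by have := equilibria_index ns sq; rewrite {1}E => /(_ 2%N (vu k)).
  by have := (equilibria_face_type 0 pK ns sq.1 t).1 sq.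
- have -> : unstable_points K = (fun k : nat => vec3 (ec R n k) (es R n k) 0) @` `I_n.
    apply/seteqP; split=> [q uq|q [k kn <-]]; last exact: (vu (Ordinal kn)).
    case: (frus_classify n3 h0 h4 uq.1) => [[E|E]|[[k ->]|t]].
    - by have := equilibria_index ns uq; rewrite E => /(_ 0%N (frus_centre_stable (or_introl erefl))).
    - by have := equilibria_index ns uq; rewrite E => /(_ 0%N (frus_centre_stable (or_intror erefl))).
    - by exists (k : nat) => //=; exact: ltn_ord.
    - by have := (equilibria_face_type 2 pK ns uq.1 t).1 uq.
  apply: inj_card_eq => i j; rewrite !inE /= => ni nj E.
  apply: (@e_inj R n n3 _ _ ni nj).
    by have := congr1 (fun x : 'rV_3 => x 0 0) E; rewrite !vec3E.
  by have := congr1 (fun x : 'rV_3 => x 0 i1) E; rewrite !vec3E.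
Qed.

Lemma frus_vol : 16^-1 * h <= fine (vol K).
Proof.
have -> : 16^-1 * h = (2 * 8^-1) ^+ 2 * (h - 0) by field.
apply: vol_brick_ge => // [|x *]; first by case: (frus_body n3 h0).
exact: (frus_brick n3 h0).
Qed.
End FrustumClass.

(** * The long bipyramid *)

Section CentroidLowerBound.
Variable R : realType.
Local Notation mu3 := (@lebesgue3 R).
Local Notation R1 := (measurableTypeR R).
Local Notation pre K := (@point3 R @^-1` K : set (R1 * R1 * R1)).

(** A Markov bound from below: a nonnegative functional integrates to at least its contribution from
    [B]. *)
Lemma centroid_ge (K : set 'rV[R]_3) w p (r : R) (B : set (R1 * R1 * R1)) : convex_body K ->
  measurable B -> B `<=` pre K -> (forall x, K x -> 0 <= dotv w (x - p)) ->
  (forall t, B t -> r <= dotv w (point3 t - p)) ->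
  r * fine (mu3 B) <= dotv w (centroid K - p) * fine (vol K).
Proof.
move=> bK mB BK h0 hr; have [cK _ _] := bK; have vK := vol_gt0 bK.
have mK := compact_measurable_pre cK.
rewrite -Rintegral_dot// -{1}[B](setIidl BK) -(Rintegral_indic r cK mB).
apply: le_Rintegral => //; [exact: integrable_indic|exact: integrable_dot|].
move=> t Kt; rewrite indicE; case: (boolP (t \in B)) => [/set_mem/hr|_].
  by rewrite mulr1.
by rewrite mulr0; exact: h0.
Qed.
End CentroidLowerBound.

Section Bipyramid.
Variables (R : realType) (n : nat) (M : R).
Hypotheses (n3 : (2 < n)%N) (M1 : 1 < M).
Local Notation ec := (ec R n).
Local Notation es := (es R n).
Implicit Types (q w : 'rV[R]_3).

(* With this ratio of the heights of the two apexes the centroid is at least as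
   high above the rim as the lower apex is below it (lemma [bip_centroid]). *)
Definition bip_height : R := 128 * 192 * M.
Local Notation L := bip_height.
Local Notation rim := (@rim R n).

Definition apex (i : 'I_2) : 'rV[R]_3 := vec3 0 0 (if i == 0 then L else - M).
Definition bipyramid := conv_hull (glue rim apex).
Local Notation K := bipyramid.
Local Notation v := (glue rim apex).
Local Notation iA := (rshift n (0 : 'I_2)).
Local Notation iB := (rshift n (1 : 'I_2)).

Lemma bip_ML : L = 128 * 192 * M. Proof. by []. Qed.

Lemma bip_ind (P : 'I_(n + 2) -> Prop) : (forall k : 'I_n, P (lshift 2 k)) -> P iA -> P iB ->
  forall i, P i.
Proof. by move=> hk hA hB; apply: glue_ind => // k; case: (ord2P k) => ->. Qed.

Lemma apexA : v iA = vec3 0 0 L. Proof. by rewrite glueR. Qed.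
Lemma apexB : v iB = vec3 0 0 (- M). Proof. by rewrite glueR. Qed.
Lemma rimE k : v (lshift 2 k) = vec3 (ec k) (es k) 0. Proof. by rewrite glueL. Qed.

Lemma bip_bounds q : K q -> [/\ `|q 0 0| <= 1, `|q 0 i1| <= 1 & - M <= q 0 i2 <= L].
Proof.
have bM := M1; have bL := bip_ML.
move=> Kq; split; rewrite ?ler_norml; apply: (conv_hull_coord _ Kq); apply: bip_ind => [k||];
  rewrite ?rimE ?apexA ?apexB !vec3E; try have /andP[/andP[? ?] /andP[? ?]] := e_norm_le1 R n k; lra.
Qed.

Lemma bip_weights (a : 'I_n -> R) (b : R) : (forall k, 0 <= a k) -> 0 <= b ->
  \sum_k a k + b = 1 -> K (\sum_k a k *: rim k + b *: vec3 0 0 L).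
Proof.
move=> a0 b0 ab; pose b' (i : 'I_2) := if i == 0 then b else 0.
have -> : b *: vec3 0 0 L = \sum_i b' i *: apex i.
  by rewrite !big_ord_recl big_ord0 /b' /apex /= scale0r !addr0.
apply: conv_glue => // [k|]; first by rewrite /b'; case: ifP.
by rewrite !big_ord_recl big_ord0 /b' /= !addr0.
Qed.

Lemma bip_cone (x y t : R) : 0 <= t < 1 -> x ^+ 2 + y ^+ 2 <= ((1 - t) / 2) ^+ 2 ->
  K (vec3 x y (t * L)).
Proof.
move=> /andP[t0 t1] xy; have t1' : 0 < 1 - t by rewrite subr_gt0.
have nz : 1 - t != 0 by rewrite gt_eqF.
have [|a [a0 a1 ax ay]] := @polygon_disc R n n3 (x / (1 - t)) (y / (1 - t)).
  rewrite !expr_div_n -mulrDl ler_pdivrMr ?exprn_gt0//; apply: le_trans xy _.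
  by rewrite expr_div_n; lra.
have -> : vec3 x y (t * L) = \sum_k ((1 - t) * a k) *: rim k + t *: vec3 0 0 L.
  have S (f : 'I_n -> R) : \sum_k (1 - t) * a k * f k = (1 - t) * \sum_k a k * f k.
    by rewrite mulr_sumr; apply: eq_bigr => k _; rewrite mulrA.
  apply: row3P; rewrite addvE !sumvE scalevE !vec3E.
  - under eq_bigr do rewrite vec3E.
    by rewrite S ax mulr0 addr0 mulrC divfK.
  - under eq_bigr do rewrite vec3E.
    by rewrite S ay mulr0 addr0 mulrC divfK.
  - under eq_bigr do rewrite vec3E mulr0.
    by rewrite big1// add0r.
apply: bip_weights => //; first by move=> k; rewrite mulr_ge0// ltW.
by rewrite -mulr_sumr a1 mulr1 subrK.
Qed.

Lemma bip_height_gt0 : 0 < L.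
Proof. by rewrite bip_ML; have hM := M1; lra. Qed.

Lemma bip_brick q : `|q 0 0| < 8^-1 -> `|q 0 i1| < 8^-1 -> 0 <= q 0 i2 <= L / 2 -> K q.
Proof.
move=> q0 q1 /andP[z0 zh]; have Lp := bip_height_gt0.
have -> : q = vec3 (q 0 0) (q 0 i1) (q 0 i2 / L * L) by rewrite divfK ?gt_eqF// vec3K.
have t1 : q 0 i2 / L <= 2^-1 by rewrite ler_pdivrMr//; lra.
apply: bip_cone; first by rewrite divr_ge0 ?(ltW Lp)//=; lra.
have sq (x : R) : `|x| < 8^-1 -> x ^+ 2 <= 64^-1.
  move=> hx; have -> : 64^-1 = (8^-1) ^+ 2 :> R by field.
  by rewrite -(real_normK (num_real x)) ler_pXn2r ?nnegrE ?invr_ge0// ltW.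
apply: (@le_trans _ _ (4^-1 ^+ 2)).
  by have s0 := sq _ q0; have s1 := sq _ q1; rewrite [4^-1 ^+ 2]expr2; lra.
by rewrite ler_pXn2r ?nnegrE ?invr_ge0//; lra.
Qed.

Lemma bip_polytope : polytope K.
Proof.
have hL := bip_ML; have bM := M1.
apply: conv_hull_polytope; exists (vec3 0 0 (L / 4)).
have := @open_brick R 8^-1 0 (L / 2); set W := [set x | _] => oW.
have : nbhs (vec3 0 0 (L / 4)) W.
  apply: open_nbhs_nbhs; split=> //; rewrite /W /= !vec3E normr0.
  split; lra.
apply: filterS => x [x0 x1 x2 x2']; apply: bip_brick => //.
by rewrite !ltW.
Qed.

Lemma bip_body : convex_body K.
Proof. by case: bip_polytope. Qed.

Local Notation c := (centroid bipyramid).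
Local Notation g := (centroid bipyramid 0 i2).

Lemma bip_vertex i : K (v i).
Proof. exact: conv_hull_vertex. Qed.

Lemma bip_rim_nat (k : nat) : K (vec3 (1 * ec k) (1 * es k) 0).
Proof.
have kn : (k %% n < n)%N by rewrite ltn_mod; lia.
rewrite -(ec_mod R n3 k) -(es_mod R n3 k) !mul1r.
by have := bip_vertex (lshift 2 (Ordinal kn)); rewrite rimE.
Qed.

Lemma bip_axis_centroid : c 0 0 = 0 /\ c 0 i1 = 0.
Proof.
have A (z : R) : vec3 0 0 z = vec3 (0 * ec 0) (0 * es 0) z by rewrite !mul0r.
apply: (centroid_rotz (es1_neq0 R n3) (ec_es R n 1) bip_body).
apply: (conv_hull_rotz (ec_es R n 1)).
- apply: bip_ind => [k||]; rewrite ?rimE ?apexA ?apexB.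
  + by rewrite -[ec k]mul1r -[es k]mul1r polygon_rotz; exact: bip_rim_nat.
  + by rewrite A polygon_rotz !mul0r -apexA; exact: bip_vertex.
  + by rewrite A polygon_rotz !mul0r -apexB; exact: bip_vertex.
- apply: bip_ind => [k||]; rewrite ?rimE ?apexA ?apexB.
  + by rewrite -[ec k]mul1r -[es k]mul1r polygon_rotzV//; exact: bip_rim_nat.
  + by rewrite A polygon_rotzV// !mul0r -apexA; exact: bip_vertex.
  + by rewrite A polygon_rotzV// !mul0r -apexB; exact: bip_vertex.
Qed.

Lemma bip_centroid : M <= g < L.
Proof.
have hL := bip_ML; have bM := M1; have [cK _ _] := bip_body.
have ez0 : (ez R) != 0.
  by apply/eqP => E; have := ez_unit R; rewrite E dot0v => /eqP; rewrite eq_sym oner_eq0.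
apply/andP; split; last first.
  have := @centroid_lt _ K (ez R) L bip_body ez0; rewrite dot_ez.
  by apply=> x /bip_bounds[_ _ /andP[_ ?]]; rewrite dot_ez.
have V : fine (vol K) <= 48 * L.
  have -> : 48 * L = (2 - - 2) * (2 - - 2) * (2 * L - - L) by ring.
  apply: (@vol_box_le _ K (-2, -2, - L) (2, 2, 2 * L)) => /=; [exact: compact_measurable_pre|lra|lra|lra|].
  move=> t /bip_bounds[]; rewrite !point3E !ler_norml => /andP[? ?] /andP[? ?] /andP[? ?].
  by rewrite /box/= !in_itv/=; split; [split|]; lra.
have mB := @measurable_box R (- 8^-1, - 8^-1, L / 4) (8^-1, 8^-1, L / 2).
have := @centroid_ge _ K (ez R) (vec3 0 0 (- M)) (L / 4) _ bip_body mB.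
have sBK : box (- 8^-1, - 8^-1, L / 4) (8^-1, 8^-1, L / 2) `<=` @point3 R @^-1` K.
  move=> t; rewrite /box/= !in_itv/= => -[[h1 h2] h3].
  by apply: bip_brick; rewrite point3E ?ltr_norml//; lra.
move=> /(_ sBK); rewrite lebesgue3_box/=; [|lra|lra|lra].
rewrite dot_ez subvE vec3E !opprK.
have h1 x : K x -> 0 <= dotv (ez R) (x - vec3 0 0 (- M)).
  by move=> /bip_bounds[_ _ /andP[? _]]; rewrite dot_ez subvE vec3E; lra.
have h2 (t : R * R * R) : box (- 8^-1, - 8^-1, L / 4) (8^-1, 8^-1, L / 2) t ->
    L / 4 <= dotv (ez R) (point3 t - vec3 0 0 (- M)).
  rewrite /box/= !in_itv/= => -[_ h3].
  by rewrite dot_ez subvE vec3E point3E; lra.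
move=> /(_ h1 h2) H.
have gM : 0 <= g + M.
  have vK := vol_gt0 bip_body.
  rewrite -(@pmulr_lge0 _ (fine (vol K)))//; apply: (le_trans _ H).
  by rewrite !mulr_ge0//; lra.
(* The box of base side 1/4 between heights [L / 4] and [L / 2] has moment at least [L ^+ 2 / 256],
   and the volume is at most [48 * L]. Hence [g + M >= L / 12288], which is [2 * M] for
   [L = 128 * 192 * M]. *)
have : L / 4 * ((8^-1 + 8^-1) * (8^-1 + 8^-1) * (L / 2 - L / 4)) <= (g + M) * (48 * L).
  by apply: le_trans H _; rewrite ler_wpM2l.
have -> : L / 4 * ((8^-1 + 8^-1) * (8^-1 + 8^-1) * (L / 2 - L / 4)) = (M + M) * (48 * L) by rewrite hL; field.
by rewrite ler_pM2r ?lerD2r// mulr_gt0//; lra.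
Qed.

Lemma bip_vol : 64^-1 * L <= fine (vol K).
Proof.
have hL := bip_ML; have bM := M1; have Lp : 0 < L by lra.
have H : (2 * 8^-1) ^+ 2 * (L / 2 - 0) <= fine (vol K).
  apply: vol_brick_ge => // [||x *]; [by case: bip_body|lra|exact: bip_brick].
by apply: le_trans H; rewrite expr2; lra.
Qed.

Lemma bip_dot q (a b d : R) : dotv (q - c) (vec3 a b d - q) =
  q 0 0 * a + q 0 i1 * b + (q 0 i2 - g) * d -
  (q 0 0 ^+ 2 + q 0 i1 ^+ 2 + (q 0 i2 - g) * q 0 i2).
Proof.
have [c0 c1] := bip_axis_centroid.
by rewrite dotv3 !subvE c0 c1 !vec3E; ring.
Qed.

Lemma bip_c_in : K c.
Proof.
have [c0 c1] := bip_axis_centroid; have /andP[gM gL] := bip_centroid.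
have Lp := bip_height_gt0; have hM := M1.
have -> : c = vec3 0 0 (g / L * L).
  by rewrite divfK ?gt_eqF//; apply: row3P; rewrite !vec3E.
apply: bip_cone; last by rewrite expr0n/= addr0 sqr_ge0.
by rewrite divr_ge0 ?(ltW Lp)/= ?ltr_pdivrMr ?mul1r//; lra.
Qed.

End Bipyramid.

Lemma sum_I2 (V : zmodType) (F : 'I_2 -> V) : \sum_i F i = F 0 + F 1.
Proof. by rewrite big_ord_recl big_ord1; congr (_ + F _); exact: val_inj. Qed.

(** * Faces of the bipyramid that can carry equilibria *)

Section BipyramidEquilibria.
Variables (R : realType) (n : nat) (M : R).
Hypotheses (n3 : (2 < n)%N) (M1 : 1 < M).
Local Notation ec := (ec R n).
Local Notation es := (es R n).
Implicit Types (q w : 'rV[R]_3).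
Local Notation rim := (@rim R n).
Local Notation L := (bip_height M).
Local Notation K := (bipyramid n M).
Local Notation v := (glue rim (apex M)).
Local Notation iA := (rshift n (0 : 'I_2)).
Local Notation iB := (rshift n (1 : 'I_2)).
Local Notation c := (centroid K).
Local Notation g := (centroid K 0 i2).
Local Notation A := (vec3 0 0 L).
Local Notation B := (vec3 0 0 (- M)).

Lemma bip_sup q : (forall i, dotv (q - c) (v i - q) <= 0) <->
  [/\ forall k : 'I_n, q 0 0 * ec k + q 0 i1 * es k <= q 0 0 ^+ 2 + q 0 i1 ^+ 2 + (q 0 i2 - g) * q 0 i2,
     (q 0 i2 - g) * L <= q 0 0 ^+ 2 + q 0 i1 ^+ 2 + (q 0 i2 - g) * q 0 i2 &
     - (q 0 i2 - g) * M <= q 0 0 ^+ 2 + q 0 i1 ^+ 2 + (q 0 i2 - g) * q 0 i2].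
Proof.
have D := bip_dot n3 M1 q; split=> [hv|[h1 h2 h3]].
  split=> [k||]; [have := hv (lshift 2 k)|have := hv iA|have := hv iB];
    by rewrite ?rimE ?apexA ?apexB D; lra.
apply: bip_ind => [k||]; rewrite ?rimE ?apexA ?apexB D.
- by have := h1 k; lra.
- by lra.
- by lra.
Qed.

Lemma bip_axis q : K q -> q != c -> (forall i, dotv (q - c) (v i - q) <= 0) ->
  q 0 0 = 0 -> q 0 i1 = 0 -> q = A \/ q = B.
Proof.
move=> Kq qc /bip_sup[_ hA hB] q0 q1; have [c0 c1] := bip_axis_centroid n3 M1.
have [_ _ /andP[z0 zh]] := bip_bounds M1 Kq.
have gz : q 0 i2 != g.
  by apply: contra qc => /eqP E; apply/eqP; apply: row3P; rewrite ?q0 ?q1 ?c0 ?c1.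
rewrite q0 q1 expr0n /= add0r in hA hB.
have [lt|gt|E] := ltgtP (q 0 i2) g; last by rewrite E eqxx in gz.
  right; apply: row3P; rewrite !vec3E//.
  have : (g - q 0 i2) * (M + q 0 i2) <= 0 by lra.
  by rewrite pmulr_rle0 ?subr_gt0// => h1; lra.
left; apply: row3P; rewrite !vec3E//.
have : (q 0 i2 - g) * (L - q 0 i2) <= 0 by lra.
by rewrite pmulr_rle0 ?subr_gt0// => h1; lra.
Qed.

Lemma bip_coords q (l : 'I_(n + 2) -> R) : q = \sum_i l i *: v i ->
  [/\ q 0 0 = \sum_k l (lshift 2 k) * ec k, q 0 i1 = \sum_k l (lshift 2 k) * es k &
      q 0 i2 = l iA * L - l iB * M].
Proof.
move=> ->; rewrite !sumvE !big_split_ord !sum_I2 /=.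
rewrite apexA apexB !vec3E !mulr0 !addr0; split.
- by apply: eq_bigr => k _; rewrite rimE vec3E.
- by apply: eq_bigr => k _; rewrite rimE vec3E.
- by rewrite big1 ?add0r ?mulrN// => k _; rewrite rimE vec3E mulr0.
Qed.

(** Here [m] is the value of [dotv (q - c)] at [q], and the squared horizontal length is [m] times
    the rim weight. Comparing with a rim vertex that carries weight gives [m <= 1]. Weight on the
    lower apex without the upper one, or on the rim alone, would force [g * M <= m], against
    [1 < M <= g]; weight on both apexes would give [q 0 i2 - g] two opposite signs. *)
Lemma bip_off_axis q (l : 'I_(n + 2) -> R) : (forall i, 0 <= l i) -> \sum_i l i = 1 ->
  q = \sum_i l i *: v i -> (forall i, dotv (q - c) (v i - q) <= 0) ->
  (q 0 0 != 0) || (q 0 i1 != 0) ->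
  let m := q 0 0 ^+ 2 + q 0 i1 ^+ 2 + (q 0 i2 - g) * q 0 i2 in
  [/\ l iB = 0, 0 < l iA, 0 < \sum_k l (lshift 2 k),
      (q 0 i2 - g) * L = m & 0 < m] /\
  q 0 0 ^+ 2 + q 0 i1 ^+ 2 = (\sum_k l (lshift 2 k)) * m /\
  forall k, l (lshift 2 k) != 0 -> q 0 0 * ec k + q 0 i1 * es k = m.
Proof.
move=> l0 l1 qE hv q01 m; have /andP[gM gL] := bip_centroid n3 M1.
have [hd hA hB] := (bip_sup q).1 hv; rewrite -/m in hd hA hB.
have D := bip_dot n3 M1 q.
have attain : forall i, l i != 0 -> dotv (q - c) (v i - q) = 0.
  by apply: (polytope_face_weights hv l0 l1); rewrite -qE subrr dotv0.
have [Q0 Q1 Q2] := bip_coords qE.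
pose N := q 0 0 ^+ 2 + q 0 i1 ^+ 2.
have N0 : 0 < N.
  by rewrite lt_neqAle eq_sym addr_ge0 ?sqr_ge0// andbT paddr_eq0 ?sqr_ge0// !sqrf_eq0 negb_and.
set p := fun k : 'I_n => l (lshift 2 k); set G := \sum_k l _.
have G0 : 0 <= G by apply: sumr_ge0.
have l1' : G + (l iA + l iB) = 1 by rewrite -l1 big_split_ord sum_I2.
have atk (k : 'I_n) : l (lshift 2 k) != 0 -> q 0 0 * ec k + q 0 i1 * es k = m.
  by move=> /attain; rewrite rimE D mulr0 addr0 -/m => /eqP; rewrite subr_eq0 => /eqP.
have NE : N = G * m.
  rewrite /G mulr_suml; transitivity (\sum_k l (lshift 2 k) * (q 0 0 * ec k + q 0 i1 * es k)).
    rewrite /N !expr2 {2}Q0 {2}Q1 !mulr_sumr -big_split; apply: eq_bigr => k _ /=; ring.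
  apply: eq_bigr => k _; have [->|/atk ->//] := eqVneq (l (lshift 2 k)) 0.
  by rewrite !mul0r.
have [m0 _] := polygon_width n3 hd.
have mp : 0 < m by rewrite lt_neqAle m0 andbT eq_sym; apply/eqP => E; move: N0; rewrite NE E mulr0 ltxx.
have Gp : 0 < G by rewrite lt_neqAle G0 andbT eq_sym; apply/eqP => E; move: N0; rewrite NE E mul0r ltxx.
have [k pk] : exists k, l (lshift 2 k) != 0.
  apply: contrapT => H; move: Gp; rewrite /G big1 ?ltxx// => k _; apply: contrapT => /eqP lk.
  by apply: H; exists k.
have m1 : m <= 1.
  have E := atk _ pk; have e1 := ec_es R n k.
  have s1 := sqr_ge0 (q 0 0 - ec k); have s2 := sqr_ge0 (q 0 i1 - es k).
  have Gm : G * m <= m by rewrite ler_piMl//; have := l0 iA; have := l0 iB; lra.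
  have : 2 * m <= N + 1 by rewrite -E /N; lra.
  by rewrite NE; lra.
have hM := M1; have Lp := bip_height_gt0 M1.
have aA : l iA != 0 -> (q 0 i2 - g) * L = m.
  by move=> /attain; rewrite apexA D !mulr0 !add0r -/m => /eqP; rewrite subr_eq0 => /eqP.
have aB : l iB != 0 -> - (q 0 i2 - g) * M = m.
  by move=> /attain; rewrite apexB D !mulr0 !add0r mulrN -mulNr -/m => /eqP; rewrite subr_eq0 => /eqP.
have gM1 : 1 < g * M.
  by apply: (@lt_le_trans _ _ (M * M)); [rewrite -[1]mulr1 ltr_pM//|rewrite ler_pM2r//]; lra.
have B0 : l iB = 0.
  apply/eqP; apply: contraT => /aB hb; have [a0|/aA ha] := eqVneq (l iA) 0.
    have : g * M <= (g - q 0 i2) * M.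
      rewrite ler_pM2r; last by lra.
      by rewrite Q2 a0 mul0r sub0r lerDl opprK mulr_ge0//; lra.
    by lra.
  have z1 : 0 < q 0 i2 - g by rewrite -(pmulr_lgt0 _ Lp) ha.
  have : 0 < (q 0 i2 - g) * M by rewrite mulr_gt0//; lra.
  lra.
have A0 : l iA != 0.
  apply/eqP => a0; have z0 : q 0 i2 = 0 by rewrite Q2 a0 B0; ring.
  by move: hB; rewrite z0; lra.
split; last by split.
split=> //; [by rewrite lt_neqAle eq_sym A0 l0|exact: aA].
Qed.

Lemma bip_face1 q (l : 'I_(n + 2) -> R) (k : 'I_n) : q != c -> \sum_i l i = 1 ->
  q = \sum_i l i *: v i -> (forall i, dotv (q - c) (v i - q) <= 0) ->
  0 < l iA -> 0 < l (lshift 2 k) -> l iB = 0 -> dotv (q - c) (v iB - q) < 0 ->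
  (forall j : 'I_n, j != k -> l (lshift 2 j) = 0 /\ dotv (q - c) (v (lshift 2 j) - q) < 0) ->
  face_type K c q 1.
Proof.
move=> qc l1 qE hv lA lk lB sB sj; have Lp := bip_height_gt0 M1.
pose s (i : 'I_2) := if i == 0 then iA else lshift 2 k.
have lr : (iA == lshift 2 k) = false by exact: eq_rlshift.
apply: (@weights_face_type _ _ _ _ _ l 1 s) => //.
- move=> x y; rewrite /s; case: (ord2P x) => ->; case: (ord2P y) => -> //= /eqP; by rewrite ?lr// eq_sym lr.
- have -> : \matrix_(i < 1) (v (s (lift ord0 i)) - v (s ord0)) = \matrix_(i < 1) (rim k - A).
    by apply/row_matrixP => i; rewrite !rowK ord1 /s /= apexA glueL.
  apply: row_free1; apply/eqP => /(congr1 (fun x : 'rV_3 => x 0 i2)).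
  by rewrite subvE !vec3E mxE; lra.
- by move=> j; case: (ord2P j) => ->.
- apply: bip_ind => [j||] // iC.
    by apply: sj; apply: contra iC => /eqP ->; apply/codomP; exists 1.
  by case/negP: iC; apply/codomP; exists 0.
Qed.

Lemma bip_face2 q (l : 'I_(n + 2) -> R) (k k' : 'I_n) : k != k' -> q != c -> \sum_i l i = 1 ->
  q = \sum_i l i *: v i -> (forall i, dotv (q - c) (v i - q) <= 0) ->
  0 < l iA -> 0 < l (lshift 2 k) -> 0 < l (lshift 2 k') ->
  l iB = 0 -> dotv (q - c) (v iB - q) < 0 ->
  (forall j : 'I_n, j != k -> j != k' ->
     l (lshift 2 j) = 0 /\ dotv (q - c) (v (lshift 2 j) - q) < 0) ->
  face_type K c q 2.
Proof.
move=> kk' qc l1 qE hv lA lk lk' lB sB sj; have Lp := bip_height_gt0 M1.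
pose s (i : 'I_3) := if i == 0 then iA else if i == i1 then lshift 2 k else lshift 2 k'.
have lr i : (iA == lshift 2 (i : 'I_n)) = false by exact: eq_rlshift.
have ll : (lshift 2 k == lshift 2 k') = false by rewrite eq_lshift; exact: negbTE.
apply: (@weights_face_type _ _ _ _ _ l 2 s) => //.
- move=> x y; move: x y; apply: ord3_ind; apply: ord3_ind => //=; rewrite /s /= => /eqP;
    by rewrite ?lr ?ll// eq_sym ?lr ?ll.
- apply: row_free2 => a b; rewrite /s /= !glueL apexA => E.
  have Z i : (0 : 'rV[R]_3) 0 i = 0 by rewrite mxE.
  have E0 := congr1 (fun x : 'rV_3 => x 0 0) E.
  have E1 := congr1 (fun x : 'rV_3 => x 0 i1) E.
  have E2 := congr1 (fun x : 'rV_3 => x 0 i2) E.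
  move: E0 E1 E2; rewrite !addvE !scalevE !subvE !Z !vec3E => E0 E1 E2.
  have ab : b = - a.
    have : L * (a + b) = 0 by lra.
    by move/eqP; rewrite mulf_eq0 gt_eqF//= addrC addr_eq0 => /eqP.
  suff bz : b = 0 by split=> //; move: ab; rewrite bz; lra.
  apply/eqP; apply: contraT => b0; case/negP: kk'; apply/eqP/val_inj.
  apply: (@e_inj R n n3 _ _ (ltn_ord k) (ltn_ord k')); apply: (mulfI b0).
    by move: E0; rewrite ab; lra.
  by move: E1; rewrite ab; lra.
- by apply: ord3_ind.
- apply: bip_ind => [j||] // iC.
    apply: sj; apply: contra iC => /eqP ->; apply/codomP; [by exists i1|by exists i2].
  by case/negP: iC; apply/codomP; exists 0.
Qed.

Lemma bip_face_types q (l : 'I_(n + 2) -> R) : (forall i, 0 <= l i) -> \sum_i l i = 1 ->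
  q = \sum_i l i *: v i -> q != c -> (forall i, dotv (q - c) (v i - q) <= 0) ->
  (q 0 0 != 0) || (q 0 i1 != 0) ->
  let m := q 0 0 ^+ 2 + q 0 i1 ^+ 2 + (q 0 i2 - g) * q 0 i2 in
  let b := \sum_k l (lshift 2 k) in
  (face_type K c q 1 /\
   exists k : 'I_n, forall j : 'I_n, j != k -> q 0 0 * ec j + q 0 i1 * es j < m) \/
  (face_type K c q 2 /\
   exists k j : 'I_n, [/\ k != j, l (lshift 2 k) = b / 2, l (lshift 2 j) = b / 2 &
     forall i, i != k -> i != j -> l (lshift 2 i) = 0]).
Proof.
move=> l0 l1 qE qc hv q01 m b.
have [[B0 A0 b0 Am m0] [_ atk]] := bip_off_axis l0 l1 qE hv q01; rewrite -/m -/b in Am m0 atk b0.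
have [hd hA hB] := (bip_sup q).1 hv; rewrite -/m in hd hA hB.
have [Q0 Q1 Q2] := bip_coords qE.
have D := bip_dot n3 M1 q; have Lp := bip_height_gt0 M1; have hM := M1.
have sB : dotv (q - c) (v iB - q) < 0.
  rewrite apexB D -/m; have z1 : 0 < q 0 i2 - g by rewrite -(pmulr_lgt0 _ Lp) Am.
  have : 0 < (q 0 i2 - g) * M by rewrite mulr_gt0//; lra.
  lra.
have sd (j : 'I_n) : q 0 0 * ec j + q 0 i1 * es j < m -> dotv (q - c) (v (lshift 2 j) - q) < 0.
  by rewrite rimE D -/m mulr0 addr0 subr_lt0.
have [[k [lk lz st]]|[k [j [kj lk lj lz st]]]] :=
  polygon_equilibrium n3 (fun k => l0 (lshift 2 k)) (erefl b) b0 (ltr01 : 0 < 1 :> R)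
    (etrans Q0 (esym (mul1r _))) (etrans Q1 (esym (mul1r _))) q01 hd atk.
- left; split; last by exists k.
  apply: (@bip_face1 q l k) => //; first by rewrite lk.
  by move=> j jk; split; [exact: lz|exact/sd/st].
- right; split; last by exists k, j.
  apply: (@bip_face2 q l k j) => //; rewrite ?lk ?lj ?divr_gt0//.
  by move=> i ik ij; split; [exact: lz|exact/sd/st].
Qed.

End BipyramidEquilibria.

Lemma sqr_scale (R : comPzRingType) (a x y : R) :
  (a * x) ^+ 2 + (a * y) ^+ 2 = a ^+ 2 * (x ^+ 2 + y ^+ 2).
Proof. by ring. Qed.

(** * The [n] stable and two unstable points of the bipyramid *)

Section BipyramidClass.
Variables (R : realType) (n : nat) (M : R).
Hypotheses (n3 : (2 < n)%N) (M1 : 1 < M).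
Local Notation ec := (ec R n).
Local Notation es := (es R n).
Implicit Types (q w : 'rV[R]_3).
Local Notation rim := (@rim R n).
Local Notation L := (bip_height M).
Local Notation K := (bipyramid n M).
Local Notation v := (glue rim (apex M)).
Local Notation iA := (rshift n (0 : 'I_2)).
Local Notation iB := (rshift n (1 : 'I_2)).
Local Notation c := (centroid K).
Local Notation g := (centroid K 0 i2).
Local Notation A := (vec3 0 0 L).
Local Notation B := (vec3 0 0 (- M)).

(* The total weight of the rim in the stable point of an upper facet.  With
   [z = (1 - b) L] its height and [m] the value of the support functional,
   [(z - g) L = m] at the apex and [m = b (1 + cos (2 pi / n)) / 2] at the rim. *)
Definition bip_weight : R := L * (L - g) / (L ^+ 2 + (1 + ec 1) / 2).
Local Notation b := bip_weight.
(** For [k = n.-1] the successor wraps round to vertex 0 by periodicity, so the closing edge needs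
    no separate formula. *)
Definition bip_mid (k : nat) : 'rV[R]_3 :=
  vec3 (b / 2 * (ec k + ec k.+1)) (b / 2 * (es k + es k.+1)) ((1 - b) * L).

Lemma bip_weight_den : 0 < L ^+ 2 + (1 + ec 1) / 2.
Proof.
have Lp := bip_height_gt0 M1; have e1 := ec1_gtN1 R n3.
by rewrite addr_gt0 ?exprn_gt0 ?divr_gt0.
Qed.

Lemma bip_weightE : b * (L ^+ 2 + (1 + ec 1) / 2) = L * (L - g).
Proof. by rewrite divfK// gt_eqF// bip_weight_den. Qed.

Lemma bip_weight_itv : 0 < b < 1.
Proof.
have Lp := bip_height_gt0 M1; have e1 := ec1_gtN1 R n3; have d := bip_weight_den.
have /andP[gM gL] := bip_centroid n3 M1; have hM := M1.
apply/andP; split; first by rewrite divr_gt0// mulr_gt0// subr_gt0.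
rewrite ltr_pdivrMr// mul1r mulrBr -expr2.
have : 0 < L * g by rewrite mulr_gt0//; lra.
lra.
Qed.

Lemma bip_mid_support k : (bip_mid k) 0 0 ^+ 2 + (bip_mid k) 0 i1 ^+ 2 +
  ((bip_mid k) 0 i2 - g) * (bip_mid k) 0 i2 = b * ((1 + ec 1) / 2) /\
  ((bip_mid k) 0 i2 - g) * L = b * ((1 + ec 1) / 2).
Proof.
have E := bip_weightE; rewrite !vec3E.
have H : ((1 - b) * L - g) * L = b * ((1 + ec 1) / 2).
  have -> : ((1 - b) * L - g) * L = L * (L - g) - b * L ^+ 2 by ring.
  by rewrite -E; ring.
split=> //; rewrite sqr_scale mid_norm.
have -> : ((1 - b) * L - g) * ((1 - b) * L) = (1 - b) * (((1 - b) * L - g) * L) by ring.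
by rewrite H; generalize b (ec 1) => x y; field.
Qed.

Lemma bip_mid_off k : (bip_mid k 0 0 != 0) || (bip_mid k 0 i1 != 0).
Proof.
have e1 := ec1_gtN1 R n3; have /andP[b0 _] := bip_weight_itv.
have b2 : b / 2 != 0 by rewrite gt_eqF// divr_gt0.
rewrite -negb_and !vec3E; apply/negP => /andP[/eqP E0 /eqP E1]; have := mid_norm R n k.
rewrite (_ : ec k + ec k.+1 = 0); last by apply: (mulfI b2); rewrite E0 mulr0.
rewrite (_ : es k + es k.+1 = 0); last by apply: (mulfI b2); rewrite E1 mulr0.
by rewrite expr0n /= addr0; lra.
Qed.

Lemma bip_mid_le k : (k < n)%N -> forall i, dotv (bip_mid k - c) (v i - bip_mid k) <= 0.
Proof.
move=> kn; have [Em EA] := bip_mid_support k; have e1 := ec1_gtN1 R n3.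
have /andP[b0 b1] := bip_weight_itv; have Lp := bip_height_gt0 M1; have hM := M1.
have m0 : 0 < b * ((1 + ec 1) / 2) by rewrite mulr_gt0// divr_gt0.
apply: (bip_sup n3 M1 _).2; rewrite Em; split=> [j||].
- rewrite !vec3E; have := adjacent_max R n3 kn (ltn_ord j); set s := _ + _ => hs.
  have -> : b / 2 * (ec k + ec k.+1) * ec j + b / 2 * (es k + es k.+1) * es j = b / 2 * s.
    by rewrite /s; ring.
  by have -> : b * ((1 + ec 1) / 2) = b / 2 * (1 + ec 1) by [ring]; rewrite ler_pM2l// divr_gt0.
- by rewrite EA.
- have z1 : 0 < bip_mid k 0 i2 - g by rewrite -(pmulr_lgt0 _ Lp) EA.
  have : 0 < (bip_mid k 0 i2 - g) * M by rewrite mulr_gt0//; lra.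
  by rewrite mulNr; lra.
Qed.

Lemma bip_mid_in k : K (bip_mid k).
Proof.
have /andP[b0 b1] := bip_weight_itv.
have cK : convex_set K by case: (bip_body n3 M1).
have h1 : K (vec3 (ec k) (es k) 0) by rewrite -[ec k]mul1r -[es k]mul1r; exact: bip_rim_nat.
have h2 : K (vec3 (ec k.+1) (es k.+1) 0) by rewrite -[ec k.+1]mul1r -[es k.+1]mul1r; exact: bip_rim_nat.
have hA : K A by rewrite -(apexA n); exact: bip_vertex.
have h3 := (convex_setP K).1 cK _ _ 2^-1 h1 h2.
have -> : bip_mid k = b *: (2^-1 *: vec3 (ec k) (es k) 0 + (1 - 2^-1) *: vec3 (ec k.+1) (es k.+1) 0) + (1 - b) *: A.
  by apply: row3P; rewrite !(addvE, scalevE) !vec3E; field.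
by apply: ((convex_setP K).1 cK) => //; [apply: h3; lra|exact: ltW|exact: ltW].
Qed.

Lemma bip_mid_neq_c k : bip_mid k != c.
Proof.
have [c0 c1] := bip_axis_centroid n3 M1.
by apply/eqP => E; have := bip_mid_off k; rewrite E c0 c1 eqxx.
Qed.

Lemma bip_mid_facet k : (k < n)%N -> equilibrium K c (bip_mid k) /\ face_type K c (bip_mid k) 2.
Proof.
move=> kn; have hv := bip_mid_le kn; have qc := bip_mid_neq_c k.
have Kq := bip_mid_in k; split.
  apply: equilibrium_max => //; first by apply: compact_closed_rV; case: (bip_body n3 M1).
  by move=> y Ky; exact: (conv_hull_dot hv Ky).
have [l [l0 l1 qE]] := Kq.
have := bip_face_types n3 M1 l0 l1 qE qc hv (bip_mid_off k).
rewrite (bip_mid_support k).1 => -[[_ [j st]]|[]//].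
have D (i : nat) : bip_mid k 0 0 * ec i + bip_mid k 0 i1 * es i =
    b / 2 * ((ec k + ec k.+1) * ec i + (es k + es k.+1) * es i).
  by rewrite !vec3E; ring.
have Em : b / 2 * (1 + ec 1) = b * ((1 + ec 1) / 2) by ring.
have k1n : (k.+1 %% n < n)%N by rewrite ltn_mod; lia.
(* Both ends of the edge attain the support value, so at most one vertex attaining it is impossible;
   the second end is taken modulo [n]. *)
have [/eqP jk|jk] := boolP (Ordinal kn == j).
  have : Ordinal k1n != j.
    rewrite -jk; apply/eqP => /(congr1 val) /=.
    have [lt|ge] := ltnP k.+1 n; first by rewrite modn_small//; lia.
    by have -> : k.+1 = n by [lia]; rewrite modnn => E; lia.
  by move=> /st; rewrite /= ec_mod// es_mod// D mid_dotS Em ltxx.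
by have := st _ jk; rewrite D mid_dot Em ltxx.
Qed.

Lemma bip_apex_type q : q = A \/ q = B ->
  equilibrium K c q /\ face_type K c q 0.
Proof.
have Lp := bip_height_gt0 M1; have hM := M1; have /andP[gM gL] := bip_centroid n3 M1.
have D i (z : R) : dotv (vec3 0 0 z - c) (v i - vec3 0 0 z) = (z - g) * (v i 0 i2 - z).
  have [c0 c1] := bip_axis_centroid n3 M1.
  by rewrite dotv3 !subvE c0 c1 !vec3E; ring.
have vertex i0 (z : R) : v i0 = vec3 0 0 z -> z != g ->
    (forall i, i != i0 -> (z - g) * (v i 0 i2 - z) < 0) ->
    equilibrium K c (vec3 0 0 z) /\ face_type K c (vec3 0 0 z) 0.
  move=> vz zg st; rewrite -vz; apply: vertex_face_type => [|i ii]; rewrite vz ?D ?st//.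
  by apply: contra zg => /eqP <-; rewrite vec3E.
case=> ->; [apply: (vertex iA); first exact: apexA|apply: (vertex iB); first exact: apexB].
- by rewrite gt_eqF.
- apply: bip_ind => [k _|/eqP//|_]; rewrite ?rimE ?apexB vec3E.
    by rewrite sub0r mulrN oppr_lt0 mulr_gt0// subr_gt0.
  by rewrite -opprD mulrN oppr_lt0 mulr_gt0// ?subr_gt0// addr_gt0//; lra.
- by rewrite lt_eqF//; lra.
- apply: bip_ind => [k _|_|/eqP//]; rewrite ?rimE ?apexA vec3E.
    by rewrite opprK -opprD mulNr oppr_lt0 mulr_gt0//; lra.
  by rewrite opprK -opprD mulNr oppr_lt0 mulr_gt0//; lra.
Qed.

Lemma bip_classify q : equilibrium K c q ->
  (q = A \/ q = B) \/ face_type K c q 1 \/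
  (face_type K c q 2 /\ exists2 k, (k < n)%N & q = bip_mid k).
Proof.
move=> eq; have [qc sup] := equilibrium_le (bip_c_in n3 M1) eq.
have Kq : K q.
  have [[+ _] _] := eq; rewrite -((closure_id K).1 _)//.
  by apply: compact_closed_rV; exact: conv_hull_compact.
have hv i : dotv (q - c) (v i - q) <= 0 by apply: sup; exact: conv_hull_vertex.
have [q01|] := boolP ((q 0 0 != 0) || (q 0 i1 != 0)); last first.
  by rewrite negb_or !negbK => /andP[/eqP q0 /eqP q1]; left; exact: (bip_axis n3 M1).
right; have [l [l0 l1 qE]] := Kq.
have [[? _]|[ft [k [j [kj lk lj lz]]]]] := bip_face_types n3 M1 l0 l1 qE qc hv q01; first by left.
right; split=> //.
have [[B0 A0 b0 Am m0] [NE atk]] := bip_off_axis n3 M1 l0 l1 qE hv q01.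
have [hd _ _] := (bip_sup n3 M1 q).1 hv.
have [Q0 Q1 Q2] := bip_coords qE.
set m := _ + _ + _ in Am m0 NE atk hd.
set G := \sum_k l (lshift 2 k) in lk lj NE b0.
wlog kj' : k j kj lk lj lz / (k < j)%N.
  move=> H; have [kj'|jk|E] := ltngtP k j; first exact: (H k j).
    by apply: (H j k) => //; [rewrite eq_sym|move=> i ij ik; exact: lz].
  by move: kj; rewrite -val_eqE /= E eqxx.
have S (f : nat -> R) : \sum_(i < n) l (lshift 2 i) * f i = G / 2 * (f k + f j).
  rewrite (bigD1 k)//= (bigD1 j) 1?eq_sym//= lk lj big1 => [|i /andP[ik ij]].
    by rewrite addr0; ring.
  by rewrite lz// mul0r.
rewrite (S ec) in Q0; rewrite (S es) in Q1.
have G2 : 0 < G / 2 by rewrite divr_gt0.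
have lk0 : l (lshift 2 k) != 0 by rewrite lk gt_eqF.
have hdk (i : 'I_n) : q 0 0 * ec i + q 0 i1 * es i <= q 0 0 * ec k + q 0 i1 * es k.
  by rewrite (atk _ lk0).
(* The closing edge from 0 to [n.-1] is recorded as the edge starting at [n.-1]. *)
have [k' k'n [Q0' Q1']] : exists2 k', (k' < n)%N &
    q 0 0 = G / 2 * (ec k' + ec k'.+1) /\ q 0 i1 = G / 2 * (es k' + es k'.+1).
  have [jE|[kE jE]] := edge_adjacent n3 kj' (ltn_ord j) G2 Q0 Q1 q01 hdk.
    by exists k => //; rewrite -jE.
  exists n.-1; first by lia.
  have -> : n.-1.+1 = n by lia.
  by rewrite Q0 Q1 kE jE ec0 es0 (ecn R n3) (esn R n3); split; rewrite addrC.
exists k' => //.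
have GA : l iA = 1 - G.
  by move: l1; rewrite big_split_ord sum_I2 B0 /= -/G; lra.
have Q2' : q 0 i2 = (1 - G) * L by rewrite Q2 B0 GA mul0r subr0.
have mE : m = G * ((1 + ec 1) / 2).
  have G0 : G != 0 by rewrite gt_eqF.
  by apply: (mulfI G0); rewrite -NE Q0' Q1' sqr_scale mid_norm; field.
(* Equality of the support values at the apex and at the rim is a linear equation for the rim
   weight, with [b] as its only solution. *)
have GE : G = b.
  apply: (mulIf (lt0r_neq0 bip_weight_den)); rewrite bip_weightE.
  by rewrite mulrDr -mE -Am Q2'; ring.
by apply: row3P; rewrite !vec3E ?Q0' ?Q1' ?Q2' GE.
Qed.

Lemma bip_not_smooth : ~ smooth_body K.
Proof.
have Lp := bip_height_gt0 M1; have hM := M1; have hL := bip_ML M.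
have [eq _] := bip_apex_type (or_introl erefl).
(* The direction [(1, 0, 1)] supports at the upper apex because the rim has radius 1, less than
   [L]. *)
apply: (@not_smooth_corner _ _ A (ez R) (vec3 1 0 1)) => //.
- by apply: compact_closed_rV; case: (bip_body n3 M1).
- by case: eq.
- apply: rank_col_mx2 => a d E.
  have Z i : (0 : 'rV[R]_3) 0 i = 0 by rewrite mxE.
  have E0 := congr1 (fun x : 'rV_3 => x 0 0) E.
  have E2 := congr1 (fun x : 'rV_3 => x 0 i2) E.
  by move: E0 E2; rewrite !addvE !scalevE !Z !vec3E => E0 E2; split; lra.
- by move=> y /(bip_bounds M1)[_ _ /andP[_ y0]]; rewrite dot_ez subvE vec3E subr_le0.
- move=> y Ky; apply: (conv_hull_dot _ Ky); apply: bip_ind => [k||].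
  + have /andP[/andP[_ e1] _] := e_norm_le1 R n k.
    by rewrite rimE dotv3 !subvE !vec3E; lra.
  + by rewrite apexA subrr dotv0.
  + by rewrite apexB dotv3 !subvE !vec3E; lra.
Qed.

Lemma bip_class : body_class n 2 K.
Proof.
have ns := bip_not_smooth; have pK := bip_polytope n3 M1.
have vu q : q = A \/ q = B -> unstable_points K q.
  move=> /bip_apex_type[eq t].
  exact: ((equilibria_face_type 2 pK ns eq t).2 _).
have vs k : (k < n)%N -> stable_points K (bip_mid k).
  move=> /bip_mid_facet[eq t].
  exact: ((equilibria_face_type 0 pK ns eq t).2 _).
have /andP[b0 b1] := bip_weight_itv.
split.
- right; split=> // q eq.
  have [] : exists d, face_type K c q d; last by move=> d [F [fF rF E _]]; exists F.
  case: (bip_classify eq) => [/bip_apex_type[_ t]|[t|[t _]]]; by eexists; exact: t.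
- have -> : stable_points K = bip_mid @` `I_n.
    apply/seteqP; split=> [q sq|q [k kn <-]]; last exact: vs.
    case: (bip_classify sq.1) => [/vu E|[t|[_ [k kn ->]]]]; last by exists k.
      by have := equilibria_index ns sq E.
    by have := (equilibria_face_type 0 pK ns sq.1 t).1 sq.
  apply: inj_card_eq => i j; rewrite !inE /= => ni nj E.
  have b2 : b / 2 != 0 by rewrite gt_eqF// divr_gt0.
  apply: (mid_inj n3 ni nj); apply: (mulfI b2).
    by have := congr1 (fun x : 'rV_3 => x 0 0) E; rewrite !vec3E.
  by have := congr1 (fun x : 'rV_3 => x 0 i1) E; rewrite !vec3E.
- have -> : unstable_points K = [set A; B]; last first.
    apply: card_pair; apply/eqP => /(congr1 (fun x : 'rV_3 => x 0 i2)); rewrite !vec3E => E.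
    by have := bip_height_gt0 M1; have := M1; lra.
  apply/seteqP; split=> [q uq|q hq]; last exact: vu.
  case: (bip_classify uq.1) => [//|[t|[_ [k kn E]]]].
    by have := (equilibria_face_type 2 pK ns uq.1 t).1 uq.
  by have := equilibria_index ns uq; rewrite E => /(_ 0%N (vs _ kn)).
Qed.

End BipyramidClass.

(** * Robustness *)

Section Robustness.
Variable R : realType.
Implicit Types (K : set 'rV[R]_3).

Lemma removed_fractionE K K' : convex_body K -> convex_body K' -> K' `<=` K ->
  removed_fraction K K' = 1 - fine (vol K') / fine (vol K).
Proof.
move=> bK bK' sK; have [cK _ _] := bK; have [cK' _ _] := bK'.
by rewrite /removed_fraction vol_setD// mulrBl divff// gt_eqF// vol_gt0.
Qed.

(** Robustness never exceeds 1, so the supremum is 1 as soon as truncations of suitable bodies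
    retain an arbitrarily small fraction of the volume. The instance [e = 1] also shows that the
    class is nonempty. *)
Lemma sup_robustness (pts : set 'rV[R]_3 -> set 'rV[R]_3) (cls : set (set 'rV[R]_3)) :
  cls `<=` @convex_body R ->
  (forall e : R, 0 < e -> exists2 K, cls K &
     forall K', truncations pts K K' -> fine (vol K') <= e * fine (vol K)) ->
  sup [set robustness pts K | K in cls] = 1.
Proof.
move=> bcls H.
have le1 K : cls K -> robustness pts K <= 1.
  move=> /bcls bK; rewrite /robustness; case: eqP => // /eqP/set0P[K' tK'].
  have lb K1 : truncations pts K K1 -> 0 <= removed_fraction K K1 <= 1.
    move=> [/admissible_body bK1 sK _]; have vK := vol_gt0 bK; have vK1 := vol_gt0 bK1.
    rewrite removed_fractionE// subr_ge0 ler_pdivrMr// mul1r gerBl (divr_ge0 (ltW vK1) (ltW vK)) andbT.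
    by apply: vol_le => //; [case: bK|apply: compact_measurable_pre; case: bK1].
  apply: (@le_trans _ _ (removed_fraction K K')); last by have /andP[] := lb _ tK'.
  apply: ge_inf; last by exists K'.
  by exists 0 => _ [K1 tK1 <-]; have /andP[] := lb _ tK1.
have ub : ubound [set robustness pts K | K in cls] 1 by move=> _ [K cK <-]; exact: le1.
have [K0 cK0 _] := H 1 ltr01.
apply/eqP; rewrite eq_le; apply/andP; split.
  by apply: ge_sup => //; exists (robustness pts K0), K0.
apply/ler_addgt0Pr => e e0; have [K cK hK] := H e e0.
rewrite -lerBlDr; apply: (@le_trans _ _ (robustness pts K)); last first.
  by apply: ub_le_sup; [exists 1|exists K].
(* Without truncations the default value 1 already exceeds [1 - e]. *)
rewrite /robustness; case: eqP => [_|/eqP/set0P[K' tK']]; first by rewrite gerBl ltW.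
apply: lb_le_inf; first by exists (removed_fraction K K'), K'.
move=> _ [K1 tK1 <-]; have [/admissible_body bK1 sK _] := tK1.
have vK := vol_gt0 (bcls _ cK).
by rewrite removed_fractionE ?lerB ?ler_pdivrMr ?hK//; exact: bcls.
Qed.
End Robustness.

Lemma rho_s_2n (R : realType) (n : nat) : (2 < n)%N -> rho_s R 2 n = 1.
Proof.
move=> n3; apply: sup_robustness => [K [/admissible_body]//|e e0].
(* The bound [48 * h ^+ 2 <= e * (h / 16)] amounts to [h <= e / 768]; the other term keeps [h] below
   1/4. *)
pose h : R := Num.min 8^-1 (e / 768).
have h0 : 0 < h by rewrite lt_min; apply/andP; split; lra.
have h8 : h <= 8^-1 by rewrite ge_min lexx.
have he : h <= e / 768 by rewrite ge_min lexx orbT.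
have h4 : h < 4^-1 by lra.
have [aK sK uK] := frus_class n3 h0 h4.
exists (frustum n h) => // K' [aK' KK' nle].
have V : fine (vol K') <= 48 * h ^+ 2.
  rewrite leNgt; apply: contra nle => lt.
  have [q1 [q2 [s1 s2 q12]]] := flat_two_stable aK' h0 (fun x Kx => frus_bounds h0 (KK' x Kx)) lt.
  exact: pair_card_le sK s1 s2 q12.
apply: le_trans V _; apply: (@le_trans _ _ (e * (16^-1 * h))); last first.
  by rewrite ler_pM2l//; exact: frus_vol.
have : h * h <= e / 768 * h by rewrite ler_pM2r.
by rewrite expr2; lra.
Qed.

Lemma rho_u_n2 (R : realType) (n : nat) : (2 < n)%N -> rho_u R n 2 = 1.
Proof.
move=> n3; apply: sup_robustness => [K [/admissible_body]//|e e0].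
(* A fraction [e] of the volume bound [bip_height M / 64 = 384 * M] is then [768 * (e + 1)], above
   the threshold 600. *)
pose M : R := 2 + 2 / e.
have e2 : 0 < 2 / e by rewrite divr_gt0.
have M1 : 1 < M by rewrite /M; lra.
have [aK sK uK] := bip_class n3 M1.
exists (bipyramid n M) => // K' [aK' KK' nle].
have V : fine (vol K') <= 600.
  rewrite leNgt; apply: contra nle => lt.
  have bd x : K' x -> `|x 0 0| <= 1 /\ `|x 0 i1| <= 1.
    by move=> /KK'/(bip_bounds M1)[].
  have [q1 [q2 [s1 s2 q12]]] := long_two_unstable aK' bd lt.
  exact: pair_card_le uK s1 s2 q12.
apply: le_trans V _; apply: (@le_trans _ _ (e * (64^-1 * bip_height M))); last first.
  by rewrite ler_pM2l//; exact: bip_vol.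
have E : e * M = 2 * e + 2 by rewrite /M; field; rewrite gt_eqF.
have -> : e * (64^-1 * bip_height M) = 384 * (e * M) by rewrite bip_ML; field.
by rewrite E; lra.
Qed.

Theorem theorem6 (R : realType) (n : nat) (hn : (2 < n)%N) :
  rho_s R 2 n = 1 /\ rho_u R n 2 = 1.
Proof. by split; [exact: rho_s_2n|exact: rho_u_n2]. Qed.
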